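(* Let $u\in C(\mathbb R;H^1(\mathbb T;\mathbb R))$ be a solution of the Benjamin--Bona--Mahony equation $$(1-\partial_x^2)u_t+\partial_x\Big(u+\frac{u^2}{2}\Big)=0\qquad\text{on }\mathbb T\times\mathbb R .$$ If $u=C$ on $\omega\times(0,T)$ for some $C\in\mathbb R$, some nonempty open set $\omega\subset\mathbb T$, and some $T>0$, then $u\equiv C$ on $\mathbb T\times\mathbb R$.
   Context: $\mathbb T=\mathbb R/(2\pi\mathbb Z)$. A solution $u\in C(\mathbb R;H^1(\mathbb T;\mathbb R))$ is understood in the sense of distributions; equivalently, $u\in C^1(\mathbb R;H^1(\mathbb T))$ and $u_t=-(1-\partial_x^2)^{-1}\partial_x(u+u^2/2)$ for all $t$, where $(1-\partial_x^2)^{-1}$ is the Fourier multiplier $(1+k^2)^{-1}$, $k\in\mathbb Z$. *)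

(* Defs.v *)
From HB Require Import structures.
From mathcomp Require Import all_boot all_order all_algebra.
From mathcomp Require Import all_classical all_reals all_analysis.

Set Implicit Arguments.
Unset Strict Implicit.
Unset Printing Implicit Defensive.

Import Order.TTheory GRing.Theory Num.Theory.
Import numFieldNormedType.Exports.

Local Open Scope classical_set_scope.
Local Open Scope ring_scope.

(** Functions on the circle T = R/(2 pi Z) are functions on R satisfying
    [periodic f (pi *+ 2)]; integrals over T are taken over [circle], one full
    period. *)
Definition circle (R : realType) : set R := `[0, pi *+ 2].
Arguments circle R : clear implicits.

(** The open subsets of T, seen through their preimages in R. *)
Definition open_circle (R : realType) (w : set R) : Prop :=
  open w /\ forall x : R, w (x + pi *+ 2) <-> w x.

Definition L2_circle (R : realType) (g : R -> R) : Prop :=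
  [/\ periodic g (pi *+ 2), measurable_fun setT g &
      (@lebesgue_measure R).-integrable (circle R)
        (fun x => (g x ^+ 2)%:E)].

Definition smooth_circle (R : realType) (phi : R -> R) : Prop :=
  periodic phi (pi *+ 2) /\ forall n (x : R), derivable (derive1n n phi) x 1.

(** [g] in L^2(T) is the derivative of [f] in the sense of distributions
    on T. *)
Definition weak_derivative (R : realType) (f g : R -> R) : Prop :=
  L2_circle g /\
  forall phi : R -> R, smooth_circle phi ->
    \int[lebesgue_measure]_(x in circle R) (f x * derive1 phi x) =
    - \int[lebesgue_measure]_(x in circle R) (g x * phi x).

(** H^1(T; R), each class being represented by its unique continuous
    member. *)
Definition H1 (R : realType) (f : R -> R) : Prop :=
  [/\ periodic f (pi *+ 2), continuous f & exists g, weak_derivative f g].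

(** Weak derivatives are unique only almost everywhere; the norm does not
    depend on the one that is picked. *)
Definition wderiv (R : realType) (f : R -> R) : R -> R :=
  xget (fun=> 0) [set g | weak_derivative f g].

Definition H1norm (R : realType) (f : R -> R) : R :=
  Num.sqrt (\int[lebesgue_measure]_(x in circle R) (f x ^+ 2 + wderiv f x ^+ 2)).

(** C(R; H^1(T; R)): the time variable comes first. *)
Definition continuous_H1 (R : realType) (u : R -> R -> R) : Prop :=
  (forall t, H1 (u t)) /\
  forall t : R, H1norm (u s \- u t) @[s --> t] --> (0 : R).

Definition dt (R : realType) (phi : R -> R -> R) : R -> R -> R :=
  fun t x => derive1 (phi ^~ x) t.

Definition dx (R : realType) (phi : R -> R -> R) : R -> R -> R :=
  fun t x => derive1 (phi t) x.

(** Iterated partial derivative along a word: [true] stands for d/dt and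
    [false] for d/dx. *)
Definition partials (R : realType) (w : seq bool) (phi : R -> R -> R) :
    R -> R -> R :=
  foldr (fun b psi => if b then dt psi else dx psi) phi w.

(** C^infinity in two variables: all iterated partial derivatives, in every
    order, exist and are jointly continuous. *)
Definition smooth2 (R : realType) (phi : R -> R -> R) : Prop :=
  forall w : seq bool,
    [/\ continuous (fun z : R * R => partials w phi z.1 z.2),
        forall t x : R, derivable (partials w phi ^~ x) t 1 &
        forall t x : R, derivable (partials w phi t) x 1].

(** C^infinity_c(T x R): as T is compact, the support is compact as soon as it
    is bounded in time. *)
Definition test_function (R : realType) (phi : R -> R -> R) : Prop :=
  [/\ smooth2 phi, forall t, periodic (phi t) (pi *+ 2) &
      exists M : R, forall t x : R, M < `|t| -> phi t x = 0].

(** (1 - d_x^2) u_t + d_x (u + u^2/2) = 0 in the sense of distributions on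
    T x R, all derivatives being moved to the test function, with a global
    change of sign. *)
Definition BBM_distributional (R : realType) (u : R -> R -> R) : Prop :=
  forall phi : R -> R -> R, test_function phi ->
    \int[lebesgue_measure]_(t in [set: R])
      (\int[lebesgue_measure]_(x in circle R)
         (u t x * (dt phi t x - dx (dx (dt phi)) t x)
          + (u t x + u t x ^+ 2 / 2) * dx phi t x)) = 0.

Definition BBM_solution (R : realType) (u : R -> R -> R) : Prop :=
  continuous_H1 u /\ BBM_distributional u.

(* Main.v *)
Require Import Defs.
From HB Require Import structures.
From mathcomp Require Import all_boot all_order all_algebra.
From mathcomp Require Import all_classical all_reals all_analysis.
From mathcomp Require Import measurable_realfun ring lra.

Set Implicit Arguments.
Unset Strict Implicit.
Unset Printing Implicit Defensive.

Import Order.TTheory GRing.Theory Num.Theory.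
Import numFieldNormedType.Exports.

Local Open Scope classical_set_scope.
Local Open Scope ring_scope.

(** The equation is the ODE u_t = - w_x in C(T), where w - w_xx = u + u^2/2; the
    nonlinearity is quadratic and the Green operator bounded, so u is analytic in time
    and u = C on omega for all times. Put v = u - C and phi(v) = (1 + C) v + v^2/2, so
    that v_t = - w_x with w - w_xx = phi(v). On omega, v = 0 and w_x = 0 for all times,
    hence w = 0 there: cutting the circle at a point x0 of omega, nothing flows through x0.
    If Phi' = phi, then A(t) = int_{x0}^{x0 + 2 pi} exp(2 x) Phi(v) dx satisfies
    A' = - int exp(2 x) (w_x + w)^2 <= 0. Conservation of the H^1 energy bounds v and makes
    it equicontinuous, uniformly in time. Thus A is bounded, and there are times tending
    to + and - infinity at which w_x + w is small in L^2, whence w, phi(v), v and finally A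
    are small there. As A is monotone, A = 0, so that w_x + w = 0 at all times, and the
    same chain of estimates gives v = 0. *)

(** * Calculus for continuous functions *)

Section ContinuousCombinators.
Context {R : realType} {T : topologicalType}.
Implicit Types f g : T -> R.

(** With weight [exp(2 x)], the term [- phi(v) w_x = - (w - w_xx) w_x] becomes an exact x-derivative
    minus a perfect square. The weight is not periodic, so boundary terms remain unless [w] and
    [w_x] vanish at the cut. This is what omega provides, and it must hold at all times because the
    squeeze on A uses times near both infinities. Two obstacles shape the rest. As v is merely H^1,
    the energy identity is derived for averages over short intervals. Its error is made small after
    the time has been fixed, so the resulting bound does not depend on time; what is kept of it is a
    Holder modulus of exponent 1/2. It is needed because a small [w] makes [phi(v) = w - w_xx] small
    only on average. Moreover [phi] has a second zero, [- 2 (1 + C)], so a small [phi(v)] need not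
    mean a small v: the value v(x0) = 0 and continuity in x select the right zero. The passage from
    distributions to an ODE is made mode by mode, with test functions [A(t) cos(k x + th)]; a
    continuous function whose modes all vanish is then shown to be 0. *)

Lemma ct_cst (c : R) : continuous (fun _ : T => c).
Proof. by move=> x; exact: cvg_cst. Qed.

Lemma ctD f g : continuous f -> continuous g -> continuous (fun x => f x + g x).
Proof. by move=> cf cg x; apply: cvgD; [exact: cf|exact: cg]. Qed.

Lemma ctN f : continuous f -> continuous (fun x => - f x).
Proof. by move=> cf x; apply: cvgN; exact: cf. Qed.

Lemma ctM f g : continuous f -> continuous g -> continuous (fun x => f x * g x).
Proof. by move=> cf cg x; apply: cvgM; [exact: cf|exact: cg]. Qed.

Lemma ctX f n : continuous f -> continuous (fun x => f x ^+ n).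
Proof.
move=> cf; elim: n => [|n IH].
  by under eq_fun do rewrite expr0; exact: ct_cst.
by under eq_fun do rewrite exprS; exact: ctM.
Qed.

Lemma ct_norm f : continuous f -> continuous (fun x => `|f x|).
Proof. by move=> cf x; apply: cvg_norm; exact: cf. Qed.

Lemma ct_comp (f : R -> R) g : continuous f -> continuous g -> continuous (fun x => f (g x)).
Proof. by move=> cf cg x; apply: (@continuous_comp _ _ _ g f); [exact: cg|exact: cf]. Qed.

Definition cont2 (f : R -> R -> R) := continuous (fun z : R * R => f z.1 z.2).

Lemma ct_comp2 (f : R -> R -> R) a b :
  cont2 f -> continuous a -> continuous b -> continuous (fun x : T => f (a x) (b x)).
Proof.
move=> cf ca cb x.
apply: (@continuous_comp _ _ _ (fun x => (a x, b x)) (fun z : R * R => f z.1 z.2)).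
  exact: cvg_pair (ca x) (cb x).
exact: cf.
Qed.

Lemma ct_sum (n : nat) (F : nat -> T -> R) :
  (forall k, (k <= n)%N -> continuous (F k)) ->
  continuous (fun x => \sum_(k < n.+1) F k x).
Proof.
elim: n => [|n IH] cF.
  by under eq_fun do rewrite big_ord1; exact: cF.
under eq_fun do rewrite big_ord_recr /=.
apply: ctD; last exact: cF.
by apply: IH => k kn; apply: cF; rewrite (leq_trans kn).
Qed.

End ContinuousCombinators.

Lemma ct_id {R : realType} : continuous (fun x : R => x).
Proof. by move=> x; exact: cvg_id. Qed.

Lemma ct_fst {R : realType} : continuous (fun z : R * R => z.1).
Proof. by move=> z; exact: cvg_fst. Qed.

Lemma ct_snd {R : realType} : continuous (fun z : R * R => z.2).
Proof. by move=> z; exact: cvg_snd. Qed.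

Lemma ct_expR {R : realType} : continuous (@expR R).
Proof. exact: continuous_expR. Qed.

Lemma ct_cos {R : realType} : continuous (@cos R).
Proof. exact: continuous_cos. Qed.

Ltac ct := lazymatch goal with
  | |- cont2 _ => first [ assumption | rewrite /cont2; ct ]
  | |- forall z, continuous_at z ?F =>
  lazymatch F with
  | (fun=> ?c) => exact: ct_cst
  | (fun x => x) => exact: ct_id
  | (fun x => @GRing.add _ (@?f x) (@?g x)) => apply: (@ctD _ _ f g); ct
  | (fun x => @GRing.opp _ (@?f x)) => apply: (@ctN _ _ f); ct
  | (fun x => @GRing.mul _ (@?f x) (@?g x)) => apply: (@ctM _ _ f g); ct
  | (fun x => @GRing.exp _ (@?f x) ?n) => apply: (@ctX _ _ f n); ct
  | (fun x => @Num.norm _ _ (@?f x)) => apply: (@ct_norm _ _ f); ct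
  | (fun x => @expR _ (@?f x)) => apply: (@ct_comp _ _ _ f ct_expR); ct
  | (fun x => @cos _ (@?f x)) => apply: (@ct_comp _ _ _ f ct_cos); ct
  | _ => first [ assumption | exact: ct_id | exact: ct_fst | exact: ct_snd
      | match goal with
        | H : cont2 ?h |- _ => apply: (ct_comp2 (f := h) H); [ct|ct]
        | H : forall z, continuous_at z ?h |- _ => apply: (ct_comp (f := h) H); ct
        end ]
  end end.

(** * Derivatives in one variable *)

Section Derivatives.
Context {R : realType}.
Implicit Types f g F G : R -> R.

(* Unlike [is_derive], [dv] is invisible to type class resolution, which would otherwise
   fill in derivatives in a form of its own choosing. *)
Definition dv (x : R) F (u : R) : Prop := is_derive x (1 : R) F u.

Definition der F f := forall x, dv x F (f x).

Lemma dvD (x : R) F G u v : dv x F u -> dv x G v ->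
  dv x (fun y => F y + G y) (u + v).
Proof. by move=> hF hG; exact: is_deriveD. Qed.

Lemma dvN (x : R) F u : dv x F u -> dv x (fun y => - F y) (- u).
Proof. by move=> hF; exact: is_deriveN. Qed.

Lemma dvM (x : R) F G u v : dv x F u -> dv x G v ->
  dv x (fun y => F y * G y) (u * G x + F x * v).
Proof.
move=> hF hG; have -> : u * G x + F x * v = F x *: v + G x *: u by rewrite /GRing.scale /= addrC (mulrC u).
exact: is_deriveM.
Qed.

Lemma dv_cst (x c : R) : dv x (fun _ => c) 0.
Proof. exact: is_derive_cst. Qed.

Lemma dv_id (x : R) : dv x (fun y => y) 1.
Proof. exact: is_derive_id. Qed.

Lemma dvX (x : R) F u n : dv x F u ->
  dv x (fun y => F y ^+ n) (n%:R * F x ^+ n.-1 * u).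
Proof.
move=> hF; have -> : (fun y => F y ^+ n) = F ^+ n by apply/funext => y; rewrite exprfctE.
exact: is_deriveX.
Qed.

Lemma dv_comp (x : R) F G u v : dv x F u -> dv (F x) G v ->
  dv x (fun y => G (F y)) (v * u).
Proof. by move=> hF hG; exact: is_derive1_comp. Qed.

Lemma dv_exp (x : R) F u : dv x F u ->
  dv x (fun y => expR (F y)) (expR (F x) * u).
Proof. by move=> hF; apply: dv_comp => //; exact: is_derive_expR. Qed.

Lemma dv_cos (x : R) F u : dv x F u -> dv x (fun y => cos (F y)) (- sin (F x) * u).
Proof. by move=> hF; apply: dv_comp => //; exact: is_derive_cos. Qed.

Lemma dv_eq (x : R) F (u v : R) : dv x F u -> u = v ->
  dv x F v.
Proof. by move=> h <-. Qed.

Lemma dv_shift (x c : R) F u : dv (x + c) F u ->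
  dv x (fun y => F (y + c)) u.
Proof.
move=> h; rewrite -[u]mulr1; apply: (@dv_comp x (fun y => y + c) F 1 u) => //.
by apply: dv_eq; [apply: dvD; [exact: dv_id|exact: dv_cst]|rewrite addr0].
Qed.

Lemma dv_derive1 (x : R) F (u : R) : dv x F u -> derive1 F x = u.
Proof. by move=> h; rewrite derive1E; exact: (@derive_val _ _ _ _ _ _ _ h). Qed.

Lemma dv_cont F f : der F f -> continuous F.
Proof.
move=> h x; apply: differentiable_continuous; apply/derivable1_diffP.
by exact: (@ex_derive _ _ _ _ _ _ _ (h x)).
Qed.

Lemma der0_cst F : der F (fun=> 0) -> forall x y, F x = F y.
Proof. by move=> h x y; exact: (is_derive_0_is_cst _ _ h). Qed.

Lemma der_unique F G f : der F f -> der G f -> forall a b, F b - F a = G b - G a.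
Proof.
move=> hF hG a b.
have h : der (fun x => F x + - G x) (fun=> 0).
  by move=> x; apply: dv_eq; [apply: dvD; [exact: hF|apply: dvN; exact: hG]|rewrite subrr].
by have := der0_cst h b a; lra.
Qed.

Lemma der_MVT F f (a b : R) : a <= b -> der F f ->
  exists2 c, a <= c <= b & F b - F a = f c * (b - a).
Proof.
move=> ab h.
have [c cab ->] : exists2 c, c \in `[a, b] & F b - F a = f c * (b - a).
  apply: MVT_segment => // [x _|]; first exact: h.
  by apply: continuous_subspaceT; exact: dv_cont h.
by exists c => //; move: cab; rewrite in_itv.
Qed.

Lemma der_nondecr F f (a b : R) : a <= b -> der F f ->
  (forall x, a <= x <= b -> 0 <= f x) -> F a <= F b.
Proof.
move=> ab h f0; have [c cab E] := der_MVT ab h.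
by rewrite -subr_ge0 E mulr_ge0 ?subr_ge0 ?f0.
Qed.

End Derivatives.

Ltac dvt := repeat first [ assumption | match goal with H : dv _ _ _ |- _ => exact: H end | exact: dv_cst | exact: dv_id
  | apply: dvD | apply: dvN | apply: dvM | apply: dvX | apply: dv_exp | apply: dv_cos
  | match goal with H : der ?F ?f |- dv _ ?F _ => exact: H end
  | match goal with H : der ?F ?f |- dv _ (fun y => ?F (y + _)) _ =>
       apply: dv_shift; exact: H end ].

(** * Oriented integrals of continuous functions *)

Section Integral.
Context {R : realType}.
Implicit Types f g F G : R -> R.
Notation mu := (@lebesgue_measure R).

Lemma ct_integrable f (a b : R) : continuous f -> mu.-integrable `[a, b] (EFin \o f).
Proof.
move=> cf; apply: continuous_compact_integrable; first exact: segment_compact.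
exact: continuous_subspaceT.
Qed.

(* Oriented integrals of continuous functions are taken through a primitive that
   is defined on the whole line. *)
Definition prim f (x : R) : R :=
  if 0 <= x then \int[mu]_(y in `[0, x]) f y else - \int[mu]_(y in `[x, 0]) f y.

Definition J f (a b : R) := prim f b - prim f a.

Lemma Rint_split f (a b c : R) : continuous f -> a <= b -> b <= c ->
  \int[mu]_(y in `[a, c]) f y = \int[mu]_(y in `[a, b]) f y + \int[mu]_(y in `[b, c]) f y.
Proof.
move=> cf ab bc.
have := @Rintegral_itvB R f (BLeft a) (BRight c) b (ct_integrable a c cf).
rewrite !bnd_simp => /(_ ab bc).
rewrite Rintegral_itv_obnd_cbnd; first lra.
by apply: integrableS (ct_integrable b c cf) => //; apply: subset_itvr; rewrite bnd_simp.
Qed.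

Lemma prim_from f (a x : R) : continuous f -> a <= 0 -> a <= x ->
  prim f x = \int[mu]_(y in `[a, x]) f y - \int[mu]_(y in `[a, 0]) f y.
Proof.
move=> cf a0 ax; rewrite /prim; case: ifPn => [x0|]; last rewrite -ltNge => /ltW x0.
  by rewrite (Rint_split cf a0 x0); lra.
by rewrite (Rint_split cf ax x0); lra.
Qed.

Lemma der_prim f : continuous f -> der (prim f) f.
Proof.
(* A base point strictly below both 0 and x, so that near x [prim f] is the integral from [a] up to
   a constant and no case split at 0 remains. *)
move=> cf x; pose a := Num.min x 0 - 1.
have ax : a < x by rewrite /a; case: (leP x 0); lra.
have a0 : a < 0 by rewrite /a; case: (leP x 0); lra.
have [d e] := @continuous_FTC1_closed R f a x (x + 1) ltac:(lra) (ct_integrable a (x + 1) cf) ax (cf x).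
pose F y := \int[mu]_(t in `[a, y]) f t - \int[mu]_(y in `[a, 0]) f y.
have hF : dv x F (f x).
  rewrite -[f x]subr0; apply: dvD; last exact: dvN (dv_cst _ _).
  by rewrite -e derive1E; apply: derivableP.
apply: near_eq_is_derive hF.
near=> y; rewrite /F -prim_from//; [exact: ltW|].
by apply: ltW; near: y; exact: lt_nbhsr.
Unshelve. all: by end_near. Qed.

Lemma J_FTC F f a b : continuous f -> der F f -> J f a b = F b - F a.
Proof. by move=> cf dF; exact: der_unique (der_prim cf) dF a b. Qed.

Lemma J_Rint f (a b : R) : continuous f -> a <= b -> J f a b = \int[mu]_(y in `[a, b]) f y.
Proof.
move=> cf ab; pose c := Num.min a 0.
have ca : c <= a by rewrite /c; case: (leP a 0); lra.
have c0 : c <= 0 by rewrite /c; case: (leP a 0); lra.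
rewrite /J (@prim_from f c b)// ?(le_trans ca)// (@prim_from f c a)// (Rint_split cf ca ab); lra.
Qed.

Lemma Jaa f a : J f a a = 0. Proof. by rewrite /J subrr. Qed.

Lemma J_cat f b a c : J f a c = J f a b + J f b c. Proof. by rewrite /J; lra. Qed.

Lemma JD f g a b : continuous f -> continuous g ->
  J (fun x => f x + g x) a b = J f a b + J g a b.
Proof.
move=> cf cg; have df := der_prim cf; have dg := der_prim cg.
rewrite (@J_FTC (fun x => prim f x + prim g x)); [rewrite /J; lra|by ct|].
by move=> x; dvt.
Qed.

Lemma JZ c f a b : continuous f -> J (fun x => c * f x) a b = c * J f a b.
Proof.
move=> cf; have df := der_prim cf.
rewrite (@J_FTC (fun x => c * prim f x)); [rewrite /J; lra|by ct|].
by move=> x; apply: dv_eq; [dvt|rewrite mul0r add0r].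
Qed.

Lemma JN f a b : continuous f -> J (fun x => - f x) a b = - J f a b.
Proof.
by move=> cf; rewrite -mulN1r -JZ//; congr J; apply/funext => x; rewrite mulN1r.
Qed.

Lemma JB f g a b : continuous f -> continuous g ->
  J (fun x => f x - g x) a b = J f a b - J g a b.
Proof. by move=> cf cg; rewrite JD ?JN//; ct. Qed.

Lemma J_cst c (a b : R) : J (fun=> c) a b = c * (b - a).
Proof.
rewrite (@J_FTC (fun x => c * x)); [by rewrite mulrBr|by ct|].
by move=> x; apply: dv_eq; [dvt|by rewrite mul0r mulr1 add0r].
Qed.

Lemma eq_J f g (a b : R) : continuous f -> continuous g -> a <= b ->
  (forall x, a <= x <= b -> f x = g x) -> J f a b = J g a b.
Proof.
move=> cf cg ab fg; rewrite !J_Rint//; apply: eq_Rintegral => x.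
by rewrite inE /= in_itv /= => /fg.
Qed.

Lemma le_J f g (a b : R) : continuous f -> continuous g -> a <= b ->
  (forall x, a <= x <= b -> f x <= g x) -> J f a b <= J g a b.
Proof.
move=> cf cg ab fg; rewrite !J_Rint//; by apply: le_Rintegral => //; exact: ct_integrable.
Qed.

Lemma J_ge0 f (a b : R) : continuous f -> a <= b ->
  (forall x, a <= x <= b -> 0 <= f x) -> 0 <= J f a b.
Proof.
move=> cf ab f0; have := @le_J (fun=> 0) f a b ltac:(ct) cf ab f0.
by rewrite J_cst mul0r.
Qed.

Lemma J_norm_le f (a b M : R) : continuous f -> a <= b ->
  (forall x, a <= x <= b -> `|f x| <= M) -> `|J f a b| <= M * (b - a).
Proof.
move=> cf ab fM; rewrite ler_norml; apply/andP; split.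
  rewrite -mulNr -J_cst; apply: le_J => //; first by ct.
  by move=> x /fM; rewrite ler_norml => /andP[].
rewrite -J_cst; apply: le_J => //; first by ct.
by move=> x /fM; rewrite ler_norml => /andP[].
Qed.

Lemma J_shift f c a b : continuous f -> J (fun x => f (x + c)) a b = J f (a + c) (b + c).
Proof.
move=> cf; have df := der_prim cf.
rewrite (@J_FTC (fun x => prim f (x + c))) //; first by ct.
by move=> x; dvt.
Qed.

Lemma J_parts F G f g a b : der F f -> der G g -> continuous f -> continuous g ->
  J (fun x => F x * g x) a b = F b * G b - F a * G a - J (fun x => f x * G x) a b.
Proof.
move=> dF dG cf cg; have cF := dv_cont dF; have cG := dv_cont dG.
have <- : J (fun x => f x * G x + F x * g x) a b = F b * G b - F a * G a.
  rewrite (@J_FTC (fun x => F x * G x)) //; first by ct.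
  by move=> x; dvt.
by rewrite JD; [lra|ct|ct].
Qed.

Lemma J_periodic f T a b : continuous f -> periodic f T -> J f a (a + T) = J f b (b + T).
Proof.
move=> cf pf; have df := der_prim cf.
suff h : der (fun x => prim f (x + T) - prim f x) (fun=> 0) by exact: (der0_cst h).
by move=> x; apply: dv_eq; [dvt|rewrite pf subrr].
Qed.

End Integral.

(** * Joint continuity, differentiation under the integral, Fubini *)

Section TwoVariables.
Context {R : realType}.
Implicit Types f g F G : R -> R.

(** Tube lemma: around each [k] a product neighbourhood keeps [F] close to [F (t0, k)], and
    compactness yields a common neighbourhood of [t0]. *)
Lemma uniform_on_compact (T X : topologicalType) (K : set X) (F : T * X -> R) (t0 : T) (e : R) :
  compact K -> continuous F -> 0 < e ->
  \forall t \near t0, forall k, K k -> `|F (t, k) - F (t0, k)| < e.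
Proof.
move=> /compact_near_coveringP cK cF e0.
have := cK T (nbhs t0) (fun t k => `|F (t, k) - F (t0, k)| < e) _.
apply => k Kk.
have e2 : 0 < e / 2 by lra.
have /cvgrPdist_lt /(_ _ e2) [[A B] /= [nA nB] AB] := cF (t0, k).
exists (B, A) => //= -[k' t] /= [Bk' At].
have h1 := AB (t, k') (conj At Bk').
have h2 := AB (t0, k') (conj (nbhs_singleton nA) Bk').
move: h1 h2 => /=; rewrite !ltr_norml => /andP[? ?] /andP[? ?].
by apply/andP; split; lra.
Qed.

Lemma compact_le_bound (X : topologicalType) (K : set X) (F : X -> R) :
  compact K -> continuous F -> exists2 M : R, 0 < M & forall k, K k -> `|F k| <= M.
Proof.
move=> cK cF.
have := compact_bounded (continuous_compact (continuous_subspaceT cF) cK).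
move=> [M [_ /(_ (Num.max M 1 + 1)) h]].
exists (Num.max M 1 + 1); first by case: (leP M 1); lra.
by move=> k Kk; apply: h; [case: (leP M 1); lra|exists k].
Qed.

Lemma cont2_slice (f : R -> R -> R) t : cont2 f -> continuous (f t).
Proof. by move=> cf; apply: (ct_comp2 cf); ct. Qed.

Lemma cont2_slicel (f : R -> R -> R) x : cont2 f -> continuous (f ^~ x).
Proof. by move=> cf; apply: (ct_comp2 cf); ct. Qed.

Arguments cont2_slice {f} t _.
Arguments cont2_slicel {f} x _.

Lemma cont2_bound (f : R -> R -> R) (S a b : R) : cont2 f ->
  exists2 M : R, 0 < M & forall t x, `|t| <= S -> a <= x <= b -> `|f t x| <= M.
Proof.
move=> cf.
have [M M0 h] := compact_le_bound (compact_setX (@segment_compact R (- S) S) (@segment_compact R a b)) cf.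
exists M => // t x tS xab; apply: (h (t, x)); split => /=; rewrite in_itv //=.
by rewrite -ler_norml.
Qed.

Lemma cont2_equi (f : R -> R -> R) (S a b e : R) : cont2 f -> 0 < e ->
  exists2 d : R, 0 < d & forall t x h, `|t| <= S -> a <= x <= b -> `|h| < d ->
    `|f t (x + h) - f t x| < e.
Proof.
move=> cf e0.
(* The increment is taken as the parameter, near 0, while (t, x) ranges over a compact rectangle. *)
have cF : continuous (fun z : R * (R * R) => f z.2.1 (z.2.2 + z.1)).
  apply: (ct_comp2 cf).
    by move=> z; apply: (@continuous_comp _ _ _ (fun z : R * (R * R) => z.2) fst); [exact: cvg_snd|exact: cvg_fst].
  apply: ctD; last by move=> z; exact: cvg_fst.
  by move=> z; apply: (@continuous_comp _ _ _ (fun z : R * (R * R) => z.2) snd); [exact: cvg_snd|exact: cvg_snd].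
have := uniform_on_compact 0 (compact_setX (@segment_compact R (- S) S) (@segment_compact R a b)) cF e0.
rewrite nbhs0P /= => /nbhs_ballP[d d0 h].
exists d => // t x k tS xab kd.
have : ball (0 : R) d k by rewrite /ball /= sub0r normrN.
move=> /h /(_ (t, x)) /=; rewrite add0r addr0; apply; split => /=; rewrite in_itv //=.
by rewrite -ler_norml.
Qed.

Lemma J_norm_le_abs f (a b M : R) : continuous f ->
  (forall x, Num.min a b <= x <= Num.max a b -> `|f x| <= M) ->
  `|J f a b| <= M * `|b - a|.
Proof.
move=> cf h; case: (leP a b) h => [ab|/ltW ba] h.
  by rewrite (ger0_norm (_ : 0 <= b - a)) ?subr_ge0//; apply: J_norm_le.
rewrite (distrC b) (ger0_norm (_ : 0 <= a - b)) ?subr_ge0//.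
have -> : J f a b = - J f b a by rewrite /J; lra.
by rewrite normrN; apply: J_norm_le.
Qed.

Lemma prim0 f : prim f 0 = 0.
Proof. by rewrite /prim lexx set_itv1 Rintegral_set1. Qed.

Lemma cont2_prim (f : R -> R -> R) : cont2 f -> cont2 (fun t x => prim (f t) x).
Proof.
move=> cf [t0 x0]; apply/cvgrPdist_le => /= e e0.
have e2 : 0 < e / 2 by lra.
pose M := `|x0| + 1.
have M0 : 0 < M by have := normr_ge0 x0; rewrite /M; lra.
have eM : 0 < e / 2 / M by apply: divr_gt0.
have h1 := uniform_on_compact t0 (@segment_compact R (- M) M) cf eM.
have cp : continuous (prim (f t0)) by exact: dv_cont (der_prim (cont2_slice t0 cf)).
have /cvgrPdist_lt /(_ _ e2) h2 := cp x0.
have h3 : \forall x \near x0, `|x0 - x| < 1 by move/cvgrPdist_lt : (@cvg_id _ (nbhs x0)) => /(_ _ ltr01).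
have h4 : \forall x \near x0, `|x0 - x| < 1 /\ `|prim (f t0) x0 - prim (f t0) x| < e / 2.
  by near=> x; split; near: x.
exists ((fun t => forall k, `[- M, M]%classic k -> `|f t k - f t0 k| < e / 2 / M),
  (fun x => `|x0 - x| < 1 /\ `|prim (f t0) x0 - prim (f t0) x| < e / 2)) => //=.
move=> [t x] /= [ht [hx hp]].
have xM : `|x| <= M.
  by rewrite -[x](subrK x0) (le_trans (ler_normD _ _))// distrC /M; lra.
have k : `|J (fun y => f t y - f t0 y) 0 x| <= e / 2 / M * `|x - 0|.
  apply: J_norm_le_abs; first by apply: ctD; [|apply: ctN]; exact: cont2_slice.
  move=> y yx; apply/ltW/ht; rewrite /= in_itv /=.
  move: xM; rewrite ler_norml; move: yx; case: (leP 0 x); lra.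
have e3 : e / 2 / M * `|x - 0| <= e / 2.
  by rewrite subr0 -[leRHS](divfK (lt0r_neq0 M0)) ler_wpM2l// ltW.
have := le_trans k e3.
rewrite JB; [|exact: cont2_slice|exact: cont2_slice].
rewrite /J !prim0 !subr0; move: hp; rewrite ltr_norml !ler_norml => /andP[? ?] /andP[? ?].
by apply/andP; split; lra.
Unshelve. all: by end_near. Qed.

Lemma ct_J (T : topologicalType) (f : R -> R -> R) (t a b : T -> R) : cont2 f ->
  continuous t -> continuous a -> continuous b -> continuous (fun z => J (f (t z)) (a z) (b z)).
Proof.
by move=> cf ct ca cb; apply: ctD; last apply: ctN; apply: (ct_comp2 (cont2_prim cf)).
Qed.

Lemma dv_eps F (x l : R) :
  (forall e : R, 0 < e -> exists2 d : R, 0 < d & forall h, `|h| < d ->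
     `|F (x + h) - F x - h * l| <= e * `|h|) -> dv x F l.
Proof.
move=> H.
have c : h^-1 *: ((F \o shift x) (h *: (1 : R)) - F x) @[h --> (0 : R)^'] --> l.
  apply/cvgrPdist_le => e e0; have [d d0 hd] := H e e0.
  near=> h.
  have h0 : h != 0 by near: h; exact: nbhs_dnbhs_neq.
  have hh : `|h| < d.
    by near: h; apply: dnbhs0_lt.
  have := hd h hh.
  rewrite /= /shift /= /GRing.scale /= mulr1 (addrC h x) => k.
  have -> : l - h^-1 * (F (x + h) - F x) = - (h^-1 * (F (x + h) - F x - h * l)).
    by field.
  by rewrite normrN normrM normfV mulrC ler_pdivrMr// normr_gt0.
by apply: DeriveDef; [apply/cvg_ex; exists l|apply: cvg_lim].
Unshelve. all: by end_near. Qed.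

Lemma der_J_param (f ft : R -> R -> R) (a b : R) : cont2 f -> cont2 ft ->
  (forall x, der (f ^~ x) (ft ^~ x)) -> a <= b ->
  der (fun t => J (f t) a b) (fun t => J (ft t) a b).
Proof.
move=> cf cft df ab t; apply: dv_eps => e e0.
have eM : 0 < e / (b - a + 1) by rewrite divr_gt0//; lra.
have := uniform_on_compact t (@segment_compact R a b) cft eM.
move=> /nbhs_ballP[d d0 hd]; exists d => // h hh.
have -> : J (f (t + h)) a b - J (f t) a b - h * J (ft t) a b =
  J (fun x => f (t + h) x - f t x - h * ft t x) a b.
  have := cont2_slice t cf; have := cont2_slice (t + h) cf; have := cont2_slice t cft.
  by move=> c1 c2 c3; rewrite JB; [rewrite JB// JZ//|ct|ct].
apply: (@le_trans _ _ (e / (b - a + 1) * `|h| * (b - a))); last first.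
  rewrite mulrAC ler_wpM2r//; rewrite mulrAC ler_pdivrMr; last lra.
  by rewrite ler_wpM2l//; lra.
apply: J_norm_le => //.
  have := cont2_slice t cf; have := cont2_slice (t + h) cf; have := cont2_slice t cft.
  by move=> c1 c2 c3; ct.
move=> x xab.
have [c [ch E]] : exists c, `|c - t| <= `|h| /\ f (t + h) x - f t x = ft c x * h.
  case: (leP 0 h) => h0.
    have th : t <= t + h by lra.
    have [c c1 c2] := der_MVT th (df x).
    by exists c; rewrite c2; split; [rewrite !ger0_norm; lra|ring].
  have th : t + h <= t by lra.
  have [c c1 c2] := der_MVT th (df x).
  exists c; split; first by rewrite !ler0_norm; lra.
  by rewrite -[LHS]opprB c2; ring.
rewrite E (_ : _ - _ = (ft c x - ft t x) * h); last ring.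
rewrite normrM ler_wpM2r//; apply/ltW/hd => /=; last by rewrite in_itv.
by rewrite /ball /= distrC (le_lt_trans ch).
Qed.

(** As functions of the endpoint [d], both sides vanish at [d = c] and have the same derivative, by
    differentiation under the integral. *)
Lemma J_swap (f : R -> R -> R) (a b c d : R) : cont2 f -> a <= b ->
  J (fun x => J (f ^~ x) c d) a b = J (fun t => J (f t) a b) c d.
Proof.
move=> cf ab.
have cf' : cont2 (fun x t => f t x).
  by apply: (ct_comp2 cf); ct.
have cK : cont2 (fun t x => J (f ^~ x) c t).
  by apply: (@ct_J _ (fun x t => f t x) snd (fun=> c) fst); ct.
have cg : continuous (fun t => J (f t) a b) by apply: (ct_J (t := id)); ct.
rewrite [RHS](J_FTC _ _ cg (F := fun d => J (fun x => J (f ^~ x) c d) a b)).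
  rewrite [X in _ - X](_ : _ = 0) ?subr0//.
  rewrite (_ : (fun x => _) = (fun _ => 0)) ?J_cst ?mul0r//.
  by apply/funext => x; rewrite Jaa.
apply: (der_J_param cK cf _ ab) => x t; rewrite -[f t x]addr0.
apply: dvD; first exact: (der_prim (cont2_slicel x cf)).
by rewrite -oppr0; apply: dvN; exact: dv_cst.
Qed.

End TwoVariables.
Arguments cont2_slice {R f} t _.
Arguments cont2_slicel {R f} x _.

(** * Strict positivity of integrals, growth of powers *)

Section Positivity.
Context {R : realType}.
Implicit Types f g F G : R -> R.

Lemma ct_eps f x (e : R) : continuous f -> 0 < e ->
  exists2 d : R, 0 < d & forall y, `|y - x| < d -> `|f y - f x| < e.
Proof.
move=> cf e0; have /cvgrPdist_lt /(_ _ e0) /nbhs_ballP[d d0 hd] := cf x.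
exists d => // y yd; rewrite distrC; apply: hd.
by rewrite /ball /= distrC.
Qed.

Lemma ex_lt2 (x y : R) : 0 < x -> 0 < y -> exists d : R, [/\ 0 < d, d < x & d < y].
Proof. by move=> x0 y0; exists (Num.min x y / 2); case: (leP x y) => ?; split; lra. Qed.

Lemma J_gt0 f (a b c : R) : continuous f -> a < b -> a <= c <= b ->
  (forall x, a <= x <= b -> 0 <= f x) -> 0 < f c -> 0 < J f a b.
Proof.
move=> cf ab cab f0 fc.
have fc2 : 0 < f c / 2 by lra.
have [d d0 hd] := ct_eps c cf fc2.
have [c1 [c2 [c12 ac1 c2b dc]]] : exists c1 c2 : R,
    [/\ c1 < c2, a <= c1, c2 <= b & forall x, c1 <= x <= c2 -> `|x - c| < d].
  exists (Num.max a (c - d / 2)), (Num.min b (c + d / 2)); split.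
  - by case: (leP a (c - d / 2)); case: (leP b (c + d / 2)); lra.
  - by case: (leP a (c - d / 2)); lra.
  - by case: (leP b (c + d / 2)); lra.
  - move=> x; case: (leP a (c - d / 2)); case: (leP b (c + d / 2));
      by rewrite ltr_norml; lra.
rewrite (J_cat f c1) (J_cat f c2 c1).
have h1 : 0 <= J f a c1 by apply: J_ge0 => // x ?; apply: f0; lra.
have h2 : 0 <= J f c2 b by apply: J_ge0 => // x ?; apply: f0; lra.
have h3 : J (fun=> f c / 2) c1 c2 <= J f c1 c2.
  apply: le_J => //; [by ct|lra|move=> x /dc /hd].
  by rewrite ltr_norml; lra.
have h4 : 0 < f c / 2 * (c2 - c1) by rewrite mulr_gt0//; lra.
by move: h3; rewrite J_cst; lra.
Qed.

Lemma exprn_unbounded (q M : R) : 1 < q -> exists n, M < q ^+ n.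
Proof.
move=> q1.
have [n hn] : exists n : nat, M / (q - 1) < n%:R.
  by exists (Num.bound `|M / (q - 1)|); apply: le_lt_trans (ler_norm _) (archi_boundP (normr_ge0 _)).
(* Bernoulli's inequality [1 + n (q - 1) <= q ^ n]. *)
exists n; apply: (@lt_le_trans _ _ (1 + n%:R * (q - 1))).
  by move: hn; rewrite ltr_pdivrMr; lra.
elim: n {hn} => [|n IH]; first by rewrite mul0r addr0 expr0.
rewrite exprS -natr1; have := ler_wpM2l (_ : 0 <= q) IH.
move=> /(_ ltac:(lra)) h; apply: le_trans h.
have : 0 <= n%:R * (q - 1) ^+ 2 by rewrite mulr_ge0// sqr_ge0.
rewrite expr2; lra.
Qed.

End Positivity.

(** * Trigonometric uniqueness *)

Section Fourier.
Context {R : realType}.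
Notation P := (pi *+ 2 : R).

Lemma le_cos : {in `[0, pi] &, {mono @cos R : x y /~ y <= x}}.
Proof. by move=> x y xI yI; rewrite !leNgt ltr_cos. Qed.

Lemma cos_far (d y : R) : 0 < d -> d <= pi -> d <= `|y| -> `|y| <= P - d -> cos y <= cos d.
Proof.
move=> d0 dpi dy yd.
rewrite -(cos_norm y); case: (leP `|y| pi) => yp.
  by rewrite le_cos ?in_itv /=; lra.
have -> : cos `|y| = cos (P - `|y|).
  by rewrite addrC cosD2pi cosN.
by rewrite le_cos ?in_itv /= ?mulr2n; rewrite mulr2n in yd; lra.
Qed.

Lemma cos_near (d y : R) : 0 < d -> d <= pi -> `|y| <= d -> cos d <= cos y.
Proof.
move=> d0 dpi yd.
rewrite -(cos_norm y).
by rewrite le_cos ?in_itv /=; have := normr_ge0 y; lra.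
Qed.

(** By the product-to-sum formula, a factor [cos (x - a)] only moves the frequency by 1 and the
    phase by [a]. Quantifying over all [k] and [th] is what lets the induction on [n] close. *)
Lemma trig_kernel_orth (D : R -> R) (a c : R) n : continuous D ->
  (forall (k : int) th, J (fun x => D x * cos (k%:~R * x + th)) 0 P = 0) ->
  forall (k : int) th, J (fun x => D x * cos (k%:~R * x + th) * (c + cos (x - a)) ^+ n) 0 P = 0.
Proof.
move=> cD h; elim: n => [|n IH] k th.
  by rewrite -[RHS](h k th); congr J; apply/funext => x; rewrite expr0 mulr1.
pose g k th x := D x * cos (k%:~R * x + th) * (c + cos (x - a)) ^+ n.
have cg k' th' : continuous (g k' th') by rewrite /g; ct.
transitivity (J (fun x => c * g k th x + (2^-1 * g (k + 1) (th - a) x + 2^-1 * g (k - 1) (th + a) x)) 0 P).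
  congr J; apply/funext => x; rewrite /g exprS.
  have -> : (k + 1)%:~R * x + (th - a) = (k%:~R * x + th) + (x - a) :> R by rewrite intrD /=; ring.
  have -> : (k - 1)%:~R * x + (th + a) = (k%:~R * x + th) - (x - a) :> R by rewrite intrB /=; ring.
  by move: (k%:~R * x + th) (x - a) => A B; rewrite cosD cosB; field.
have z k' th' : J (g k' th') 0 P = 0 by exact: IH.
have c1 := cg k th; have c2 := cg (k + 1) (th - a); have c3 := cg (k - 1) (th + a).
rewrite JD; [|by ct|by ct]; rewrite JD; [|by ct|by ct].
by rewrite !JZ// !z; lra.
Qed.

End Fourier.

Section FourierUniqueness.
Context {R : realType}.
Notation P := (pi *+ 2 : R).

(* If D a > 0, the kernel (1 - cos d + cos (x - a)) ^ n blows up near [a] while it stays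
   bounded by 1 at distance at least [d] from [a]. *)
Lemma fourier_le0 (D : R -> R) : continuous D ->
  (forall (k : int) th, J (fun x => D x * cos (k%:~R * x + th)) 0 P = 0) ->
  forall x, 0 < x < P -> D x <= 0.
Proof.
move=> cD h a a0; rewrite leNgt; apply/negP => Da.
have Da2 : 0 < D a / 2 by lra.
have [d1 d10 hd] := ct_eps a cD Da2.
have pi0 := pi_gt0 R.
have [d [d0 dd1 da [dP dpi]]] : exists d : R, [/\ 0 < d, d < d1, d < a & d < P - a /\ d < pi].
  have [e1 [e10 e1d e1a]] := ex_lt2 d10 (proj1 (andP a0)).
  have aP : 0 < P - a by lra.
  have [e2 [e20 e2p e2pi]] := ex_lt2 aP pi0.
  have [d [d0 dd1 dd2]] := ex_lt2 e10 e20.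
  by exists d; split; [|lra|lra|split; lra].
have [B B0 hB] := compact_le_bound (@segment_compact R 0 P) cD.
pose q x := 1 - cos d + cos (x - a).
have cq : continuous q by rewrite /q; ct.
(* A lower bound for the kernel on the half-size interval [|x - a| <= d / 2]; it exceeds 1 because
   [cos] decreases. *)
pose q0 := 1 - cos d + cos (d / 2).
have q01 : 1 < q0.
  have : cos d < cos (d / 2) by rewrite ltr_cos ?in_itv /=; lra.
  by rewrite /q0; lra.
(* This power makes the central contribution, at least [D a / 2 * q0 ^+ n * d], larger than [B * P],
   which is more than the rest of the period can subtract. *)
have [n hn] := exprn_unbounded (B * P / (D a / 2 * d)) q01.
have z : J (fun x => D x * q x ^+ n) 0 P = 0.
  rewrite -[RHS](trig_kernel_orth a (1 - cos d) n cD h 0 0); congr J; apply/funext => x.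
  by rewrite mul0r addr0 cos0 mulr1.
have cf : continuous (fun x => D x * q x ^+ n) by ct.
(* Within [d] of [a] both factors are nonnegative; farther away the kernel has modulus at most 1. *)
have low x : 0 <= x <= P -> - B <= D x * q x ^+ n.
  move=> x0P; case: (leP `|x - a| d) => xa.
    have q1 : 1 <= q x by have := cos_near d0 (ltW dpi) xa; rewrite /q; lra.
    have Dx : 0 <= D x by have := hd x (le_lt_trans xa dd1); rewrite ltr_norml; lra.
    by rewrite (@le_trans _ _ 0)//; [lra|rewrite mulr_ge0// exprn_ge0//; lra].
  have xaP : `|x - a| <= P - d by rewrite ler_norml; lra.
  have q1 : `|q x| <= 1.
    have c1 := cos_far d0 (ltW dpi) (ltW xa) xaP.
    have c2 := cos_geN1 (x - a); have c3 := cos_le1 d.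
    have c4 := cos_geN1 d; rewrite ler_norml /q; lra.
  have DB : `|D x| <= B by apply: hB; rewrite /= in_itv.
  have : `|D x * q x ^+ n| <= B.
    rewrite normrM normrX -[leRHS]mulr1 ler_pM ?normr_ge0 ?exprn_ge0//.
    by apply: exprn_ile1.
  by rewrite ler_norml => /andP[].
have h1 : - B * (a - d / 2) <= J (fun x => D x * q x ^+ n) 0 (a - d / 2).
  have := @le_J _ (fun=> - B) _ 0 (a - d / 2) ltac:(ct) cf.
  by rewrite J_cst subr0; apply; [lra|move=> x ?; apply: low; lra].
have h2 : - B * (P - (a + d / 2)) <= J (fun x => D x * q x ^+ n) (a + d / 2) P.
  rewrite -J_cst; apply: le_J => //; [by ct|lra|move=> x ?; apply: low; lra].
have h3 : D a / 2 * q0 ^+ n * d <= J (fun x => D x * q x ^+ n) (a - d / 2) (a + d / 2).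
  have := @le_J _ (fun=> D a / 2 * q0 ^+ n) _ (a - d / 2) (a + d / 2) ltac:(ct) cf.
  rewrite J_cst (_ : a + d / 2 - (a - d / 2) = d); last lra.
  apply; [lra|move=> x xa].
  have xa' : `|x - a| <= d / 2 by rewrite ler_norml; lra.
  apply: ler_pM; [lra|by rewrite exprn_ge0//; lra| |].
    have : `|x - a| < d1 by lra.
    by move=> /hd; rewrite ltr_norml; lra.
  apply: lerXn2r; rewrite ?nnegrE; [lra| |].
    have : q0 <= q x; last lra.
    by rewrite /q /q0 lerD2l; apply: cos_near => //; lra.
  by rewrite /q /q0 lerD2l; apply: cos_near => //; lra.
move: z; rewrite (J_cat _ (a - d / 2)) (J_cat _ (a + d / 2) (a - d / 2)).
move: hn; rewrite ltr_pdivrMr; last by rewrite mulr_gt0.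
have : 0 < B * d by rewrite mulr_gt0.
move: h1 h2 h3; lra.
Qed.

(** The one-sided bound is applied to [D] and [- D]. The kernel needs room on both sides of its
    centre, so the two endpoints are reached by continuity. *)
Lemma fourier_eq0 (D : R -> R) : continuous D ->
  (forall (k : int) th, J (fun x => D x * cos (k%:~R * x + th)) 0 P = 0) ->
  forall x, 0 <= x <= P -> D x = 0.
Proof.
move=> cD h.
have pi0 := pi_gt0 R.
have D0 x : 0 < x < P -> D x = 0.
  move=> x0; apply/eqP; rewrite eq_le fourier_le0//=.
  have cN : continuous (fun x => - D x) by ct.
  suff : - D x <= 0 by lra.
  apply: (fourier_le0 cN) => // k th.
  rewrite (_ : (fun _ => _) = (fun x => - (D x * cos (k%:~R * x + th)))).
    by rewrite JN ?h ?oppr0//; ct.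
  by apply/funext => y; rewrite mulNr.
move=> x xP; apply/eqP; rewrite -normr_le0 leNgt; apply/negP => Dx.
have [d d0 hd] := ct_eps x cD Dx.
have [y [yP yx]] : exists y : R, 0 < y < P /\ `|y - x| < d.
  have [e [e0 ed epi]] := ex_lt2 d0 pi0.
  case: (leP x pi) => xpi.
    by exists (x + e); rewrite ltr_norml mulr2n; split; lra.
  by exists (x - e); rewrite ltr_norml; rewrite mulr2n in xP *; split; lra.
by have := hd y yx; rewrite D0// sub0r normrN ltxx.
Qed.

End FourierUniqueness.

(** * Distributional equations in time *)

Section Bumps.
Context {R : realType}.
Implicit Types f g F G : R -> R.

(** The powers of [t^-1] are built in so that differentiation stays within linear combinations of
    the family; smoothness to all orders then follows by induction. *)
Definition flat (j : nat) (t : R) : R := if 0 < t then t^-1 ^+ j * expR (- t^-1) else 0.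

Lemma flat_ge0 j t : 0 <= flat j t.
Proof.
rewrite /flat; case: ifP => // t0.
by rewrite mulr_ge0 ?expR_ge0// exprn_ge0// invr_ge0 ltW.
Qed.

Lemma flat0_gt0 t : 0 < t -> 0 < flat 0 t.
Proof. by move=> t0; rewrite /flat t0 expr0 mul1r expR_gt0. Qed.

Lemma flat_le0 j t : t <= 0 -> flat j t = 0.
Proof. by rewrite /flat leNgt => /negbTE ->. Qed.

(* From [expR y = (expR (y / N)) ^+ N >= (y / N) ^+ N] with [N = j + 2]. *)
Lemma flat_quadratic j t : 0 < t -> flat j t <= j.+2%:R ^+ j.+2 * t ^+ 2.
Proof.
move=> t0; rewrite /flat t0 expRN.
have N0 : 0 < j.+2%:R :> R by [].
have h : (t^-1 / j.+2%:R) ^+ j.+2 <= expR t^-1.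
  have E : t^-1 = j.+2%:R * (t^-1 / j.+2%:R) by rewrite mulrC divfK// gt_eqF.
  rewrite [in leRHS]E expRM_natl.
  rewrite lerXn2r ?nnegrE ?expR_ge0//; first by rewrite divr_ge0 ?invr_ge0// ltW.
  by apply: le_trans (expR_ge1Dx _); rewrite lerDr.
have p0 : 0 < (t^-1 / j.+2%:R) ^+ j.+2 by rewrite exprn_gt0// divr_gt0 ?invr_gt0.
apply: (@le_trans _ _ (t^-1 ^+ j * ((t^-1 / j.+2%:R) ^+ j.+2)^-1)).
  apply: ler_wpM2l; first by rewrite exprn_ge0// invr_ge0 ltW.
  by rewrite lef_pV2// posrE expR_gt0.
have e : t^-1 ^+ j * ((t^-1 / j.+2%:R) ^+ j.+2)^-1 = j.+2%:R ^+ j.+2 * t ^+ 2.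
  rewrite exprMn invfM -!exprVn !invrK mulrA [RHS]mulrC; congr (_ * _).
  by rewrite -addn2 exprD mulrA -exprMn mulVf ?expr1n ?mul1r// gt_eqF.
by rewrite e.
Qed.

Lemma dv_inv (x : R) F u : F x != 0 -> dv x F u -> dv x (fun y => (F y)^-1) (- (F x)^-1 ^+ 2 * u).
Proof.
move=> F0 hF; have := @realfun.is_deriveV _ F x u 1 F0 hF.
by rewrite /dv /GRing.scale /= exprVn.
Qed.

Lemma dv_flat j t : dv t (flat j) (- j%:R * flat j.+1 t + flat j.+2 t).
Proof.
have [t0|t0|<-] := ltgtP 0 t.
- have h : dv t (fun y => y^-1 ^+ j * expR (- y^-1)) (- j%:R * flat j.+1 t + flat j.+2 t).
    have tn : t != 0 by rewrite gt_eqF.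
    have hi : dv t (@GRing.inv R) (- t^-1 ^+ 2 * 1) by apply: (dv_inv (F := id)) => //; exact: dv_id.
    apply: dv_eq; first by dvt.
    rewrite /= /flat t0; case: j => [|j]; first by rewrite !expr0 !mul0r oppr0 mul0r; ring.
    rewrite /= !exprS; ring.
  apply: near_eq_is_derive h; near=> y.
  by rewrite /flat ifT//; near: y; exact: lt_nbhsr.
- rewrite !flat_le0 ?mulr0 ?addr0 ?(ltW t0)//.
  apply: near_eq_is_derive (dv_cst t 0); near=> y.
  by rewrite flat_le0//; apply: ltW; near: y; exact: lt_nbhsl.
(* At the junction [t = 0] the quadratic bound forces derivative 0. *)
- rewrite !flat_le0 ?mulr0 ?addr0//; apply: dv_eps => e e0.
  pose C : R := j.+2%:R ^+ j.+2.
  have C0 : 0 < C by exact: exprn_gt0.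
  exists (e / C); first exact: divr_gt0.
  move=> h; rewrite ltr_pdivlMr// add0r (flat_le0 _ (lexx 0)) mulr0 !subr0 => hh.
  rewrite ger0_norm ?flat_ge0//.
  case: (leP h 0) => h0; first by rewrite flat_le0// mulr_ge0// ltW.
  apply: (le_trans (flat_quadratic j h0)); rewrite -/C.
  rewrite expr2 mulrA gtr0_norm// ler_wpM2r ?(ltW h0)//.
  by rewrite mulrC ltW//; move: hh; rewrite gtr0_norm.
Unshelve. all: by end_near. Qed.

(** A class closed under differentiation that contains the products of two one-sided flat functions:
    membership carries the induction over iterated derivatives. *)
Inductive bump_span (a b : R) : (R -> R) -> Prop :=
| bump_base i j : bump_span a b (fun t => flat i (t - a) * flat j (b - t))
| bump_add f g : bump_span a b f -> bump_span a b g -> bump_span a b (fun t => f t + g t)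
| bump_scale c f : bump_span a b f -> bump_span a b (fun t => c * f t).

Lemma bump_span_der a b f : bump_span a b f -> bump_span a b (derive1 f) /\ der f (derive1 f).
Proof.
suff h : bump_span a b f -> exists2 g, bump_span a b g & der f g.
  move=> /h [g bg dg]; suff -> : derive1 f = g by [].
  by apply/funext => x; exact: dv_derive1 (dg x).
elim=> [i j|{}f g _ [f' bf df] _ [g' bg dg]|c {}f _ [f' bf df]].
- exists (fun t => (- i%:R * (flat i.+1 (t - a) * flat j (b - t)) + flat i.+2 (t - a) * flat j (b - t))
      + (j%:R * (flat i (t - a) * flat j.+1 (b - t)) + -1 * (flat i (t - a) * flat j.+2 (b - t)))).
    by do ! first [exact: bump_base | apply: bump_add | apply: bump_scale].
  move=> t.
  have h1 : dv t (fun t => flat i (t - a)) (- i%:R * flat i.+1 (t - a) + flat i.+2 (t - a)).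
    by apply: dv_shift; exact: dv_flat.
  have h2 : dv t (fun t => flat j (b - t)) ((- j%:R * flat j.+1 (b - t) + flat j.+2 (b - t)) * (0 - 1)).
    by apply: (dv_comp (F := fun t => b - t)); [dvt|exact: dv_flat].
  apply: dv_eq; first by dvt.
  by rewrite /=; ring.
- by exists (fun t => f' t + g' t); [exact: bump_add|move=> t; dvt].
- exists (fun t => c * f' t); first exact: bump_scale.
  by move=> t; apply: dv_eq; [dvt|rewrite mul0r add0r].
Qed.

(** A smooth function [A 0] bundled with all its derivatives, so that test functions can be
    prescribed through [A 1]. *)
Definition smooth_chain (A : nat -> R -> R) := forall n, der (A n) (A n.+1).

Lemma bump_chain a b f : bump_span a b f -> smooth_chain (fun n => iter n (@derive1 R R) f).
Proof.
move=> bf n; suff : bump_span a b (iter n (@derive1 R R) f) by move/bump_span_der => [].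
by elim: n => //= n IH; have [] := bump_span_der IH.
Qed.

Definition tbump (c e t : R) := flat 0 (t - (c - e)) * flat 0 (c + e - t).

Lemma bump_ge0 c e t : 0 <= tbump c e t.
Proof. by rewrite mulr_ge0 ?flat_ge0. Qed.

Lemma bump_out c e t : e <= `|t - c| -> tbump c e t = 0.
Proof.
rewrite /tbump; case: (leP c t) => ct h.
  by rewrite (flat_le0 _ (_ : c + e - t <= 0)) ?mulr0//; move: h; rewrite ger0_norm; lra.
by rewrite (flat_le0 _ (_ : t - (c - e) <= 0)) ?mul0r//; move: h; rewrite ltr0_norm; lra.
Qed.

Lemma bump_gt0 c e : 0 < e -> 0 < tbump c e c.
Proof. by move=> e0; rewrite mulr_gt0// flat0_gt0//; lra. Qed.

Lemma ct_bump c e : continuous (tbump c e).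
Proof.
have [_ h] := bump_span_der (bump_base (c - e) (c + e) 0 0).
exact: dv_cont h.
Qed.

Lemma bump_shift c e d t : tbump (c + d) e (t + d) = tbump c e t.
Proof. by rewrite /tbump; congr (flat _ _ * flat _ _); ring. Qed.

End Bumps.
Arguments ct_bump {R} c e.

(** * The du Bois-Reymond lemma *)

Section DuBoisReymond.
Context {R : realType}.
Implicit Types f g F G : R -> R.

(* The test function is the primitive of the difference of two translates of a
   bump; it has compact support because both translates have the same integral. *)
Lemma plateau_chain (t1 t2 e : R) : 0 < e ->
  exists A : nat -> R -> R, exists M : R,
  [/\ smooth_chain A, 0 < M, forall t, M < `|t| -> A 0%N t = 0, `|t1| + e < M /\ `|t2| + e < M &
      forall t, A 1%N t = tbump t1 e t - tbump t2 e t].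
Proof.
move=> e0.
pose B c := fun n => iter n (@derive1 R R) (tbump c e).
have cB c : smooth_chain (B c) by exact: bump_chain (bump_base _ _ 0 0).
pose b t := tbump t1 e t + - tbump t2 e t.
have cb : continuous b by have := ct_bump t1 e; have := ct_bump t2 e; move=> ? ?; rewrite /b; ct.
pose M := `|t1| + `|t2| + e + 1.
have n1 := normr_ge0 t1; have n2 := normr_ge0 t2.
have out c t : `|c| + e < `|t| -> tbump c e t = 0.
  by move=> h; apply: bump_out; have := ler_normD (t - c) c; rewrite subrK; lra.
have bout t : M < `|t| -> b t = 0.
  by move=> h; rewrite /b !out ?subr0//; rewrite /M in h; lra.
exists (fun n => if n is n'.+1 then fun t => B t1 n' t + - B t2 n' t else fun t => J b (- (M + 1)) t), M.
have Mp : 0 < M by rewrite /M; lra.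
split => //; last by rewrite /M; lra.
- case=> [|n] t; first by have := der_prim cb t => h; apply: dv_eq; [apply: dvD; [exact: h|apply: dvN; exact: dv_cst]|rewrite /b oppr0 addr0].
  by apply: dvD; [exact: cB|apply: dvN; exact: cB].
- have J0 c d : c <= d -> (forall t, c <= t <= d -> M < `|t|) -> J b c d = 0.
    move=> cd h; rewrite (eq_J (g := fun=> 0)) ?J_cst ?mul0r//; first by ct.
    by move=> x /h /bout.
  have same c : `|c| + e < M -> J (tbump c e) (- (M + 1)) (M + 1) = J (tbump 0 e) (- e) e.
    move=> cM; rewrite (J_cat _ (c - e)) (J_cat _ (c + e) (c - e)).
    have cM' := ler_norm c; have cM'' := ler_norm (- c); rewrite normrN in cM''.
    have z u v : u <= v -> (forall t, u <= t <= v -> e <= `|t - c|) -> J (tbump c e) u v = 0.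
      move=> uv h; rewrite (eq_J (g := fun=> 0)) ?J_cst ?mul0r//; [exact: ct_bump|by ct|].
      by move=> x /h /bump_out.
    rewrite z; [|lra|by move=> t ?; rewrite ler0_norm; lra].
    rewrite (z (c + e)); [|lra|by move=> t ?; rewrite ger0_norm; lra].
    have -> : tbump 0 e = (fun t => tbump c e (t + c)).
      by apply/funext => t; rewrite -{1}[c]add0r bump_shift.
    rewrite J_shift; last exact: ct_bump.
    by rewrite add0r addr0 (addrC (- e)) (addrC e).
  move=> t; case: (leP 0 t) => t0 h; last first.
    case: (leP t (- (M + 1))) => tM.
      have -> : J b (- (M + 1)) t = - J b t (- (M + 1)) by rewrite /J; lra.
      rewrite J0 ?oppr0// => s sM; rewrite ltr0_norm; rewrite ltr0_norm in h; lra.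
    rewrite J0//; first exact: ltW.
    move=> s sM; rewrite ltr0_norm; rewrite ltr0_norm in h; lra.
  rewrite ger0_norm// in h.
  rewrite (J_cat _ (M + 1)).
  rewrite [X in X + _](_ : _ = 0) ?add0r; last first.
    rewrite JB; [|exact: ct_bump|exact: ct_bump].
    by rewrite !same ?subrr// /M; lra.
  case: (leP t (M + 1)) => tM.
    have -> : J b (M + 1) t = - J b t (M + 1) by rewrite /J; lra.
    by rewrite J0 ?oppr0// => s sM; rewrite ger0_norm; lra.
  by rewrite J0//; [exact: ltW|move=> s sM; rewrite ger0_norm; lra].
Qed.

(** Otherwise the test function whose derivative is a bump at [t1] minus a bump at [t2] gives a
    positive integral. The window ends at [M + 1] because [A 0] is known to vanish only strictly
    beyond [M]. *)
Lemma du_bois_reymond_le (n : R -> R) : continuous n ->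
  (forall (A : nat -> R -> R) (M : R), smooth_chain A -> 0 < M ->
     (forall t, M < `|t| -> A 0%N t = 0) ->
     J (fun t => n t * A 1%N t) (- (M + 1)) (M + 1) = 0) ->
  forall t1 t2, n t1 <= n t2.
Proof.
move=> cn h t1 t2; rewrite leNgt; apply/negP => n12.
(* Subtracting the midpoint costs nothing, as [A 1] has integral 0, and it makes [(n - c) * A 1]
   nonnegative near both bumps. *)
pose c := (n t1 + n t2) / 2.
have g0 : 0 < (n t1 - n t2) / 4 by lra.
have [d1 d10 hd1] := ct_eps t1 cn g0.
have [d2 d20 hd2] := ct_eps t2 cn g0.
have [e [e0 e1 e2]] := ex_lt2 d10 d20.
have [A [M [cA M0 A0 [M1 M2] A1]]] := plateau_chain t1 t2 e0.
have cA0 := cA 0%N; have := h A M cA M0 A0.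
have cb1 := ct_bump t1 e; have cb2 := ct_bump t2 e.
have zero : J (A 1%N) (- (M + 1)) (M + 1) = 0.
  rewrite (J_FTC _ _ (dv_cont (cA 1%N)) (cA 0%N)) !A0 ?subrr//; first by rewrite normrN ger0_norm; lra.
  by rewrite ger0_norm; lra.
have cA1 : continuous (A 1%N) by exact: dv_cont (cA 1%N).
have E : J (fun t => n t * A 1%N t) (- (M + 1)) (M + 1) =
         J (fun t => (n t - c) * A 1%N t) (- (M + 1)) (M + 1) + c * J (A 1%N) (- (M + 1)) (M + 1).
  rewrite -JZ// -JD; [|by ct|by ct].
  by congr J; apply/funext => t; ring.
rewrite E zero mulr0 addr0 => k.
suff : 0 < J (fun t => (n t - c) * A 1%N t) (- (M + 1)) (M + 1) by rewrite k ltxx.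
apply: (J_gt0 (c := t1)); [by ct|lra|by have := ler_norm t1; have := ler_norm (- t1); rewrite normrN; lra| |].
- move=> t _; rewrite A1 mulrBr subr_ge0; apply: (@le_trans _ _ 0).
    case: (ltP `|t - t2| e) => te; last by rewrite bump_out ?mulr0.
    apply: mulr_le0_ge0 (bump_ge0 _ _ _).
    by have := hd2 t (lt_trans te e2); rewrite ltr_norml /c; lra.
  case: (ltP `|t - t1| e) => te; last by rewrite bump_out ?mulr0.
  apply: mulr_ge0 (bump_ge0 _ _ _).
  by have := hd1 t (lt_trans te e1); rewrite ltr_norml /c; lra.
- rewrite A1 mulr_gt0//; first by rewrite /c; lra.
  have t12 : e <= `|t1 - t2|.
    rewrite leNgt; apply/negP => te.
    by have := hd2 t1 (lt_trans te e2); rewrite ltr_norml; lra.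
  by rewrite (bump_out t12) subr0 bump_gt0.
Qed.

(** Integrating [h * A 0] by parts shows that [m - prim h] is orthogonal to every [A 1], hence
    constant. *)
Lemma du_bois_reymond (m h : R -> R) : continuous m -> continuous h ->
  (forall (A : nat -> R -> R) (M : R), smooth_chain A -> 0 < M ->
     (forall t, M < `|t| -> A 0%N t = 0) ->
     J (fun t => m t * A 1%N t + h t * A 0%N t) (- (M + 1)) (M + 1) = 0) ->
  forall t1 t2, m t2 - m t1 = J h t1 t2.
Proof.
move=> cm ch H.
have dH := der_prim ch; have cH := dv_cont dH.
pose n t := m t - prim h t.
have cn : continuous n by rewrite /n; ct.
have z (A : nat -> R -> R) (M : R) : smooth_chain A -> 0 < M ->
     (forall t, M < `|t| -> A 0%N t = 0) ->
     J (fun t => n t * A 1%N t) (- (M + 1)) (M + 1) = 0.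
  move=> cA M0 A0; have := H A M cA M0 A0.
  have c0 := dv_cont (cA 0%N); have c1 := dv_cont (cA 1%N).
  have := J_parts (- (M + 1)) (M + 1) dH (cA 0%N) ch c1.
  rewrite !A0 ?mulr0; [|by rewrite normrN ger0_norm; lra|by rewrite ger0_norm; lra].
  rewrite JD; [|by ct|by ct] => E1 E2.
  rewrite (_ : (fun t => _) = (fun t => m t * A 1%N t - prim h t * A 1%N t)); last first.
    by apply/funext => t; rewrite /n mulrBl.
  rewrite JB; [|by ct|by ct]; lra.
have zN (A : nat -> R -> R) (M : R) : smooth_chain A -> 0 < M ->
     (forall t, M < `|t| -> A 0%N t = 0) ->
     J (fun t => - n t * A 1%N t) (- (M + 1)) (M + 1) = 0.
  move=> cA M0 A0; have c1 := dv_cont (cA 1%N).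
  rewrite (_ : (fun t => _) = (fun t => - (n t * A 1%N t))).
    by rewrite JN ?z ?oppr0//; ct.
  by apply/funext => t; rewrite mulNr.
have cnN : continuous (fun t => - n t) by ct.
move=> t1 t2; have := du_bois_reymond_le cn z t1 t2; have := du_bois_reymond_le cnN zN t1 t2.
by rewrite /n /J; lra.
Qed.

End DuBoisReymond.

(** * Trigonometric test functions and the equation of each mode *)

Section TestFunctions.
Context {R : realType}.
Implicit Types u : R -> R -> R.
Notation P := (pi *+ 2 : R).
Notation mu := (@lebesgue_measure R).

Lemma cos_periodicz (k : int) (th x : R) : cos (k%:~R * (x + P) + th) = cos (k%:~R * x + th).
Proof.
rewrite mulrDr addrAC; move: (k%:~R * x + th) => y; case: k => n.
  by rewrite -pmulrn mulr_natl (periodicn (@cosD2pi R)).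
rewrite NegzE mulrNz mulNr -pmulrn mulr_natl.
by rewrite -(periodicn (@cosD2pi R) n.+1) subrK.
Qed.

Lemma der_cos_lin (k th c : R) :
  der (fun x => c * cos (k * x + th)) (fun x => c * k * cos (k * x + (th + pi / 2))).
Proof.
move=> x; apply: dv_eq; first by dvt.
by rewrite /= addrA cosDpihalf; ring.
Qed.

(** The free phase absorbs x-derivatives: each one is a factor [k] and a shift by [pi / 2]. A single
    shape therefore covers all words in the two derivatives. *)
Lemma partials_trig (A : nat -> R -> R) (k th : R) w : smooth_chain A ->
  exists n c th', partials w (fun t x => A 0%N t * cos (k * x + th)) =
    (fun t x => A n t * (c * cos (k * x + th'))).
Proof.
move=> cA; elim: w => [|b w [n [c [th' IH]]]].
  by exists 0%N, 1, th; apply/funext => t; apply/funext => x; rewrite /= mul1r.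
rewrite /= IH; case: b.
  exists n.+1, c, th'; apply/funext => t; apply/funext => x; apply: dv_derive1.
  by apply: dv_eq; [apply: dvM; [exact: cA|exact: dv_cst]|rewrite mulr0 addr0].
exists n, (c * k), (th' + pi / 2); apply/funext => t; apply/funext => x; apply: dv_derive1.
by apply: dv_eq; [apply: dvM; [exact: dv_cst|exact: der_cos_lin]|rewrite mul0r add0r].
Qed.

Lemma trig_test_function (A : nat -> R -> R) (M : R) (k : int) (th : R) : smooth_chain A ->
  (forall t, M < `|t| -> A 0%N t = 0) ->
  test_function (fun t x => A 0%N t * cos (k%:~R * x + th)).
Proof.
move=> cA A0; split.
- move=> w; have [n [c [th' ->]]] := partials_trig k%:~R th w cA; split.
  + by have cAn := dv_cont (cA n); ct.
  + move=> t x; apply: (@ex_derive _ _ _ _ _ _ _ (_ : dv t _ _)).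
    by apply: dvM; [exact: cA|exact: dv_cst].
  + move=> t x; apply: (@ex_derive _ _ _ _ _ _ _ (_ : dv x _ _)).
    by apply: dvM; [exact: dv_cst|exact: der_cos_lin].
- by move=> t x; rewrite cos_periodicz.
- by exists M => t x /A0 ->; rewrite mul0r.
Qed.

Lemma Rint_support (f : R -> R) (M : R) : (forall t, M < `|t| -> f t = 0) ->
  \int[mu]_(t in [set: R]) f t = \int[mu]_(t in `[- M, M]) f t.
Proof.
move=> f0; rewrite [RHS]Rintegral_mkcond; congr Rintegral; apply/funext => t.
rewrite patchE; case: ifPn => //; rewrite notin_setE /= in_itv /= -ler_norml => /negP.
by rewrite -ltNge => /f0.
Qed.

(** Testing with [A t * cos (k x + th)] turns [1 - d_x^2] into the factor [1 + k^2] and leaves a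
    scalar weak equation in time. *)
Lemma BBM_fourier u (k : int) (th t1 t2 : R) : cont2 u -> BBM_distributional u ->
  (1 + k%:~R ^+ 2) * (J (fun x => u t2 x * cos (k%:~R * x + th)) 0 P -
                      J (fun x => u t1 x * cos (k%:~R * x + th)) 0 P) =
  J (fun t => J (fun x => (u t x + u t x ^+ 2 / 2) *
                 (k%:~R * cos (k%:~R * x + (th + pi / 2)))) 0 P) t1 t2.
Proof.
move=> cu hu; set K : R := k%:~R.
have P0 : 0 <= P by rewrite mulrn_wge0// pi_ge0.
pose g1 t x := u t x * cos (K * x + th).
pose g2 t x := (u t x + u t x ^+ 2 / 2) * (K * cos (K * x + (th + pi / 2))).
have c1 : cont2 g1 by rewrite /cont2 /g1; ct.
have c2 : cont2 g2 by rewrite /cont2 /g2; ct.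
pose m t := (1 + K ^+ 2) * J (g1 t) 0 P.
pose h t := - J (g2 t) 0 P.
have cm : continuous m by apply: ctM; [ct|apply: (ct_J (t := id)); ct].
have cJ2 : continuous (fun t => J (g2 t) 0 P) by apply: (ct_J (t := id)); ct.
have ch : continuous h by rewrite /h; ct.
(* The tested identity is the integral of [m * A 1 - h * A 0]; its negative has the shape required,
   with [- m] in the first slot. *)
have H : forall t1 t2, - m t2 - (- m t1) = J h t1 t2.
  apply: du_bois_reymond => // [|A M cA M0 A0]; first by ct.
  have cA0 := dv_cont (cA 0%N); have cA1 := dv_cont (cA 1%N).
  pose phi t x := A 0%N t * cos (K * x + th).
  pose I t := A 1%N t * (1 + K ^+ 2) * J (g1 t) 0 P + A 0%N t * J (g2 t) 0 P.
  have cI : continuous I.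
    have cJ1 : continuous (fun t => J (g1 t) 0 P) by apply: (ct_J (t := id)); ct.
    by rewrite /I; ct.
  have E t : \int[mu]_(x in circle R) (u t x * (dt phi t x - dx (dx (dt phi)) t x) +
      (u t x + u t x ^+ 2 / 2) * dx phi t x) = I t.
    have d0 : dt phi = fun t x => A 1%N t * cos (K * x + th).
      apply/funext => s; apply/funext => x; apply: dv_derive1.
      by apply: dv_eq; [apply: dvM; [exact: cA|exact: dv_cst]|rewrite mulr0 addr0].
    have d1 a (th' : R) : dx (fun t x => a t * cos (K * x + th')) = fun t x => a t * K * cos (K * x + (th' + pi / 2)).
      by apply/funext => s; apply/funext => x; apply: dv_derive1; exact: der_cos_lin.
    rewrite d0 /phi !d1 (_ : (fun x => _) = fun x => (A 1%N t * (1 + K ^+ 2)) * g1 t x + A 0%N t * g2 t x).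
      have cg1 := cont2_slice t c1; have cg2 := cont2_slice t c2.
      by rewrite -J_Rint//; [rewrite JD; [rewrite !JZ|ct|ct]|ct].
    apply/funext => x.
    have -> : K * x + (th + pi / 2 + pi / 2) = K * x + th + pi by field.
    by rewrite cosDpi /g1 /g2; ring.
  have : \int[mu]_(t in [set: R]) I t = 0.
    rewrite -[RHS](hu phi (trig_test_function k th cA A0)).
    by apply: eq_Rintegral => t _; rewrite E.
  rewrite (@Rint_support _ (M + 1)) => [|t tM].
    rewrite -J_Rint// ?ler_oppl; [|lra] => I0.
    rewrite (_ : (fun t => _) = (fun t => - I t)); first by rewrite JN// I0 oppr0.
    by apply/funext => t; rewrite /m /h /I; ring.
  have A0t s : M < `|s| -> A 0%N s = 0 by exact: A0.
  rewrite /I A0t ?mul0r ?addr0; last lra.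
  suff -> : A 1%N t = 0 by rewrite !mul0r.
  suff h0 : dv t (A 0%N) 0 by rewrite -(dv_derive1 (cA 0%N t)) (dv_derive1 h0).
  apply: near_eq_is_derive (dv_cst t 0); near=> s; rewrite A0//.
  by near: s; apply: (cvgr_norm_gt (f := id)) => //; [exact: cvg_id|lra].
have := H t1 t2; rewrite /h JN// /m /g1 /g2; lra.
Unshelve. all: by end_near. Qed.

End TestFunctions.

(** * Functions of class H^1 *)

Section Cumulative.
Context {R : realType}.
Notation mu := (@lebesgue_measure R).
Implicit Types q b : R -> R.

Definition L1on (D : set R) q := mu.-integrable D (EFin \o q).

Lemma L1on_meas (D : set R) q : L1on D q -> measurable_fun D q.
Proof. by move=> /measurable_int /measurable_EFinP. Qed.

Lemma L1on_le (D : set R) q q' : measurable D -> L1on D q' -> measurable_fun D q ->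
  (forall x, D x -> `|q x| <= `|q' x|) -> L1on D q.
Proof.
move=> mD iq' mq h; rewrite /L1on.
apply: (@le_integrable _ _ _ mu D mD (EFin \o q) (EFin \o q')) => //.
exact/measurable_EFinP.
Qed.

Lemma L1onM (D : set R) q b (B : R) : measurable D -> L1on D q -> continuous b ->
  (forall x, D x -> `|b x| <= B) -> L1on D (fun x => q x * b x).
Proof.
move=> mD iq cb hB.
have iB : L1on D (fun x => B * q x) by exact: (@integrableZl _ _ _ mu D mD B (EFin \o q) iq).
apply: L1on_le iB _ _ => //.
  apply: measurable_funM; first exact: L1on_meas.
  by apply: measurable_funTS; exact: continuous_measurable_fun.
move=> x Dx; rewrite mulrC !normrM ler_wpM2r//.
by rewrite (le_trans (hB x Dx))// ler_norm.
Qed.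

Lemma L1onD (D : set R) q q' : measurable D -> L1on D q -> L1on D q' ->
  L1on D (fun x => q x + q' x).
Proof. by move=> mD i i'; exact: (@integrableD _ _ _ mu D mD (EFin \o q) (EFin \o q') i i'). Qed.

Lemma L1onZ (D : set R) q (c : R) : measurable D -> L1on D q -> L1on D (fun x => c * q x).
Proof. by move=> mD i; exact: (@integrableZl _ _ _ mu D mD c (EFin \o q) i). Qed.

Lemma L1onS (D E : set R) q : measurable E -> measurable D -> D `<=` E -> L1on E q -> L1on D q.
Proof. by move=> mE mD DE; exact: (@integrableS _ _ _ mu E D (EFin \o q)). Qed.

Lemma L1onT (D : set R) q : measurable D -> L1on setT q -> L1on D q.
Proof. by move=> mD i; apply: (L1onS _ _ _ i). Qed.

Definition cum q (x : R) : R := \int[mu]_(y in `]-oo, x]) q y.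

Lemma cumB q (x y : R) : L1on setT q -> x <= y ->
  cum q y - cum q x = \int[mu]_(s in `]x, y]) q s.
Proof.
move=> iq xy; apply: Rintegral_itvB => //.
by apply: (L1onT _ iq).
Qed.

Lemma cum_cont q : L1on setT q -> continuous (cum q).
Proof.
move=> iq x.
have h : {within `[x - 1, x + 1], continuous (fun y => \int[mu]_(s in `[x - 1, y]) q s)}.
  apply: parameterized_integral_continuous; first lra.
  by apply: (L1onT _ iq).
have c : {for x, continuous (fun y => cum q (x - 1) + \int[mu]_(s in `[x - 1, y]) q s)}.
  apply: cvgD; first exact: cvg_cst.
  apply: (within_continuous_continuous _ h); first lra.
  by rewrite in_itv /=; lra.
apply: (cvg_trans _ (_ : cum q (x - 1) + \int[mu]_(s in `[x - 1, y]) q s @[y --> x] --> cum q x)).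
  apply: near_eq_cvg; near=> y.
  have xy : x - 1 <= y by apply: ltW; near: y; apply: lt_nbhsr; lra.
  by rewrite -Rintegral_itv_obnd_cbnd; [rewrite -cumB// addrC subrK|by apply: (L1onT _ iq)].
have -> : cum q x = cum q (x - 1) + \int[mu]_(s in `[x - 1, x]) q s; last exact: c.
by rewrite -Rintegral_itv_obnd_cbnd; [rewrite -cumB//; lra|by apply: (L1onT _ iq)].
Unshelve. all: by end_near. Qed.

Lemma cum_le q (x y : R) : L1on setT q -> (forall s, 0 <= q s) -> x <= y -> cum q x <= cum q y.
Proof.
by move=> iq q0 xy; rewrite -subr_ge0 cumB//; apply: Rintegral_ge0 => s _; exact: q0.
Qed.

Lemma L1on_norm q (D : set R) : L1on D q -> L1on D (fun s => `|q s|).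
Proof. by move=> iq; exact: integrable_norm. Qed.

Lemma norm_cumB q (x y : R) : L1on setT q -> x <= y ->
  `|cum q y - cum q x| <= cum (fun s => `|q s|) y - cum (fun s => `|q s|) x.
Proof.
move=> iq xy; rewrite !cumB//; last exact: L1on_norm.
by apply: le_normr_Rintegral => //; by apply: (L1onT _ iq).
Qed.

(* The oscillation of the difference between the two sides over [x, y] is at most
   2 B (y - x) times the mass of |q| on [x, y], so that difference has derivative 0. *)
Lemma cum_parts q b b' (B : R) : L1on setT q -> der b b' -> continuous b' ->
  (forall x, `|b x| <= B) -> (forall x, `|b' x| <= B) ->
  forall x y, cum (fun s => q s * b s) y - cum (fun s => q s * b s) x =
    cum q y * b y - cum q x * b x - J (fun s => cum q s * b' s) x y.
Proof.
move=> iq db cb' hb hb'.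
have cb := dv_cont db; have cG := cum_cont iq.
have B0 : 0 <= B by apply: le_trans (hb 0).
pose N := cum (fun s => `|q s|).
have inq := L1on_norm iq.
have cN : continuous N by exact: cum_cont.
have iqb : L1on setT (fun s => q s * b s) by apply: (L1onM _ iq cb) => //.
pose Psi x := cum (fun s => q s * b s) x - cum q x * b x + prim (fun s => cum q s * b' s) x.
have key x y : x <= y -> `|Psi y - Psi x| <= 2 * B * (y - x) * (N y - N x).
  move=> xy.
  have Nxy : 0 <= N y - N x by rewrite subr_ge0; apply: cum_le.
  have bxy s : x <= s <= y -> `|b s - b y| <= B * (y - x).
    move=> sxy; have sy : s <= y by lra.
    have -> : b s - b y = - J b' s y by rewrite (J_FTC _ _ cb' db); lra.
    rewrite normrN; apply: le_trans (J_norm_le (M := B) cb' sy _) _ => //.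
    by rewrite ler_wpM2l//; lra.
  have e : Psi y - Psi x = \int[mu]_(s in `]x, y]) (q s * (b s - b y)) +
      J (fun s => (cum q s - cum q x) * b' s) x y.
    have e1 : \int[mu]_(s in `]x, y]) (q s * (b s - b y)) =
        cum (fun s => q s * b s) y - cum (fun s => q s * b s) x - (cum q y - cum q x) * b y.
      rewrite !cumB// -RintegralZr//; last by apply: (L1onT _ iq).
      rewrite -RintegralB//; [|by apply: (L1onT _ iqb)|].
        by apply: eq_Rintegral => s _; rewrite mulrBr.
      apply: (@L1onM _ q (fun=> b y) B) => //; [by apply: (L1onT _ iq)|exact: ct_cst].
    have e2 : J (fun s => (cum q s - cum q x) * b' s) x y =
        J (fun s => cum q s * b' s) x y - cum q x * (b y - b x).
      rewrite -(J_FTC x y cb' db) -JZ// -JB; [|by ct|by ct].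
      by congr J; apply/funext => s; rewrite mulrBl.
    by rewrite e1 e2 /Psi /J; ring.
  rewrite e; apply: le_trans (ler_normD _ _) _.
  have h1 : `|\int[mu]_(s in `]x, y]) (q s * (b s - b y))| <= B * (y - x) * (N y - N x).
    have i1 : L1on `]x, y] (fun s => q s * (b s - b y)).
      apply: (@L1onM _ q _ (B * (y - x))) => //; [by apply: (L1onT _ iq)|by ct|].
      by move=> s; rewrite /= in_itv /= => sxy; apply: bxy; lra.
    apply: le_trans (le_normr_Rintegral _ i1) _ => //.
    rewrite /N cumB// -RintegralZl//; last by apply: (L1onT _ inq).
    apply: le_Rintegral => //.
    - exact: L1on_norm.
    - by apply: L1onZ => //; by apply: (L1onT _ inq).
    - move=> s; rewrite /= in_itv /= => sxy; rewrite normrM mulrC ler_wpM2r//.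
      by apply: bxy; lra.
  have h2 : `|J (fun s => (cum q s - cum q x) * b' s) x y| <= (N y - N x) * B * (y - x).
    apply: J_norm_le => //; first by ct.
    move=> s sxy; rewrite normrM ler_pM//.
    have xs : x <= s by lra.
    apply: (le_trans (norm_cumB iq xs)); rewrite lerD2r; apply: cum_le => //; lra.
  have -> : 2 * B * (y - x) * (N y - N x) = B * (y - x) * (N y - N x) + (N y - N x) * B * (y - x) by ring.
  exact: lerD.
have d0 : der Psi (fun=> 0).
  move=> x; apply: dv_eps => e e0.
  have e1 : 0 < e / (2 * B + 1) by rewrite divr_gt0//; lra.
  have [d dd hd] := ct_eps x cN e1.
  have dec h : `|h| < d -> 2 * B * `|N (x + h) - N x| <= e.
    move=> hh; have := hd (x + h); rewrite (_ : x + h - x = h); [move=> /(_ hh) k|ring].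
    apply: (@le_trans _ _ (2 * B * (e / (2 * B + 1)))).
      by apply: ler_wpM2l; [lra|exact: ltW].
    by rewrite mulrA ler_pdivrMr; [rewrite mulrC ler_wpM2l//; lra|lra].
  exists d => // h hh; rewrite mulr0 subr0.
  have := dec h hh; case: (leP 0 h) => h0.
    have xh : x <= x + h by lra.
    have := key _ _ xh; rewrite (_ : x + h - x = h); [move=> k1 k2|ring].
    have N0 : 0 <= N (x + h) - N x by rewrite subr_ge0 cum_le.
    rewrite (ger0_norm N0) in k2; apply: (le_trans k1); rewrite mulrAC (ger0_norm h0).
    exact: ler_wpM2r.
  have xh : x + h <= x by lra.
  have := key _ _ xh; rewrite distrC (_ : x - (x + h) = - h); [move=> k1 k2|ring].
  have N0 : 0 <= N x - N (x + h) by rewrite subr_ge0 cum_le.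
  rewrite distrC (ger0_norm N0) in k2; apply: (le_trans k1); rewrite mulrAC (ltr0_norm h0).
  by apply: ler_wpM2r => //; lra.
move=> x y; have := der0_cst d0 x y; rewrite /Psi /J; lra.
Qed.

(** The pointwise inequality [2 |q| <= l q^2 + 1 / l], integrated. Cauchy-Schwarz is kept in this
    form, linear in the integrals, until [l] is optimised. *)
Lemma cum_amgm q (x y l : R) : L1on setT q -> L1on setT (fun s => q s ^+ 2) ->
  0 < l -> x <= y ->
  2 * `|cum q y - cum q x| <= l * (cum (fun s => q s ^+ 2) y - cum (fun s => q s ^+ 2) x) + (y - x) / l.
Proof.
move=> iq iq2 l0 xy.
have h : 2 * (cum (fun s => `|q s|) y - cum (fun s => `|q s|) x) <=
    l * (cum (fun s => q s ^+ 2) y - cum (fun s => q s ^+ 2) x) + (y - x) / l.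
  have inq := L1on_norm iq.
  have i1 : L1on `]x, y] (fun s => `|q s|) by apply: (L1onT _ inq).
  have i2 : L1on `]x, y] (fun s => q s ^+ 2) by apply: (L1onT _ iq2).
  have i3 : L1on `]x, y] (fun=> l^-1).
    have : L1on `[x, y] (fun=> l^-1) by apply: ct_integrable; exact: ct_cst.
    by apply: L1onS => //; apply: subset_itvr; rewrite bnd_simp.
  have e : (y - x) / l = \int[mu]_(s in `]x, y]) l^-1.
    by rewrite Rintegral_itv_obnd_cbnd// -J_Rint// ?J_cst 1?mulrC//; exact: ct_cst.
  rewrite !cumB// e -!RintegralZl// -RintegralD//; last by apply: L1onZ.
  apply: le_Rintegral => //; [exact: L1onZ|by apply: L1onD => //; exact: L1onZ|].
  move=> s _; rewrite -subr_ge0.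
  have -> : l * q s ^+ 2 + l^-1 - 2 * `|q s| = l * (`|q s| - l^-1) ^+ 2.
    by rewrite -(real_normK (num_real (q s))); field; rewrite gt_eqF.
  by rewrite mulr_ge0 ?sqr_ge0// ltW.
by apply: le_trans h; rewrite ler_pM2l//; exact: norm_cumB.
Qed.

End Cumulative.

(** * Weak derivatives, Holder and Sobolev bounds *)

Section Sobolev.
Context {R : realType}.
Notation mu := (@lebesgue_measure R).
Notation P := (pi *+ 2 : R).
Implicit Types f g : R -> R.

Lemma period_gt0 : 0 < P.
Proof. by rewrite pmulrn_lgt0// pi_gt0. Qed.

(* Optimising over [l] gives the Cauchy-Schwarz inequality. *)
Lemma sqr_le_amgm (d r s : R) : 0 <= r -> 0 <= s ->
  (forall l, 0 < l -> 2 * `|d| <= l * s + r / l) -> d ^+ 2 <= r * s.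
Proof.
move=> r0 s0 h; rewrite -(real_normK (num_real d)).
have [->|d0] := eqVneq d 0; first by rewrite normr0 expr0n mulr_ge0.
have dp : 0 < `|d| by rewrite normr_gt0.
case: (ltrP 0 s) => sp.
  have := h (`|d| / s) (divr_gt0 dp sp).
  rewrite divfK ?gt_eqF// invf_div mulrA.
  have -> : 2 * `|d| = `|d| + `|d| by ring.
  by rewrite lerD2l ler_pdivlMr// expr2.
have l0 : 0 < r / `|d| + 1 by have := divr_ge0 r0 (ltW dp); lra.
have := h _ l0; have -> : s = 0 by lra.
rewrite mulr0 add0r ler_pdivlMr// -mulrA mulrDr mulrCA divff ?gt_eqF//; lra.
Qed.

Lemma smooth_trig (k : int) (th : R) : smooth_circle (fun x => cos (k%:~R * x + th)).
Proof.
split=> [x|n x]; first by rewrite cos_periodicz.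
suff [c [th' ->]] : exists c th', derive1n n (fun x => cos (k%:~R * x + th)) = fun x : R => c * cos (k%:~R * x + th').
  exact: (@ex_derive _ _ _ _ _ _ _ (der_cos_lin _ _ _ _)).
elim: n => [|n [c [th' IH]]].
  by exists 1, th; apply/funext => y; rewrite derive1n0 mul1r.
exists (c * k%:~R), (th' + pi / 2); rewrite derive1nS IH.
by apply/funext => y; apply: dv_derive1; exact: der_cos_lin.
Qed.

Lemma L1on_restrict (D : set R) g : measurable D -> L1on D g -> L1on setT (g \_ D).
Proof.
move=> mD ig; rewrite /L1on.
have -> : EFin \o (g \_ D) = (EFin \o g) \_ D.
  by apply/funext => x; rewrite /= !patchE; case: ifP.
exact: (iffLR (@integrable_mkcond _ _ _ mu D (EFin \o g) mD)).
Qed.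

Lemma measurable_circle : measurable (circle R).
Proof. exact: measurable_itv. Qed.

Hint Resolve measurable_circle : core.

Definition cut g : R -> R := g \_ `]0, P].

Lemma cut_in g x : 0 < x <= P -> cut g x = g x.
Proof. by move=> xP; rewrite /cut patchE ifT// inE /= in_itv. Qed.

Lemma cut_out g x : x <= 0 -> cut g x = 0.
Proof. by move=> x0; rewrite /cut patchE ifF//; apply/negbTE; rewrite notin_setE /= in_itv /=; lra. Qed.

Lemma L1on_oc g : L1on (circle R) g -> L1on `]0, P] g.
Proof.
rewrite /circle => ig; apply: (L1onS _ _ _ ig) => //.
by apply: subset_itvr; rewrite bnd_simp.
Qed.

Lemma L1on_cut g : L1on (circle R) g -> L1on setT (cut g).
Proof. by move=> /L1on_oc; exact: L1on_restrict. Qed.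

Lemma cum_cut0 q x : (forall s, s <= 0 -> q s = 0) -> x <= 0 -> cum q x = 0 :> R.
Proof.
move=> q0 x0; have -> : cum q x = \int[mu]_(s in `]-oo, x]) 0.
  apply: eq_Rintegral => s; rewrite inE /= in_itv /= => sx; apply: q0.
  exact: le_trans sx x0.
by rewrite Rintegral_cst ?mul0r.
Qed.

Lemma cum_cutP q g : L1on setT q -> L1on `]0, P] g -> (forall s, s <= 0 -> q s = 0) ->
  (forall s, 0 < s <= P -> q s = g s) -> cum q P = \int[mu]_(s in circle R) g s.
Proof.
move=> iq ig q0 qg; have P0 := period_gt0.
have -> : cum q P = cum q P - cum q 0 by rewrite (cum_cut0 q0 (lexx 0)) subr0.
rewrite cumB//; last exact: ltW.
rewrite /circle -[RHS]Rintegral_itv_obnd_cbnd//.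
by apply: eq_Rintegral => s; rewrite inE /= in_itv /=; exact: qg.
Qed.

Lemma L1on_sqr (D : set R) g : measurable D -> measurable_fun D g ->
  L1on D (fun=> 1) -> L1on D (fun s => g s ^+ 2) -> L1on D g.
Proof.
move=> mD mg i1 i2.
apply: (@L1on_le _ D g (fun s => 1 + g s ^+ 2)) => //; first exact: L1onD.
move=> s _; rewrite (ger0_norm (_ : 0 <= 1 + g s ^+ 2)) ?addr_ge0 ?sqr_ge0//.
rewrite -(real_normK (num_real (g s))); have := sqr_ge0 (`|g s| - 1).
by have := sqr_ge0 `|g s|; rewrite !expr2; lra.
Qed.

Lemma L1on_circle1 : L1on (circle R) (fun=> 1).
Proof. by apply: ct_integrable; exact: ct_cst. Qed.

Lemma L2_L1 g : L2_circle g -> L1on (circle R) g.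
Proof.
move=> [_ mg ig]; apply: L1on_sqr => //; [exact: measurable_funTS|exact: L1on_circle1].
Qed.

(** Tested against derivatives of trigonometric functions, [f] and the cumulative integral [G] of
    [g] give the same numbers. Hence [f - G] has no mode other than its mean. *)
Lemma weak_primitive f g : continuous f -> weak_derivative f g ->
  forall x, 0 <= x <= P -> f x - f 0 = cum (cut g) x.
Proof.
move=> cf [hg H].
have ig := L2_L1 hg; have iq := L1on_cut ig; have P0 := period_gt0.
have cG := cum_cont iq.
set q := cut g; set G := cum q.
have G0 x : x <= 0 -> G x = 0 by apply: cum_cut0; exact: cut_out.
have b1 k th x : `|cos (k * x + th) : R| <= 1 by exact: cos_max.
have H' (k : int) th : J (fun x => f x * (1 * k%:~R * cos (k%:~R * x + (th + pi / 2)))) 0 P =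
    - \int[mu]_(x in circle R) (g x * cos (k%:~R * x + th)).
  rewrite -(H _ (smooth_trig k th)) J_Rint ?(ltW P0)//; last by ct.
  apply: eq_Rintegral => x _; congr (_ * _); apply/esym/dv_derive1.
  by rewrite (_ : (fun x => cos _) = (fun x : R => 1 * cos (k%:~R * x + th))); [exact: der_cos_lin|apply/funext => y; rewrite mul1r].
have key (k : int) th : J (fun x => G x * (1 * k%:~R * cos (k%:~R * x + (th + pi / 2)))) 0 P =
    G P * cos (k%:~R * P + th) - \int[mu]_(x in circle R) (g x * cos (k%:~R * x + th)).
  have db := der_cos_lin (k%:~R : R) th 1.
  have cb' : continuous (fun x : R => 1 * k%:~R * cos (k%:~R * x + (th + pi / 2))) by ct.
  have cb : continuous (fun x : R => 1 * cos (k%:~R * x + th)) by ct.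
  have h1 x : `|1 * cos (k%:~R * x + th) : R| <= 1 + `|k%:~R : R|.
    by rewrite mul1r; have := b1 k%:~R th x; have := normr_ge0 (k%:~R : R); lra.
  have h2 x : `|1 * k%:~R * cos (k%:~R * x + (th + pi / 2)) : R| <= 1 + `|k%:~R : R|.
    rewrite mul1r normrM; have := ler_wpM2l (normr_ge0 (k%:~R : R)) (b1 k%:~R (th + pi / 2) x).
    by rewrite mulr1; lra.
  have := cum_parts iq db cb' h1 h2 0 P; rewrite -/G (G0 0)// mul0r subr0.
  have iqb : L1on setT (fun s => q s * (1 * cos (k%:~R * s + th))) by apply: (L1onM _ iq cb) => // x _; exact: h1.
  have igb : L1on `]0, P] (fun s => g s * cos (k%:~R * s + th)).
    by apply: (L1onM (B := 1) _ (L1on_oc ig)) => //; ct.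
  rewrite (cum_cutP iqb igb); [|by move=> s s0; rewrite /q cut_out// mul0r|by move=> s sP; rewrite /q cut_in// mul1r].
  rewrite cum_cut0//; last by move=> s s0; rewrite /q cut_out// mul0r.
  by rewrite mul1r; lra.
(* The mode [k = 0] says that [g] has mean 0, which removes the boundary term of [key]. *)
have GP : G P = 0.
  have z h : J (fun x => h x * (1 * 0%:~R * cos (0%:~R * x + (0 + pi / 2)))) 0 P = 0 :> R.
    rewrite (_ : (fun x => _) = (fun=> 0)) ?J_cst ?mul0r//.
    by apply/funext => x; rewrite mulr0 mul0r mulr0.
  have := key 0 0; have := H' 0 0; rewrite !z mul0r add0r cos0 mulr1; lra.
(* The mean of [f - G]: subtracting it settles [k = 0], while for other [k] the factor [k] can be
   divided out. *)
pose c := J (fun x => f x - G x) 0 P / P.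
have cD : continuous (fun x => f x - G x - c) by ct.
have D0 := fourier_eq0 cD _.
have z : forall x, 0 <= x <= P -> f x - G x - c = 0.
  apply: D0 => k th; have [->|k0] := eqVneq k 0.
    rewrite (_ : (fun _ => _) = (fun x => cos th * (f x - G x - c))); last first.
      by apply/funext => x; rewrite mul0r add0r mulrC.
    rewrite JZ// JB; [|by ct|by ct].
    by rewrite J_cst /c subr0 divfK ?gt_eqF// subrr mulr0.
  have kn : (k%:~R : R) != 0 by rewrite intr_eq0.
  (* The phase [th - pi / 2] is chosen so that differentiating the test function brings back
     [th]. *)
  have E : J (fun x => (f x - G x) * (1 * k%:~R * cos (k%:~R * x + (th - pi / 2 + pi / 2)))) 0 P = 0.
    rewrite (_ : (fun _ => _) = (fun x => f x * (1 * k%:~R * cos (k%:~R * x + (th - pi / 2 + pi / 2))) -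
       G x * (1 * k%:~R * cos (k%:~R * x + (th - pi / 2 + pi / 2))))); last first.
      by apply/funext => x; rewrite mulrBl.
    rewrite JB; [|by ct|by ct].
    by rewrite H' key GP mul0r; lra.
  have E2 : J (fun x => 1 * k%:~R * cos (k%:~R * x + (th - pi / 2 + pi / 2))) 0 P = 0 :> R.
    rewrite (J_FTC _ _ _ (der_cos_lin (k%:~R : R) (th - pi / 2) 1)); last by ct.
    by rewrite -{1}[P]add0r cos_periodicz subrr.
  have cm : continuous (fun x : R => 1 * k%:~R * cos (k%:~R * x + (th - pi / 2 + pi / 2))) by ct.
  rewrite (_ : (fun _ => _) = (fun x => k%:~R^-1 * ((f x - G x) * (1 * k%:~R * cos (k%:~R * x + (th - pi / 2 + pi / 2))) -
     c * (1 * k%:~R * cos (k%:~R * x + (th - pi / 2 + pi / 2)))))); last first.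
    by apply/funext => x; rewrite subrK; field.
  rewrite JZ; last by ct.
  rewrite JB; [|by ct|by ct].
  by rewrite JZ// E E2 mulr0 subrr mulr0.
move=> x xP; have := z x xP; have := z 0 _; rewrite lexx (ltW P0) G0// => /(_ isT); lra.
Qed.

(** [S] is the cumulated integral of [g ^+ 2], and the last clause is Cauchy-Schwarz. Keeping [S]
    rather than its total makes the bound additive over adjacent intervals, which the estimate of
    difference quotients exploits. *)
Lemma weak_derivative_holder f g : continuous f -> weak_derivative f g ->
  exists S : R -> R, [/\ continuous S, forall x y, x <= y -> S x <= S y, S 0 = 0,
    S P = \int[mu]_(x in circle R) (g x ^+ 2) &
    forall x y, 0 <= x <= y -> y <= P -> (f y - f x) ^+ 2 <= (y - x) * (S y - S x)].
Proof.
move=> cf wg; have [hg _] := wg; have [_ mg ig2] := hg; have P0 := period_gt0.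
have iq := L1on_cut (L2_L1 hg).
have iq2 : L1on setT (fun s => cut g s ^+ 2).
  have -> : (fun s => cut g s ^+ 2) = cut (fun s => g s ^+ 2).
    by apply/funext => s; rewrite /cut !patchE; case: ifP => //; rewrite expr0n.
  exact: L1on_cut.
exists (cum (fun s => cut g s ^+ 2)); split.
- exact: cum_cont.
- by move=> x y xy; apply: cum_le => // s; exact: sqr_ge0.
- by apply: cum_cut0 => // s s0; rewrite cut_out// expr0n.
- apply: cum_cutP => //; [exact: L1on_oc|by move=> s s0; rewrite cut_out// expr0n|].
  by move=> s sP; rewrite cut_in.
- move=> x y xy yP; apply: sqr_le_amgm; first lra.
    by rewrite subr_ge0; apply: cum_le => //; [move=> s; exact: sqr_ge0|lra].
  move=> l l0; have -> : f y - f x = cum (cut g) y - cum (cut g) x.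
    by rewrite -!(weak_primitive cf wg); lra.
  by apply: cum_amgm => //; lra.
Qed.

(** The inequality [f x ^+ 2 <= 2 * f y ^+ 2 + 2 * (f x - f y) ^+ 2], whose last square is at most
    [P] times the integral of [g ^+ 2], is averaged over [y]. This gives [2 / P] and [2 * P], merged
    into one constant. *)
Lemma sobolev f g : continuous f -> weak_derivative f g -> forall x, 0 <= x <= P ->
  f x ^+ 2 <= (2 / P + 2 * P) * \int[mu]_(y in circle R) (f y ^+ 2 + g y ^+ 2).
Proof.
move=> cf wg x xP; have P0 := period_gt0.
have [S [cS mS S0 SP hS]] := weak_derivative_holder cf wg.
have [[_ mg ig2] _] := wg.
rewrite RintegralD//; [|by apply: ct_integrable; ct].
rewrite -SP -J_Rint//; [|by ct|exact: ltW].
have SP0 : 0 <= S P by rewrite -S0; apply: mS; exact: ltW.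
have h y : 0 <= y <= P -> f x ^+ 2 <= 2 * f y ^+ 2 + 2 * P * S P.
  move=> yP.
  have d : (f x - f y) ^+ 2 <= P * S P.
    case: (leP x y) => xy.
      rewrite -sqrrN opprB; apply: le_trans (hS x y _ _) _; [lra|lra|].
      by apply: ler_pM; rewrite ?subr_ge0 ?mS//; [lra|have := mS 0 x; have := mS y P; rewrite S0; lra].
    apply: le_trans (hS y x _ _) _; [lra|lra|].
    by apply: ler_pM; rewrite ?subr_ge0 ?mS ?(ltW xy)//; [lra|have := mS 0 y; have := mS x P; rewrite S0; lra].
  by have := sqr_ge0 (f x - 2 * f y); move: d; rewrite !expr2; lra.
have c1 : continuous (fun y => 2 * f y ^+ 2 + 2 * P * S P) by ct.
have := @le_J _ (fun=> f x ^+ 2) _ 0 P ltac:(ct) c1 (ltW P0) h.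
rewrite J_cst JD; [|by ct|by ct]; rewrite JZ; [|by ct]; rewrite J_cst subr0 => k.
have I0 : 0 <= J (fun y => f y ^+ 2) 0 P by apply: J_ge0; [ct|exact: ltW|move=> *; exact: sqr_ge0].
rewrite -(ler_pM2r P0); apply: (le_trans k).
have aux (p a b : R) : 0 < p ->
    (2 / p + 2 * p) * (a + b) * p = 2 * a + 2 * b + 2 * p * p * a + 2 * p * b * p.
  by move=> p0; field; rewrite gt_eqF.
rewrite aux//.
have : 0 <= 2 * P * P * J (fun y => f y ^+ 2) 0 P by rewrite !mulr_ge0 ?(ltW P0).
lra.
Qed.

Lemma weak_derivativeB f1 g1 f2 g2 : continuous f1 -> continuous f2 ->
  weak_derivative f1 g1 -> weak_derivative f2 g2 -> weak_derivative (f1 \- f2) (g1 \- g2).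
Proof.
move=> c1 c2 [h1 H1] [h2 H2]; have i1 := L2_L1 h1; have i2 := L2_L1 h2.
have [p1 m1 s1] := h1; have [p2 m2 s2] := h2; split.
  split; first by move=> x; rewrite /= p1 p2.
    exact: measurable_funB.
  apply: (@L1on_le _ (circle R) _ (fun s => 2 * g1 s ^+ 2 + 2 * g2 s ^+ 2)) => //.
  - by apply: L1onD => //; apply: L1onZ.
  - by apply: measurable_funTS; apply: measurable_funX; exact: measurable_funB.
  - move=> x _; rewrite !ger0_norm ?sqr_ge0//; last by rewrite addr_ge0// mulr_ge0// sqr_ge0.
    by have := sqr_ge0 (g1 x + g2 x); rewrite /= !expr2; lra.
move=> phi sphi.
have cphi n : continuous (derive1n n phi).
  by move=> x; apply: differentiable_continuous; apply/derivable1_diffP; exact: sphi.2.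
have cphi0 : continuous phi by have := cphi 0%N; rewrite derive1n0.
have cphi1 : continuous (derive1 phi) by have := cphi 1%N; rewrite derive1n1.
have [B B0 hB] := compact_le_bound (@segment_compact R 0 P) cphi0.
have j1 : L1on (circle R) (fun x => g1 x * phi x) by apply: (L1onM _ i1 cphi0 hB).
have j2 : L1on (circle R) (fun x => g2 x * phi x) by apply: (L1onM _ i2 cphi0 hB).
transitivity (\int[mu]_(x in circle R) (f1 x * derive1 phi x - f2 x * derive1 phi x)).
  by apply: eq_Rintegral => x _; rewrite /= mulrBl.
rewrite RintegralB//; [|by apply: ct_integrable; ct|by apply: ct_integrable; ct].
rewrite H1// H2// opprK addrC -[LHS]opprB; congr (- _).
by rewrite -RintegralB//; apply: eq_Rintegral => x _; rewrite /= mulrBl.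
Qed.

Lemma H1_sup f : H1 f -> forall x, 0 <= x <= P -> f x ^+ 2 <= (2 / P + 2 * P) * H1norm f ^+ 2.
Proof.
move=> [_ cf ex] x xP.
have wg : weak_derivative f (wderiv f) by exact: xgetPex ex.
rewrite /H1norm sqr_sqrtr; first exact: sobolev.
by apply: Rintegral_ge0 => y _; rewrite addr_ge0 ?sqr_ge0.
Qed.

Lemma H1B f1 f2 : H1 f1 -> H1 f2 -> H1 (f1 \- f2).
Proof.
move=> [p1 c1 [g1 w1]] [p2 c2 [g2 w2]]; split; first by move=> x; rewrite /= p1 p2.
- by move=> x; apply: cvgB; [exact: c1|exact: c2].
- by exists (g1 \- g2); exact: weak_derivativeB.
Qed.

(** The representative is chosen before [f], so that several periodic functions can be moved to the
    same point. *)
Lemma periodic_reduce (a x : R) : exists y, a <= y <= a + P /\ forall f : R -> R, periodic f P -> f x = f y.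
Proof.
have P0 := period_gt0; pose n := Num.floor ((x - a) / P).
exists (x - n%:~R * P); split.
  have h1 : n%:~R <= (x - a) / P by exact: floor_le.
  have h2 : (x - a) / P < (n + 1)%:~R by exact: floorD1_gt.
  rewrite ler_pdivlMr// in h1; rewrite ltr_pdivrMr// intrD mulrDl mul1r in h2; lra.
move=> f pf; have pn (m : nat) y : f (y + m%:R * P) = f y by rewrite mulr_natl (periodicn pf).
case: n => m; first by rewrite -[LHS](pn m) -pmulrn -(pn m (x - _)) subrK (pn m).
by rewrite NegzE mulrNz mulNr opprK -pmulrn pn.
Qed.

(** The H^1 norm dominates the supremum norm, so [u t] depends on [t] continuously in C(T). *)
Lemma continuous_H1_cont2 (u : R -> R -> R) : continuous_H1 u -> cont2 u.
Proof.
move=> [h1 hc] [t0 x0].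
have P0 := period_gt0; pose K : R := 2 / P + 2 * P.
have K0 : 0 < K by rewrite addr_gt0 ?divr_gt0 ?mulr_gt0.
apply/cvgrPdist_lt => /= e e0.
have e2 : 0 < e / 2 by lra.
have eK : 0 < e / 2 / (K + 1) by rewrite divr_gt0//; lra.
have /cvgrPdist_lt /(_ _ eK) n1 := hc t0.
have c0 : continuous (u t0) by have [] := h1 t0.
have /cvgrPdist_lt /(_ _ e2) n2 := c0 x0.
exists ([set s | `|0 - H1norm (u s \- u t0)| < e / 2 / (K + 1)], [set x | `|u t0 x0 - u t0 x| < e / 2]) => //=.
move=> [t x] /= [k1 k2].
have [y [yP E]] := periodic_reduce 0 x; rewrite add0r in yP.
have [pt _ _] := h1 t; have [p0 _ _] := h1 t0.
have := H1_sup (H1B (h1 t) (h1 t0)) yP; rewrite /= -E// -[u t0 y]E// => k.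
have k3 : `|u t x - u t0 x| < e / 2.
  rewrite -(@ltr_pXn2r _ 2) ?nnegrE ?(ltW e2)// real_normK ?num_real//.
  apply: (le_lt_trans k); rewrite sub0r normrN in k1.
  have k4 : H1norm (u t \- u t0) ^+ 2 < (e / 2 / (K + 1)) ^+ 2.
    by rewrite -(real_normK (num_real (H1norm _))) ltr_pXn2r ?nnegrE// ltW.
  apply: (@lt_le_trans _ _ (K * (e / 2 / (K + 1)) ^+ 2)); first by rewrite ltr_pM2l.
  have -> : K * (e / 2 / (K + 1)) ^+ 2 = K / (K + 1) ^+ 2 * (e / 2) ^+ 2 by field; rewrite gt_eqF//; lra.
  rewrite -[leRHS]mul1r ler_wpM2r ?sqr_ge0// ler_pdivrMr ?exprn_gt0//; last lra.
  by rewrite mul1r expr2; have := mulr_gt0 K0 K0; lra.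
by move: k2 k3; rewrite !ltr_norml; lra.
Qed.

End Sobolev.

(** * The evolution equation *)

Section Green.
Context {R : realType}.
Notation P := (pi *+ 2 : R).
Implicit Types f g : R -> R.

(** The sum of the geometric series of ratio [exp(- P)]: it folds the exponential kernel of a
    half-line onto one period. *)
Definition gc : R := (1 - expR (- P))^-1.

Lemma gc_gt0 : 0 < 1 - expR (- P).
Proof. by rewrite subr_gt0 expR_lt1 oppr_lt0 period_gt0. Qed.

Lemma gcK : gc * (1 - expR (- P)) = 1.
Proof. by rewrite mulVf// gt_eqF// gc_gt0. Qed.

(* [greenl f] and [greenr f] are the periodic solutions of q + q' = f and p - p' = f;
   since 1 - d^2 = (1 - d) (1 + d), the periodic solution of w - w'' = f is their mean. *)
Definition greenl f x := gc * (expR (- x) * J (fun y => expR y * f y) (x - P) x).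
Definition greenr f x := gc * (expR x * J (fun y => expR (- y) * f y) x (x + P)).
Definition green f x := (greenr f x + greenl f x) / 2.
Definition dgreen f x := (greenr f x - greenl f x) / 2.

Lemma der_greenl f : continuous f -> periodic f P -> der (greenl f) (fun x => f x - greenl f x).
Proof.
move=> cf pf x.
have cg : continuous (fun y => expR y * f y) by ct.
have dp := der_prim cg.
have d1 : dv x (fun x => prim (fun y => expR y * f y) (x - P)) (expR (x - P) * f (x - P)).
  by apply: dv_shift; exact: dp.
have d2 : dv x (prim (fun y => expR y * f y)) (expR x * f x) by exact: dp.
apply: dv_eq.
  apply: dvM; first exact: dv_cst.
  apply: dvM; first by apply: dv_exp; apply: dvN; exact: dv_id.
  by apply: dvD; [exact: d2|apply: dvN; exact: d1].
have -> : f (x - P) = f x by rewrite -[in RHS](subrK P x) pf.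
rewrite /= mul0r add0r -/(J _ (x - P) x) expRD /greenl.
have e : expR (- x) * expR x = 1 by rewrite -expRD addNr expR0.
have g := gcK.
transitivity (gc * (1 - expR (- P)) * (expR (- x) * expR x) * f x -
  gc * (expR (- x) * J (fun y => expR y * f y) (x - P) x)); first by ring.
by rewrite g e !mul1r.
Qed.

Lemma der_greenr f : continuous f -> periodic f P -> der (greenr f) (fun x => greenr f x - f x).
Proof.
move=> cf pf x.
have cg : continuous (fun y => expR (- y) * f y) by ct.
have dp := der_prim cg.
have d1 : dv x (fun x => prim (fun y => expR (- y) * f y) (x + P)) (expR (- (x + P)) * f (x + P)).
  by apply: dv_shift; exact: dp.
have d2 : dv x (prim (fun y => expR (- y) * f y)) (expR (- x) * f x) by exact: dp.
apply: dv_eq.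
  apply: dvM; first exact: dv_cst.
  apply: dvM; first by apply: dv_exp; exact: dv_id.
  by apply: dvD; [exact: d1|apply: dvN; exact: d2].
rewrite /= pf mul0r add0r -/(J _ x (x + P)) opprD expRD /greenr.
have e : expR x * expR (- x) = 1 by rewrite -expRD subrr expR0.
have g := gcK.
transitivity (gc * (expR x * J (fun y => expR (- y) * f y) x (x + P)) -
  gc * (1 - expR (- P)) * (expR x * expR (- x)) * f x); first by ring.
by rewrite g e !mul1r.
Qed.

Lemma der_green f : continuous f -> periodic f P -> der (green f) (dgreen f).
Proof.
move=> cf pf x; have dl := der_greenl cf pf; have dr := der_greenr cf pf.
apply: dv_eq; first by apply: dvM; [apply: dvD; [exact: dr|exact: dl]|exact: dv_cst].
by rewrite mulr0 addr0 /dgreen; congr (_ / 2); ring.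
Qed.

Lemma der_dgreen f : continuous f -> periodic f P -> der (dgreen f) (fun x => green f x - f x).
Proof.
move=> cf pf x; have dl := der_greenl cf pf; have dr := der_greenr cf pf.
apply: dv_eq; first by apply: dvM; [apply: dvD; [exact: dr|apply: dvN; exact: dl]|exact: dv_cst].
by rewrite mulr0 addr0 /green; field.
Qed.

Lemma periodic_greenl f : continuous f -> periodic f P -> periodic (greenl f) P.
Proof.
move=> cf pf x; rewrite /greenl opprD expRD addrAC.
rewrite -(J_shift (f := fun y => expR y * f y)); last by ct.
rewrite (_ : (fun _ => _) = (fun y => expR P * (expR y * f y))); last first.
  by apply/funext => y; rewrite pf expRD; ring.
rewrite JZ; last by ct.
have e : expR (- P) * expR P = 1 by rewrite -expRD addNr expR0.
transitivity (gc * (expR (- x) * J (fun y => expR y * f y) (x - P) x) * (expR (- P) * expR P)); first by ring.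
by rewrite e mulr1.
Qed.

Lemma periodic_greenr f : continuous f -> periodic f P -> periodic (greenr f) P.
Proof.
move=> cf pf x; rewrite /greenr expRD.
rewrite -(J_shift (f := fun y => expR (- y) * f y)); last by ct.
rewrite (_ : (fun _ => _) = (fun y => expR (- P) * (expR (- y) * f y))); last first.
  by apply/funext => y; rewrite pf opprD expRD; ring.
rewrite JZ; last by ct.
have e : expR (- P) * expR P = 1 by rewrite -expRD addNr expR0.
transitivity (gc * (expR x * J (fun y => expR (- y) * f y) x (x + P)) * (expR (- P) * expR P)); first by ring.
by rewrite e mulr1.
Qed.

Lemma periodic_green f : continuous f -> periodic f P -> periodic (green f) P.
Proof. by move=> cf pf x; rewrite /green (periodic_greenl cf pf) (periodic_greenr cf pf). Qed.

Lemma periodic_dgreen f : continuous f -> periodic f P -> periodic (dgreen f) P.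
Proof. by move=> cf pf x; rewrite /dgreen (periodic_greenl cf pf) (periodic_greenr cf pf). Qed.

(** The kernel is positive and of total mass 1. The constant 1 reappears in the Cauchy estimates for
    the Taylor coefficients in time. *)
Lemma norm_greenl f M x : continuous f -> (forall y, `|f y| <= M) -> `|greenl f x| <= M.
Proof.
move=> cf fM; have P0 := @period_gt0 R; have g0 := gc_gt0.
rewrite /greenl !normrM (gtr0_norm (_ : 0 < gc)) ?invr_gt0// (gtr0_norm (expR_gt0 _)).
have h : `|J (fun y => expR y * f y) (x - P) x| <= M * (expR x - expR (x - P)).
  have dE : der (fun y => M * expR y) (fun y => M * expR y).
    move=> y; apply: dv_eq; first by apply: dvM; [exact: dv_cst|apply: (dv_exp (F := id)); exact: dv_id].
    by rewrite mul0r add0r mulr1.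
  have cE : continuous (fun y : R => M * expR y) by ct.
  have cEN : continuous (fun y : R => - (M * expR y)) by ct.
  have E : J (fun y => M * expR y) (x - P) x = M * (expR x - expR (x - P)).
    by rewrite (J_FTC _ _ cE dE); ring.
  have cg : continuous (fun y => expR y * f y) by ct.
  have xP : x - P <= x by lra.
  rewrite -E ler_norml -JN//; apply/andP; split; apply: le_J => // y _.
    by rewrite mulrC -mulrN ler_wpM2l ?expR_ge0//; have := fM y; rewrite ler_norml => /andP[].
  by rewrite mulrC ler_wpM2r ?expR_ge0//; have := fM y; rewrite ler_norml => /andP[].
have k := ler_wpM2l (ltW (expR_gt0 (- x))) h.
have g1 : 0 <= gc by rewrite ltW// invr_gt0.
apply: (le_trans (ler_wpM2l g1 k)).
have e : expR (- x) * expR x = 1 by rewrite -expRD addNr expR0.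
rewrite expRD (_ : gc * _ = gc * (1 - expR (- P)) * (expR (- x) * expR x) * M); last by ring.
by rewrite gcK e !mul1r.
Qed.

Lemma greenr_refl f x : continuous f -> greenr f x = greenl (fun y => f (- y)) (- x).
Proof.
move=> cf; rewrite /greenr /greenl opprK; congr (_ * (_ * _)).
have cg : continuous (fun y => expR (- y) * f y) by ct.
have dp := der_prim cg.
have h : der (fun y => - prim (fun y => expR (- y) * f y) (- y)) (fun y => expR y * f (- y)).
  move=> y; apply: dv_eq.
    by apply: dvN; apply: (dv_comp (F := fun y => - y)); [apply: dvN; exact: dv_id|exact: dp].
  by rewrite opprK; ring.
have cN : continuous (fun y : R => - y) by ct.
have cf' : continuous (fun y => f (- y)) by exact: ct_comp cf cN.
rewrite (J_FTC _ _ _ h); last by ct.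
by rewrite !opprK /J opprD !opprK; ring.
Qed.

Lemma norm_greenr f M x : continuous f -> (forall y, `|f y| <= M) -> `|greenr f x| <= M.
Proof.
move=> cf fM; rewrite greenr_refl//; apply: norm_greenl => //.
have cN : continuous (fun y : R => - y) by ct.
exact: ct_comp cf cN.
Qed.

Lemma norm_dgreen f M x : continuous f -> (forall y, `|f y| <= M) -> `|dgreen f x| <= M.
Proof.
move=> cf fM; have := norm_greenl x cf fM; have := norm_greenr x cf fM.
by rewrite /dgreen; move: (greenl f x) (greenr f x) => a b; rewrite !ler_norml; lra.
Qed.

Lemma greenlD f g x : continuous f -> continuous g ->
  greenl (fun y => f y + g y) x = greenl f x + greenl g x.
Proof.
move=> cf cg; rewrite /greenl -!mulrDr -JD; [|by ct|by ct].
rewrite (_ : (fun y => expR y * (f y + g y)) = (fun y => expR y * f y + expR y * g y))//.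
by apply/funext => y; rewrite mulrDr.
Qed.

Lemma greenrD f g x : continuous f -> continuous g ->
  greenr (fun y => f y + g y) x = greenr f x + greenr g x.
Proof.
move=> cf cg; rewrite /greenr -!mulrDr -JD; [|by ct|by ct].
rewrite (_ : (fun y => expR (- y) * (f y + g y)) = (fun y => expR (- y) * f y + expR (- y) * g y))//.
by apply/funext => y; rewrite mulrDr.
Qed.

Lemma greenlZ c f x : continuous f -> greenl (fun y => c * f y) x = c * greenl f x.
Proof.
move=> cf; rewrite /greenl (_ : (fun _ => _) = (fun y => c * (expR y * f y))).
  by rewrite JZ; [ring|ct].
by apply/funext => y; ring.
Qed.

Lemma greenrZ c f x : continuous f -> greenr (fun y => c * f y) x = c * greenr f x.
Proof.
move=> cf; rewrite /greenr (_ : (fun _ => _) = (fun y => c * (expR (- y) * f y))).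
  by rewrite JZ; [ring|ct].
by apply/funext => y; ring.
Qed.

Lemma dgreenD f g x : continuous f -> continuous g ->
  dgreen (fun y => f y + g y) x = dgreen f x + dgreen g x.
Proof. by move=> cf cg; rewrite /dgreen greenlD// greenrD//; field. Qed.

Lemma dgreenZ c f x : continuous f -> dgreen (fun y => c * f y) x = c * dgreen f x.
Proof. by move=> cf; rewrite /dgreen greenlZ// greenrZ//; field. Qed.

Lemma dgreen_cst c x : dgreen (fun=> c) x = 0.
Proof.
have dE : der (fun y : R => expR y * c) (fun y => expR y * c).
  move=> y; apply: dv_eq; first by apply: dvM; [apply: (dv_exp (F := id)); exact: dv_id|exact: dv_cst].
  by rewrite mulr0 addr0 mulr1.
have e : greenl (fun=> c) =1 fun=> c.
  move=> y; rewrite /greenl (J_FTC _ _ _ dE) /=; last by ct.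
  have e : expR (- y) * expR y = 1 by rewrite -expRD addNr expR0.
  rewrite expRD (_ : gc * _ = gc * (1 - expR (- P)) * (expR (- y) * expR y) * c); last by ring.
  by rewrite gcK e !mul1r.
have cc : continuous (fun _ : R => c) by ct.
by rewrite /dgreen greenr_refl// !e subrr mul0r.
Qed.

Lemma cont2_greenl (f : R -> R -> R) : cont2 f -> cont2 (fun t => greenl (f t)).
Proof.
move=> cf; rewrite /cont2 /greenl; apply: ctM; first by ct.
apply: ctM; first by ct.
have cg : cont2 (fun t y => expR y * f t y) by ct.
by apply: (ct_J cg); ct.
Qed.

Lemma cont2_greenr (f : R -> R -> R) : cont2 f -> cont2 (fun t => greenr (f t)).
Proof.
move=> cf; rewrite /cont2 /greenr; apply: ctM; first by ct.
apply: ctM; first by ct.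
have cg : cont2 (fun t y => expR (- y) * f t y) by ct.
by apply: (ct_J cg); ct.
Qed.

Lemma cont2_green (f : R -> R -> R) : cont2 f -> cont2 (fun t => green (f t)).
Proof.
move=> cf; rewrite /cont2 /green; apply: ctM; last exact: ct_cst.
by apply: ctD; [exact: cont2_greenr|exact: cont2_greenl].
Qed.

Lemma cont2_dgreen (f : R -> R -> R) : cont2 f -> cont2 (fun t => dgreen (f t)).
Proof.
move=> cf; rewrite /cont2 /dgreen; apply: ctM; last exact: ct_cst.
by apply: ctD; [exact: cont2_greenr|apply: ctN; exact: cont2_greenl].
Qed.

Lemma der_dgreen_param (f ft : R -> R -> R) x : cont2 f -> cont2 ft ->
  (forall y, der (f ^~ y) (ft ^~ y)) ->
  der (fun t => dgreen (f t) x) (fun t => dgreen (ft t) x).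
Proof.
move=> cf cft df; have P0 := @period_gt0 R.
have dl : der (fun t => greenl (f t) x) (fun t => greenl (ft t) x).
  have h : der (fun t => J (fun y => expR y * f t y) (x - P) x) (fun t => J (fun y => expR y * ft t y) (x - P) x).
    apply: der_J_param; [by ct|by ct| |lra].
    by move=> y t; apply: dv_eq; [apply: dvM; [exact: dv_cst|exact: df]|rewrite mul0r add0r].
  move=> t; apply: dv_eq.
    by apply: dvM; [exact: dv_cst|apply: dvM; [exact: dv_cst|exact: h]].
  by rewrite !mul0r !add0r.
have dr : der (fun t => greenr (f t) x) (fun t => greenr (ft t) x).
  have h : der (fun t => J (fun y => expR (- y) * f t y) x (x + P)) (fun t => J (fun y => expR (- y) * ft t y) x (x + P)).
    apply: der_J_param; [by ct|by ct| |lra].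
    by move=> y t; apply: dv_eq; [apply: dvM; [exact: dv_cst|exact: df]|rewrite mul0r add0r].
  move=> t; apply: dv_eq.
    by apply: dvM; [exact: dv_cst|apply: dvM; [exact: dv_cst|exact: h]].
  by rewrite !mul0r !add0r.
move=> t; apply: dv_eq; first by apply: dvM; [apply: dvD; [exact: dr|apply: dvN; exact: dl]|exact: dv_cst].
by rewrite mulr0 addr0.
Qed.

End Green.

(** * From Fourier modes to a pointwise equation in time *)

Section Evolution.
Context {R : realType}.
Notation P := (pi *+ 2 : R).
Implicit Types f g : R -> R.

(** Identifies [dgreen] with [d_x (1 - d_x^2)^-1] on each mode: two integrations by parts, with
    boundary terms cancelled by periodicity, and [w'' = w - f] for [w = green f]. *)
Lemma dgreen_fourier f (k : int) th : continuous f -> periodic f P ->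
  J (fun x => f x * (k%:~R * cos (k%:~R * x + (th + pi / 2)))) 0 P =
  - ((1 + k%:~R ^+ 2) * J (fun x => dgreen f x * cos (k%:~R * x + th)) 0 P).
Proof.
move=> cf pf; set K : R := k%:~R.
have dg := der_green cf pf; have ddg := der_dgreen cf pf.
have cg := dv_cont dg; have cdg := dv_cont ddg.
have dc := der_cos_lin K th 1; have dc2 := der_cos_lin K (th + pi / 2) K.
have cc : continuous (fun x : R => 1 * cos (K * x + th)) by ct.
have cc1 : continuous (fun x : R => 1 * K * cos (K * x + (th + pi / 2))) by ct.
have cc2 : continuous (fun x : R => K * cos (K * x + (th + pi / 2))) by ct.
have cc3 : continuous (fun x : R => K * K * cos (K * x + (th + pi / 2 + pi / 2))) by ct.
have cgf : continuous (fun x => green f x - f x) by apply: ctD => //; ct.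
have per th' : cos (K * P + th') = cos (K * 0 + th') by rewrite -{1}[P]add0r cos_periodicz.
have pg : green f P = green f 0 by rewrite -{1}[P]add0r periodic_green.
have pdg : dgreen f P = dgreen f 0 by rewrite -{1}[P]add0r periodic_dgreen.
have e1 := J_parts 0 P dg dc cdg cc1; have e2 := J_parts 0 P ddg dc2 cgf cc3.
move: e1 e2; rewrite !per pg pdg !subrr !sub0r => e1 e2.
have s1 : J (fun x => green f x * (1 * K * cos (K * x + (th + pi / 2)))) 0 P =
    J (fun x => green f x * (K * cos (K * x + (th + pi / 2)))) 0 P.
  by congr J; apply/funext => x; rewrite mul1r.
have s2 : J (fun x => dgreen f x * (1 * cos (K * x + th))) 0 P = J (fun x => dgreen f x * cos (K * x + th)) 0 P.
  by congr J; apply/funext => x; rewrite mul1r.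
have s3 : J (fun x => dgreen f x * (K * K * cos (K * x + (th + pi / 2 + pi / 2)))) 0 P =
    - (K * K) * J (fun x => dgreen f x * cos (K * x + th)) 0 P.
  rewrite -JZ; last by apply: ctM => //; ct.
  congr J; apply/funext => x.
  have -> : K * x + (th + pi / 2 + pi / 2) = K * x + th + pi by field.
  by rewrite cosDpi; ring.
have s4 : J (fun x => (green f x - f x) * (K * cos (K * x + (th + pi / 2)))) 0 P =
    J (fun x => green f x * (K * cos (K * x + (th + pi / 2)))) 0 P -
    J (fun x => f x * (K * cos (K * x + (th + pi / 2)))) 0 P.
  rewrite -JB; [|by apply: ctM|by apply: ctM].
  by congr J; apply/funext => x; rewrite mulrBl.
move: e1 e2; rewrite s1 s2 s3 s4 => e1 e2.
have -> : J (fun x => f x * (K * cos (K * x + (th + pi / 2)))) 0 P =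
  J (fun x => green f x * (K * cos (K * x + (th + pi / 2)))) 0 P - - - (J (fun x => green f x * (K * cos (K * x + (th + pi / 2)))) 0 P -
    J (fun x => f x * (K * cos (K * x + (th + pi / 2)))) 0 P) by ring.
by rewrite -e2 e1 expr2; ring.
Qed.

Definition flux (u : R -> R) (x : R) : R := u x + u x ^+ 2 / 2.

(** After Fubini, the defect [D] of the equation integrated over [t1, t2] has all its modes equal to
    0, so it vanishes at every x. Then [u ^~ x] is a constant minus a primitive of [g ^~ x], which
    makes it differentiable. *)
Lemma fourier_evolution (u g : R -> R -> R) : cont2 u -> (forall t, periodic (u t) P) ->
  cont2 g -> (forall t, periodic (g t) P) ->
  (forall (k : int) th t1 t2, J (fun x => u t2 x * cos (k%:~R * x + th)) 0 P -
      J (fun x => u t1 x * cos (k%:~R * x + th)) 0 P =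
    - J (fun t => J (fun x => g t x * cos (k%:~R * x + th)) 0 P) t1 t2) ->
  forall x, der (u ^~ x) (fun t => - g t x).
Proof.
move=> cu pu cg pg H; have P0 := @period_gt0 R.
have E t1 t2 x : u t2 x - u t1 x + J (g ^~ x) t1 t2 = 0.
  pose D x := u t2 x - u t1 x + J (g ^~ x) t1 t2.
  have c1 := cont2_slice t1 cu; have c2 := cont2_slice t2 cu.
  have cgT : cont2 (fun x t => g t x) by ct.
  have cJ : continuous (fun x => J (g ^~ x) t1 t2).
    by apply: (ct_J (t := id) cgT); [exact: ct_id|exact: ct_cst|exact: ct_cst].
  have cD : continuous D by apply: ctD => //; ct.
  have D0 : forall x, 0 <= x <= P -> D x = 0.
    apply: (fourier_eq0 cD) => k th; set K : R := k%:~R.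
    have cc : continuous (fun x : R => cos (K * x + th)) by ct.
    have cgc : cont2 (fun t x => g t x * cos (K * x + th)) by ct.
    have h2 : J (fun x => J (g ^~ x) t1 t2 * cos (K * x + th)) 0 P =
        J (fun t => J (fun x => g t x * cos (K * x + th)) 0 P) t1 t2.
      rewrite -(J_swap t1 t2 cgc (ltW P0)).
      congr J; apply/funext => y; rewrite mulrC -JZ; last exact: (cont2_slicel y cg).
      by congr J; apply/funext => t; rewrite mulrC.
    rewrite (_ : (fun x => D x * _) = (fun x =>
       (u t2 x * cos (K * x + th) - u t1 x * cos (K * x + th)) + J (g ^~ x) t1 t2 * cos (K * x + th))); last first.
      by apply/funext => y; rewrite /D; ring.
    rewrite JD; [|by ct|by apply: ctM].
    rewrite JB; [|by ct|by ct].
    by rewrite h2 H addNr.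
  have pD : periodic D P.
    by move=> y; rewrite /D !pu; congr (_ + J _ _ _); apply/funext => t; rewrite pg.
  have [y [yP e]] := periodic_reduce 0 x; rewrite add0r in yP.
  by rewrite -(D0 y yP) -(e D pD).
move=> x t.
have cgx := cont2_slicel x cg.
have uE : u ^~ x = fun t => u 0 x - (prim (g ^~ x) t - prim (g ^~ x) 0).
  by apply/funext => s; have := E 0 s x; rewrite /J; lra.
rewrite uE; have dp := der_prim cgx; apply: dv_eq.
  by apply: dvD; [exact: dv_cst|apply: dvN; apply: dvD; [exact: dp|apply: dvN; exact: dv_cst]].
by ring.
Qed.

Lemma BBM_evolution (u : R -> R -> R) : cont2 u -> (forall t, periodic (u t) P) ->
  BBM_distributional u -> forall x, der (u ^~ x) (fun t => - dgreen (flux (u t)) x).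
Proof.
move=> cu pu hu.
have cN : cont2 (fun t => flux (u t)) by rewrite /cont2 /flux; ct.
have cNt t : continuous (flux (u t)) by exact: (cont2_slice t cN).
have pN t : periodic (flux (u t)) P by move=> x; rewrite /flux pu.
apply: (fourier_evolution cu pu (cont2_dgreen cN)) => [t|k th t1 t2]; first exact: periodic_dgreen.
have h := BBM_fourier k th t1 t2 cu hu.
have e t : J (fun x => (u t x + u t x ^+ 2 / 2) * (k%:~R * cos (k%:~R * x + (th + pi / 2)))) 0 P =
  - (1 + k%:~R ^+ 2) * J (fun x => dgreen (flux (u t)) x * cos (k%:~R * x + th)) 0 P.
  by rewrite mulNr -(dgreen_fourier k th (cNt t) (pN t)).
have K0 : 0 < 1 + k%:~R ^+ 2 :> R by have := sqr_ge0 (k%:~R : R); lra.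
have cgc : cont2 (fun t x => dgreen (flux (u t)) x * cos (k%:~R * x + th)).
  by apply: ctM; [exact: (cont2_dgreen cN)|ct].
have cJg : continuous (fun t => J (fun x => dgreen (flux (u t)) x * cos (k%:~R * x + th)) 0 P).
  by apply: (ct_J (t := id) cgc); [exact: ct_id|exact: ct_cst|exact: ct_cst].
apply: (mulfI (lt0r_neq0 K0)); rewrite h (funext e).
by rewrite (JZ _ _ _ cJg) mulNr mulrN.
Qed.

End Evolution.

(** * Analyticity in time *)

Section PowerSeries.
Context {R : realType}.

(** Comparison with the primitive of the bound along [t0 + s * r]: [s] selects the side of [t0], and
    the factor [e] in [F] the sign of [f]. *)
Lemma growth_le (f f' : R -> R) (S t0 c : R) (j : nat) : der f f' -> f t0 = 0 ->
  (forall t, `|t| <= S -> `|f' t| <= c * `|t - t0| ^+ j) -> `|t0| <= S ->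
  forall t, `|t| <= S -> `|f t| <= c / j.+1%:R * `|t - t0| ^+ j.+1.
Proof.
move=> df f0 hf t0S.
suff main (s : R) : s = 1 \/ s = -1 -> forall t, `|t| <= S -> 0 <= s * (t - t0) ->
    `|f t| <= c / j.+1%:R * (s * (t - t0)) ^+ j.+1.
  move=> t tS; case: (leP t0 t) => tt.
    have t1 : 0 <= 1 * (t - t0) by lra.
    have -> : `|t - t0| = 1 * (t - t0) by rewrite mul1r in t1 *; rewrite ger0_norm.
    by apply: main => //; left.
  have t1 : 0 <= -1 * (t - t0) by lra.
  have -> : `|t - t0| = -1 * (t - t0) by rewrite mulN1r ltr0_norm// subr_lt0.
  by apply: main => //; right.
move=> s1 t tS st.
have s2 : s * s = 1 by case: s1 => ->; ring.
pose F e r := e * f (t0 + s * r) - c / j.+1%:R * r ^+ j.+1.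
have dF e : der (F e) (fun r => e * (s * f' (t0 + s * r)) - c * r ^+ j).
  move=> r; rewrite /F.
  have d1 : dv r (fun r => f (t0 + s * r)) (f' (t0 + s * r) * s).
    apply: (dv_comp (F := fun r => t0 + s * r)); last exact: df.
    by apply: dv_eq; [apply: dvD; [exact: dv_cst|apply: dvM; [exact: dv_cst|exact: dv_id]]|rewrite mul0r !add0r mulr1].
  apply: dv_eq.
    by apply: dvD; [apply: dvM; [exact: dv_cst|exact: d1]|apply: dvN; apply: dvM; [exact: dv_cst|apply: dvX; exact: dv_id]].
  by rewrite /=; field; rewrite gt_eqF//; have := ler0n R j; lra.
have r0 : 0 <= s * (t - t0) := st.
have decr e : `|e| = 1 -> F e (s * (t - t0)) <= F e 0.
  move=> e1.
  have dG : der (fun r => - F e r) (fun r => - (e * (s * f' (t0 + s * r)) - c * r ^+ j)).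
    by move=> r; apply: dvN; exact: dF.
  suff : - F e 0 <= - F e (s * (t - t0)) by lra.
  apply: (der_nondecr r0 dG) => r /andP[rp rs].
  have tr : t0 + s * r - t0 = s * r by ring.
  have sr : `|s * r| = r by case: s1 => ->; rewrite ?mul1r ?mulN1r ?normrN ger0_norm.
  have rS : `|t0 + s * r| <= S.
    by move: tS t0S rs rp; rewrite !ler_norml; case: s1 => ->; lra.
  have := hf _ rS; rewrite tr sr => k.
  have : `|e * (s * f' (t0 + s * r))| <= c * r ^+ j.
    rewrite !normrM e1 mul1r (_ : `|s| = 1) ?mul1r//.
    by case: s1 => ->; rewrite ?normrN normr1.
  by rewrite ler_norml; lra.
have tE : t0 + s * (s * (t - t0)) = t by rewrite mulrA s2; ring.
have F0 e : F e 0 = 0 by rewrite /F mulr0 addr0 f0 expr0n /= mulr0; ring.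
have k1 := decr 1 (normr1 _); have k2 : F (-1) (s * (t - t0)) <= F (-1) 0 by apply: decr; rewrite normrN normr1.
have E e : F e (s * (t - t0)) = e * f t - c / j.+1%:R * (s * (t - t0)) ^+ j.+1 by rewrite /F tE.
move: k1 k2; rewrite !F0 !E; move: (c / _ * _) => X k1 k2.
by rewrite ler_norml; lra.
Qed.

(* Normalised Taylor coefficients g_n = d^n g_0 / n!, with the Cauchy estimate |g_n| <= M rho^n. *)
Definition taylor_family (g : nat -> R -> R) (S M rho : R) :=
  (forall n, der (g n) (fun t => n.+1%:R * g n.+1 t)) /\
  forall n t, `|t| <= S -> `|g n t| <= M * rho ^+ n.

(** The Cauchy estimate for [g (n + j)] is integrated [j] times from [t0], where everything
    vanishes; the factors [n + 1], ..., [n + j] over [j!] make up the binomial coefficient. *)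
Lemma taylor_decay g S M rho t0 : taylor_family g S M rho -> `|t0| <= S ->
  (forall n, g n t0 = 0) -> forall j n t, `|t| <= S ->
  `|g n t| <= 'C(n + j, j)%:R * (M * rho ^+ (n + j)) * `|t - t0| ^+ j.
Proof.
move=> [dg bg] t0S z; elim=> [|j IH] n t tS.
  by rewrite addn0 bin0 mul1r expr0 mulr1; exact: bg.
have h s : `|s| <= S -> `|n.+1%:R * g n.+1 s| <= (n.+1%:R * ('C(n.+1 + j, j)%:R * (M * rho ^+ (n.+1 + j)))) * `|s - t0| ^+ j.
  by move=> sS; rewrite normrM normr_nat -mulrA ler_wpM2l// IH.
have := growth_le (dg n) (z n) h t0S tS.
suff -> : n.+1%:R * ('C(n.+1 + j, j)%:R * (M * rho ^+ (n.+1 + j))) / j.+1%:R = 'C(n + j.+1, j.+1)%:R * (M * rho ^+ (n + j.+1)) :> R by [].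
rewrite addSnnS.
have b : (n.+1 * 'C(n + j.+1, j) = j.+1 * 'C(n + j.+1, j.+1))%N.
  by rewrite mul_bin_left addnS -addSn addnK.
have br : n.+1%:R * 'C(n + j.+1, j)%:R = j.+1%:R * 'C(n + j.+1, j.+1)%:R :> R by rewrite -!natrM b.
rewrite mulrA br -mulrA mulrAC [j.+1%:R * _ * _]mulrC mulrA; field.
by rewrite gt_eqF//; have := ler0n R j; lra.
Qed.

End PowerSeries.

Section TaylorVanishing.
Context {R : realType}.

Lemma bin_le_exp2 n m : ('C(n, m) <= 2 ^ n)%N.
Proof.
elim: n m => [|n IH] [|m]; rewrite ?bin0 ?bin0n ?expn_gt0//.
by rewrite binS expnS mul2n -addnn leq_add.
Qed.

(** As the binomial coefficient is at most [2 ^ (n + j)], the decay bound is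
    [K * (2 * rho * |t - t0|) ^ j]. The threshold 1/4 makes its ratio at most 1/2, and [j] tends to
    infinity. *)
Lemma taylor_vanish_near (g : nat -> R -> R) S M rho t0 : taylor_family g S M rho -> 0 < M -> 0 < rho ->
  `|t0| <= S -> (forall n, g n t0 = 0) ->
  forall t, `|t| <= S -> rho * `|t - t0| <= 4^-1 -> forall n, g n t = 0.
Proof.
move=> tf M0 r0 t0S z t tS tr n; apply/eqP; rewrite -normr_le0 leNgt; apply/negP => gn.
pose K := 2 ^+ n * M * rho ^+ n.
have K0 : 0 < K by rewrite !mulr_gt0// exprn_gt0.
have q : 1 < 2 :> R by lra.
have [j hj] := exprn_unbounded (K / `|g n t|) q.
have := taylor_decay tf t0S z j n tS.
apply/negP; rewrite -ltNge.
apply: (@le_lt_trans _ _ (K * (2^-1) ^+ j)); last first.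
  by rewrite exprVn ltr_pdivrMr ?exprn_gt0// mulrC -ltr_pdivrMr.
apply: (@le_trans _ _ (2 ^+ (n + j) * (M * rho ^+ (n + j)) * `|t - t0| ^+ j)).
  rewrite ler_wpM2r ?exprn_ge0// ler_wpM2r ?mulr_ge0 ?exprn_ge0 ?(ltW M0) ?(ltW r0)//.
  by rewrite -natrX ler_nat bin_le_exp2.
have -> : 2 ^+ (n + j) * (M * rho ^+ (n + j)) * `|t - t0| ^+ j = K * (2 * (rho * `|t - t0|)) ^+ j.
  by rewrite /K !exprD !exprMn; ring.
rewrite ler_pM2l// lerXn2r ?nnegrE ?mulr_ge0 ?(ltW r0)//; lra.
Qed.

Lemma taylor_vanish (g : nat -> R -> R) S M rho t0 : taylor_family g S M rho -> 0 < M -> 0 < rho ->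
  `|t0| <= S -> (forall n, g n t0 = 0) -> forall t, `|t| <= S -> g 0%N t = 0.
Proof.
move=> tf M0 r0 t0S z.
have step (m : nat) t : `|t| <= S -> rho * `|t - t0| <= m%:R * 4^-1 -> forall n, g n t = 0.
  elim: m t => [|m IH] t tS.
    rewrite mul0r => h n; rewrite (_ : t = t0)//; apply/eqP; rewrite -subr_eq0 -normr_le0.
    by rewrite -(pmulr_rle0 _ r0).
  move=> h; pose l : R := m%:R / m.+1%:R.
  have m0 : 0 < m.+1%:R :> R by [].
  have mm : 0 <= m%:R :> R by [].
  have mS : m.+1%:R = m%:R + 1 :> R by rewrite natr1.
  have l0 : 0 <= l by rewrite divr_ge0.
  have l1 : 1 - l = m.+1%:R^-1 by rewrite /l mS; field; rewrite gt_eqF//; lra.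
  have li : 0 < m.+1%:R^-1 :> R by rewrite invr_gt0.
  have l2 : 0 <= 1 - l by rewrite l1 ltW.
  (* The point at fraction [m / (m + 1)] of the segment: [m] admissible steps from [t0] and a single
     one from [t]. The constants [M] and [rho] are the same on all of [- S, S], so the step length
     does not shrink. *)
  pose t' := t0 + l * (t - t0).
  have t'S : `|t'| <= S.
    have -> : t' = (1 - l) * t0 + l * t by rewrite /t'; ring.
    apply: le_trans (ler_normD _ _) _; rewrite (normrM (1 - l)) (normrM l) (ger0_norm l0) (ger0_norm l2).
    have -> : S = (1 - l) * S + l * S by ring.
    by apply: lerD; apply: ler_wpM2l.
  have z' : forall n, g n t' = 0.
    apply: IH => //.
    have -> : t' - t0 = l * (t - t0) by rewrite /t'; ring.
    rewrite (normrM l) (ger0_norm l0) mulrCA; apply: le_trans (ler_wpM2l l0 h) _.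
    by rewrite /l mulrA divfK ?gt_eqF.
  apply: (taylor_vanish_near tf M0 r0 t'S z' tS).
  have -> : t - t' = (1 - l) * (t - t0) by rewrite /t'; ring.
  rewrite (normrM (1 - l)) (ger0_norm l2).
  rewrite l1 mulrCA; apply: le_trans (ler_wpM2l (ltW li) h) _.
  by rewrite mulrA mulVf ?mul1r// gt_eqF.
move=> t tS.
pose x := rho * `|t - t0| * 4.
apply: (step (Num.bound x) t tS).
have x0 : 0 <= x by rewrite !mulr_ge0// ltW.
by have := archi_boundP x0; rewrite /x; lra.
Qed.

Lemma taylor_zero_on (g : nat -> R -> R) (a b : R) : (forall n, der (g n) (fun t => n.+1%:R * g n.+1 t)) ->
  (forall t, a < t < b -> g 0%N t = 0) -> forall n t, a < t < b -> g n t = 0.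
Proof.
move=> dg z; elim=> [//|n IH] t tab.
have h : dv t (g n) 0.
  apply: near_eq_is_derive (dv_cst t 0); near=> s; apply/esym/IH.
  apply/andP; split; near: s; [apply: lt_nbhsr|apply: lt_nbhsl]; lra.
have := dv_derive1 (dg n t); rewrite (dv_derive1 h) => /esym /eqP.
by rewrite mulf_eq0 pnatr_eq0 /= => /eqP.
Unshelve. all: by end_near. Qed.

End TaylorVanishing.

(** * Taylor coefficients in time of a solution *)

Section TimeAnalyticity.
Context {R : realType}.
Notation P := (pi *+ 2 : R).
Implicit Types u : R -> R -> R.

Definition tcoef u n t x : R := derive1n n (u ^~ x) t / n`!%:R.

Lemma tcoef0 u t x : tcoef u 0 t x = u t x.
Proof. by rewrite /tcoef fact0 divr1. Qed.

Lemma tcoefS u n x V : der (tcoef u n ^~ x) (V ^~ x) -> forall t, tcoef u n.+1 t x = V t x / n.+1%:R.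
Proof.
move=> d t; rewrite /tcoef derive1nS.
have nf : n`!%:R != 0 :> R by rewrite pnatr_eq0 -lt0n fact_gt0.
have -> : derive1n n (u ^~ x) = (fun s => n`!%:R * tcoef u n s x).
  by apply/funext => s; rewrite /tcoef mulrC divfK.
rewrite (@dv_derive1 _ t _ (n`!%:R * V t x)).
  by rewrite factS natrM invfM; field; rewrite nf gt_eqF//; have := ler0n R n; lra.
by apply: dv_eq; [apply: dvM; [exact: dv_cst|exact: d]|rewrite mul0r add0r].
Qed.

(** The n-th Taylor coefficient of u + u^2/2 when u has coefficients [V]: a Cauchy product. *)
Definition fluxcoef (V : nat -> R) n : R := V n + 2^-1 * \sum_(i < n.+1) V i * V (n - i)%N.

(** Leibniz rule for the Cauchy product: after reindexing, the term [a i * a (n.+1 - i)] collects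
    the weights [i] and [n + 1 - i]. *)
Lemma convolution_deriv (a : nat -> R) n :
  \sum_(i < n.+1) (i.+1%:R * a i.+1 * a (n - i)%N + a i * ((n - i).+1%:R * a (n - i).+1)) =
  n.+1%:R * \sum_(i < n.+2) a i * a (n.+1 - i)%N.
Proof.
rewrite big_split /=.
have -> : \sum_(i < n.+1) i.+1%:R * a i.+1 * a (n - i)%N = \sum_(i < n.+2) i%:R * (a i * a (n.+1 - i)%N).
  rewrite [RHS]big_ord_recl /= mul0r add0r; apply: eq_bigr => i _.
  by rewrite /bump /= add1n subSS mulrA.
have -> : \sum_(i < n.+1) a i * ((n - i).+1%:R * a (n - i).+1) = \sum_(i < n.+2) (n.+1 - i)%:R * (a i * a (n.+1 - i)%N).
  rewrite [RHS]big_ord_recr /= subnn mul0r addr0; apply: eq_bigr => i _.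
  by rewrite subSn ?leq_ord// mulrCA.
rewrite -big_split mulr_sumr /=; apply: eq_bigr => i _.
by rewrite -mulrDl -natrD subnKC// leq_ord.
Qed.

Lemma dv_sum (n : nat) (F : nat -> R -> R) (f : nat -> R) t :
  (forall k, (k <= n)%N -> dv t (F k) (f k)) ->
  dv t (fun s => \sum_(k < n.+1) F k s) (\sum_(k < n.+1) f k).
Proof.
elim: n => [|n IH] h.
  by under eq_fun do rewrite big_ord1; rewrite big_ord1; exact: h.
under eq_fun do rewrite big_ord_recr /=; rewrite big_ord_recr /=.
by apply: dvD; [apply: IH => k kn; apply: h; rewrite (leq_trans kn)|exact: h].
Qed.

Lemma dv_fluxcoef (V : nat -> R -> R) n t : (forall k, (k <= n)%N -> dv t (V k) (k.+1%:R * V k.+1 t)) ->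
  dv t (fun s => fluxcoef (V ^~ s) n) (n.+1%:R * fluxcoef (V ^~ t) n.+1).
Proof.
move=> h; rewrite /fluxcoef; apply: dv_eq.
  apply: dvD; first exact: h.
  apply: dvM; first exact: dv_cst.
  apply: (dv_sum (F := fun k s => V k s * V (n - k)%N s)) => k kn.
  by apply: dvM; apply: h => //; exact: leq_subr.
by rewrite mul0r add0r /= (convolution_deriv (V ^~ t)) mulrDr; congr (_ + _); rewrite mulrCA.
Qed.

Lemma cont2_fluxcoef (V : nat -> R -> R -> R) n : (forall k, (k <= n)%N -> cont2 (V k)) ->
  cont2 (fun t x => fluxcoef (fun k => V k t x) n).
Proof.
move=> cV; rewrite /cont2 /fluxcoef; apply: ctD; first exact: cV.
apply: ctM; first exact: ct_cst.
apply: (ct_sum (F := fun k (z : R * R) => V k z.1 z.2 * V (n - k)%N z.1 z.2)) => k kn.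
by apply: ctM; apply: cV => //; exact: leq_subr.
Qed.

(** The equation gives [(n + 1) u_(n+1) = - dgreen (fluxcoef n)], and the right-hand side can be
    differentiated in time under the integral. The induction is strong because the Cauchy product
    involves all lower coefficients. *)
Lemma tcoef_evolution u : cont2 u -> (forall t, periodic (u t) P) ->
  (forall x, der (u ^~ x) (fun t => - dgreen (flux (u t)) x)) ->
  forall n, [/\ cont2 (tcoef u n), forall t, periodic (tcoef u n t) P &
    forall x, der (tcoef u n ^~ x) (fun t => - dgreen (fun y => fluxcoef (fun k => tcoef u k t y) n) x)].
Proof.
move=> cu pu du.
suff H n : forall k, (k <= n)%N -> [/\ cont2 (tcoef u k), forall t, periodic (tcoef u k t) P &
    forall x, der (tcoef u k ^~ x) (fun t => - dgreen (fun y => fluxcoef (fun k => tcoef u k t y) k) x)].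
  by move=> n; exact: (H n).
have u0 : tcoef u 0 = u by apply/funext => t; apply/funext => x; rewrite tcoef0.
elim: n => [|n IH] k.
  rewrite leqn0 => /eqP ->; rewrite u0; split => // x t.
  apply: dv_eq (du x t) _; congr (- dgreen _ x); apply/funext => y.
  by rewrite /fluxcoef big_ord1 /= tcoef0 /flux expr2; ring.
rewrite leq_eqVlt => /predU1P[->|]; last by rewrite ltnS; exact: IH.
pose Q t y := fluxcoef (fun k => tcoef u k t y) n.
have cQ : cont2 Q by apply: (cont2_fluxcoef (V := tcoef u)) => i /IH[].
have pQ t : periodic (Q t) P.
  move=> y; rewrite /Q /fluxcoef; congr (_ + _ * _); first by have [_ -> _] := IH n (leqnn n).
  apply: eq_bigr => i _; have [_ -> _] := IH i (leq_ord i).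
  by have [_ -> _] := IH (n - i)%N (leq_subr _ _).
have E t x : tcoef u n.+1 t x = n.+1%:R^-1 * - dgreen (Q t) x.
  have [_ _ d] := IH n (leqnn n).
  by rewrite (tcoefS (V := fun t x => - dgreen (Q t) x) (d x)) mulrC.
have E' : tcoef u n.+1 = fun t x => n.+1%:R^-1 * - dgreen (Q t) x.
  by apply/funext => t; apply/funext => x; exact: E.
have cE : cont2 (tcoef u n.+1).
  by rewrite E' /cont2; apply: ctM; [exact: ct_cst|apply: ctN; exact: (cont2_dgreen cQ)].
split => // [t x|x].
  rewrite !E; congr (_ * - _); apply: periodic_dgreen => //.
  exact: (cont2_slice t cQ).
pose Q' t y := n.+1%:R * fluxcoef (fun k => tcoef u k t y) n.+1.
have cF : cont2 (fun t y => fluxcoef (fun k => tcoef u k t y) n.+1).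
  apply: (cont2_fluxcoef (V := tcoef u)) => i; rewrite leq_eqVlt => /predU1P[->//|].
  by rewrite ltnS => /IH[].
have cQ' : cont2 Q' by rewrite /cont2 /Q'; apply: ctM; [exact: ct_cst|exact: cF].
have dQ y : der (Q ^~ y) (Q' ^~ y).
  move=> t; apply: (dv_fluxcoef (V := fun k t => tcoef u k t y)) => i /IH[_ _ d].
  rewrite (tcoefS (V := fun t x => - dgreen (fun y => fluxcoef (fun k => tcoef u k t y) i) x) (d y)).
  by rewrite mulrC divfK ?pnatr_eq0//; exact: d.
have dg := der_dgreen_param x cQ cQ' dQ.
rewrite E' => t; apply: dv_eq.
  by apply: dvM; [exact: dv_cst|apply: dvN; exact: dg].
rewrite mul0r add0r /Q' dgreenZ; last exact: (cont2_slice t cF).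
by rewrite mulrN mulKf// pnatr_eq0.
Qed.

(** The [n + 1] terms of the Cauchy product are compensated by the division by [n + 1] in the
    recursion. What is left is [M + M^2 / 2], at most [M * (1 + M)], whence the rate [1 + M]. *)
Lemma tcoef_bound u S M : cont2 u -> (forall t, periodic (u t) P) ->
  (forall x, der (u ^~ x) (fun t => - dgreen (flux (u t)) x)) -> 0 < M ->
  (forall t x, `|t| <= S -> `|u t x| <= M) ->
  forall n t x, `|t| <= S -> `|tcoef u n t x| <= M * (1 + M) ^+ n.
Proof.
move=> cu pu du M0 hM n t x tS; have H := tcoef_evolution cu pu du.
have r0 : 0 <= 1 + M by lra.
suff : forall k, (k <= n)%N -> forall x, `|tcoef u k t x| <= M * (1 + M) ^+ k by apply.
elim: n {x} => [|n IH] k; first by rewrite leqn0 => /eqP -> x; rewrite expr0 mulr1 tcoef0; exact: hM.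
rewrite leq_eqVlt => /predU1P[-> x|]; last by rewrite ltnS; exact: IH.
have [_ _ d] := H n.
rewrite (tcoefS (V := fun t x => - dgreen (fun y => fluxcoef (fun k => tcoef u k t y) n) x) (d x)).
have n0 : 0 < n.+1%:R :> R by [].
rewrite normrM normrN normfV (gtr0_norm n0) ler_pdivrMr//.
have cF : cont2 (fun t y => fluxcoef (fun k => tcoef u k t y) n).
  by apply: (cont2_fluxcoef (V := tcoef u)) => i _; have [] := H i.
apply: norm_dgreen => [|y]; first exact: (cont2_slice t cF).
rewrite /fluxcoef; apply: le_trans (ler_normD _ _) _.
have h1 := IH n (leqnn n) y.
have h2 : `|\sum_(i < n.+1) tcoef u i t y * tcoef u (n - i)%N t y| <= n.+1%:R * (M ^+ 2 * (1 + M) ^+ n).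
  apply: le_trans (ler_norm_sum _ _ _) _.
  rewrite mulr_natl -[X in _ *+ X](card_ord n.+1) -sumr_const; apply: ler_sum => i _.
  have -> : M ^+ 2 * (1 + M) ^+ n = (M * (1 + M) ^+ i) * (M * (1 + M) ^+ (n - i)).
    by rewrite mulrACA -exprD subnKC ?leq_ord// expr2.
  by rewrite normrM ler_pM// IH ?leq_ord ?leq_subr.
have half : 0 <= 2^-1 :> R by rewrite invr_ge0.
rewrite (normrM 2^-1) (ger0_norm half); apply: (le_trans (lerD h1 (ler_wpM2l half h2))).
have q0 : 0 <= M * (1 + M) ^+ n by rewrite mulr_ge0 ?exprn_ge0 ?(ltW M0).
have q1 : M * (1 + M) ^+ n <= n.+1%:R * (M * (1 + M) ^+ n) by rewrite ler_peMl// ler1n.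
have q2 : 0 <= n.+1%:R * (M ^+ 2 * (1 + M) ^+ n) by rewrite !mulr_ge0 ?exprn_ge0 ?(ltW M0).
have -> : M * (1 + M) ^+ n.+1 * n.+1%:R = n.+1%:R * (M * (1 + M) ^+ n) + n.+1%:R * (M ^+ 2 * (1 + M) ^+ n).
  by rewrite exprS expr2; ring.
lra.
Qed.

Lemma time_unique_continuation u (T C x : R) : cont2 u -> (forall t, periodic (u t) P) ->
  (forall x, der (u ^~ x) (fun t => - dgreen (flux (u t)) x)) -> 0 < T ->
  (forall t, 0 < t < T -> u t x = C) -> forall t, u t x = C.
Proof.
move=> cu pu du T0 huC t.
(* A window containing both the target time and [T / 2]. The bound on u, hence the rate of the
   Taylor coefficients, is available on bounded time intervals only. *)
pose S := `|t| + T.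
have tS : `|t| <= S by rewrite /S; lra.
have [M M0 hM] := cont2_bound S 0 P cu.
have hM' s y : `|s| <= S -> `|u s y| <= M.
  move=> sS; have [z [zP E]] := periodic_reduce 0 y; rewrite (E _ (pu s)).
  by apply: hM => //; rewrite add0r in zP.
(* Subtracting the constant solution affects the coefficient of order 0 only. *)
pose g n s := tcoef u n s x - (if n is 0%N then C else 0).
have dg n : der (g n) (fun s => n.+1%:R * g n.+1 s).
  move=> s; rewrite /g subr0.
  have [_ _ d] := tcoef_evolution cu pu du n.
  apply: dv_eq; first by apply: dvD; [exact: (d x)|apply: dvN; exact: dv_cst].
  rewrite subr0 (tcoefS (V := fun t x => - dgreen (fun y => fluxcoef (fun k => tcoef u k t y) n) x) (d x)).
  by rewrite mulrC divfK// pnatr_eq0.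
have tf : taylor_family g S (M + `|C|) (1 + M).
  split=> // n s sS; have := tcoef_bound cu pu du M0 hM' n x sS => h.
  have C0 := normr_ge0 C; rewrite /g; case: n h => [|n] h.
    by rewrite expr0 mulr1 in h *; apply: le_trans (ler_normB _ _) _; lra.
  rewrite subr0; apply: (le_trans h); rewrite ler_wpM2r ?exprn_ge0//; lra.
have z : forall n, g n (T / 2) = 0.
  move=> n; apply: (taylor_zero_on (a := 0) (b := T) dg) => [s sT|]; last lra.
  by rewrite /g tcoef0 huC ?subrr.
have T2 : `|T / 2| <= S by rewrite ger0_norm /S; have := normr_ge0 t; lra.
have MC : 0 < M + `|C| by have := normr_ge0 C; lra.
have r0 : 0 < 1 + M by lra.
by have := taylor_vanish tf MC r0 T2 z tS; rewrite /g tcoef0; lra.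
Qed.

End TimeAnalyticity.

(** * The H^1 energy *)

Section Averages.
Context {R : realType}.
Notation P := (pi *+ 2 : R).
Implicit Types f g : R -> R.

(** The Steklov average. Its x-derivative is the difference quotient [dq], so it is C^1 for
    continuous [f]. *)
Definition avg (h : R) f (x : R) : R := J f x (x + h) / h.
Definition dq (h : R) f (x : R) : R := (f (x + h) - f x) / h.

Lemma der_avg h f : continuous f -> der (avg h f) (dq h f).
Proof.
move=> cf x; have dp := der_prim cf; rewrite /avg /J; apply: dv_eq.
  apply: dvM; last exact: dv_cst.
  by apply: dvD; [apply: dv_shift; exact: dp|apply: dvN; exact: dp].
by rewrite mulr0 addr0.
Qed.

Lemma der_dq h f f' : der f f' -> der (dq h f) (dq h f').
Proof.
move=> df x; rewrite /dq; apply: dv_eq.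
  apply: dvM; last exact: dv_cst.
  by apply: dvD; [apply: dv_shift; exact: df|apply: dvN; exact: df].
by rewrite mulr0 addr0.
Qed.

Lemma ct_dq h f : continuous f -> continuous (dq h f).
Proof.
move=> cf; rewrite /dq; apply: ctM; last exact: ct_cst.
by apply: ctD; [ct|ct].
Qed.

Lemma ct_avg h f : continuous f -> continuous (avg h f).
Proof. by move=> cf; exact: dv_cont (der_avg h cf). Qed.

Lemma cont2_dq h (f : R -> R -> R) : cont2 f -> cont2 (fun t => dq h (f t)).
Proof.
move=> cf; rewrite /cont2 /dq; apply: ctM; last exact: ct_cst.
by apply: ctD; [ct|ct].
Qed.

Lemma cont2_avg h (f : R -> R -> R) : cont2 f -> cont2 (fun t => avg h (f t)).
Proof.
move=> cf; rewrite /cont2 /avg; apply: ctM; last exact: ct_cst.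
by apply: (ct_J cf); ct.
Qed.

Lemma periodic_dq h f T : periodic f T -> periodic (dq h f) T.
Proof. by move=> pf x; rewrite /dq pf addrAC pf. Qed.

Lemma periodic_avg h f T : continuous f -> periodic f T -> periodic (avg h f) T.
Proof.
move=> cf pf x; rewrite /avg addrAC -(J_shift T _ _ cf).
by congr (J _ _ _ / _); apply/funext => y; rewrite pf.
Qed.

Lemma avg_near h f x c d : 0 < h -> continuous f ->
  (forall y, x <= y <= x + h -> `|f y - c| <= d) -> `|avg h f x - c| <= d.
Proof.
move=> h0 cf hd.
have -> : avg h f x - c = J (fun y => f y - c) x (x + h) / h.
  rewrite JB; [|by []|by ct]; rewrite J_cst /avg; field; rewrite gt_eqF//.
rewrite normrM normfV (gtr0_norm h0) ler_pdivrMr//.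
have xh : x <= x + h by lra.
have cfc : continuous (fun y => f y - c) by ct.
apply: le_trans (J_norm_le cfc xh hd) _; rewrite (_ : x + h - x = h)//; ring.
Qed.

Lemma J_parts_periodic f f' g g' T : der f f' -> der g g' -> continuous f' -> continuous g' ->
  periodic f T -> periodic g T -> J (fun x => f x * g' x) 0 T = - J (fun x => f' x * g x) 0 T.
Proof.
move=> df dg cf' cg' pf pg; rewrite (J_parts 0 T df dg cf' cg').
by rewrite -[X in f X]add0r -[X in g X]add0r pf pg; ring.
Qed.

Lemma dq_energy_bound f (S : R -> R) (h : R) : continuous f -> continuous S -> periodic f P ->
  (forall x y, x <= y -> S x <= S y) -> S 0 = 0 ->
  (forall x y, 0 <= x <= y -> y <= P -> (f y - f x) ^+ 2 <= (y - x) * (S y - S x)) ->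
  0 < h < P -> J (fun x => dq h f x ^+ 2) 0 P <= 5 * S P.
Proof.
move=> cf cS pf mS S0 hS hP.
have P0 := @period_gt0 R.
have h0 : 0 < h by lra.
have cd : continuous (fun x => dq h f x ^+ 2) by apply: ctX; exact: ct_dq.
have sq x : dq h f x ^+ 2 = (f (x + h) - f x) ^+ 2 / h ^+ 2.
  by rewrite /dq expr_div_n.
have SP0 : 0 <= S P by rewrite -S0 mS// ltW.
(* Increments of [S] telescope after integration: only the two end strips of width [h] remain. *)
have b1 : J (fun x => dq h f x ^+ 2) 0 (P - h) <= S P.
  have cS' : continuous (fun x => h^-1 * (S (x + h) - S x)) by ct.
  have Ph : 0 <= P - h by lra.
  apply: (le_trans (le_J cd cS' Ph _)) => [x xP|].
    have x1 : 0 <= x <= x + h by lra.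
    have x2 : x + h <= P by lra.
    have := hS x (x + h) x1 x2; rewrite (_ : x + h - x = h); last ring.
    rewrite sq ler_pdivrMr ?exprn_gt0// => k; apply: (le_trans k).
    by rewrite expr2 (_ : h^-1 * _ * _ = h * (S (x + h) - S x))//; field; rewrite gt_eqF.
  rewrite JZ; last by ct.
  rewrite JB; [|by ct|by []].
  rewrite (J_shift h 0 (P - h) cS) subrK add0r.
  have -> : J S h P - J S 0 (P - h) = J S (P - h) P - J S 0 h by rewrite /J; ring.
  have k1 : J S (P - h) P <= J (fun=> S P) (P - h) P.
    by apply: le_J => //; [exact: ct_cst|lra|move=> x ?; apply: mS; lra].
  have k2 : 0 <= J S 0 h by apply: J_ge0 => //; [lra|move=> x ?; rewrite -S0; apply: mS; lra].
  rewrite J_cst in k1; rewrite mulrC ler_pdivrMr//; lra.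
(* Here [x + h] leaves the period. The increment is split at the point [P], identified with 0, into
   two parts whose squares are at most [h * S P]; this gives 4, and 5 in total. *)
have b2 : J (fun x => dq h f x ^+ 2) (P - h) P <= 4 * S P.
  have cc : continuous (fun _ : R => 4 * S P / h) by exact: ct_cst.
  have Ph : P - h <= P by lra.
  apply: (le_trans (le_J cd cc Ph _)) => [x xP|]; last first.
    by rewrite J_cst (_ : P - (P - h) = h) ?divfK ?gt_eqF//; ring.
  have e : f (x + h) - f x = (f (x + h - P) - f 0) + (f P - f x).
    have e1 : f (x + h) = f (x + h - P) by rewrite -[in LHS](subrK P (x + h)) pf.
    have e2 : f P = f 0 by rewrite -[X in f X = _]add0r pf.
    by rewrite e1 e2; ring.
  have y1 : (0 : R) <= 0 <= x + h - P by apply/andP; split=> //; lra.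
  have y2 : x + h - P <= P by lra.
  have z1 : 0 <= x <= P by apply/andP; split; lra.
  have k1 := hS 0 (x + h - P) y1 y2; have k2 := hS x P z1 (lexx P).
  have m1 : (x + h - P - 0) * (S (x + h - P) - S 0) <= h * S P.
    apply: ler_pM; [lra|by rewrite subr_ge0 mS//; lra|lra|rewrite S0 subr0; apply: mS; lra].
  have m2 : (P - x) * (S P - S x) <= h * S P.
    apply: ler_pM; [lra|by rewrite subr_ge0 mS//; lra|lra|].
    have : 0 <= S x by rewrite -S0 mS//; lra.
    lra.
  rewrite sq e; set A := f (x + h - P) - f 0 in k1 *; set B := f P - f x in k2 *.
  have AB : (A + B) ^+ 2 <= 2 * A ^+ 2 + 2 * B ^+ 2 by have := sqr_ge0 (A - B); rewrite !expr2; lra.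
  rewrite ler_pdivrMr ?exprn_gt0// expr2 mulrA divfK ?gt_eqF//.
  lra.
by rewrite (J_cat _ (P - h)); lra.
Qed.

End Averages.

(** * The averaged energy and its defect *)

Section Energy.
Context {R : realType}.
Notation P := (pi *+ 2 : R).
Context (kap : R) (v w wx : R -> R -> R).
Notation phi y := (kap * y + y ^+ 2 / 2).
Context (cv : cont2 v) (cw : cont2 w) (cwx : cont2 wx)
  (pv : forall t, periodic (v t) P)
  (pwx : forall t, periodic (wx t) P)
  (dw : forall t, der (w t) (wx t)) (dwx : forall t, der (wx t) (fun x => w t x - phi (v t x)))
  (dtv : forall x, der (v ^~ x) (fun t => - wx t x)).

(* [v t] is only in H^1, so the H^1 energy is computed on averages over [x, x + h]; it is
   conserved up to the defect [avg h (phi v) - phi (avg h v)], which vanishes with [h]. *)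
Definition energy h t := J (fun x => avg h (v t) x ^+ 2 + dq h (v t) x ^+ 2) 0 P.

Lemma der_energy h : h != 0 ->
  der (energy h) (fun t => 2 * J (fun x => dq h (v t) x * (avg h (fun y => phi (v t y)) x - phi (avg h (v t) x))) 0 P).
Proof.
move=> h0; have P0 := @period_gt0 R.
pose a t x := avg h (v t) x; pose d t x := dq h (v t) x.
pose b t x := dq h (w t) x; pose c t x := dq h (wx t) x.
pose f t x := phi (v t x).
have ca : cont2 a by exact: cont2_avg.
have cd : cont2 d by exact: cont2_dq.
have cb : cont2 b by exact: cont2_dq.
have cc : cont2 c by exact: cont2_dq.
have cf : cont2 f by rewrite /cont2 /f; ct.
have da x : der (a ^~ x) (fun t => - b t x).
  have cwN : cont2 (fun t y => - wx t y) by rewrite /cont2; ct.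
  move=> t; have g : dv t (fun t => J (v t) x (x + h)) (- (w t (x + h) - w t x)).
    have [hp|hn] := leP 0 h.
      have xh : x <= x + h by lra.
      have k := der_J_param cv cwN dtv xh.
      apply: dv_eq (k t) _; rewrite JN; last exact: (cont2_slice t cwx).
      by rewrite (J_FTC _ _ (cont2_slice t cwx) (dw t)).
    have xh : x + h <= x by lra.
    have k := der_J_param cv cwN dtv xh.
    have -> : (fun t => J (v t) x (x + h)) = (fun t => - J (v t) (x + h) x).
      by apply/funext => s; rewrite /J; ring.
    apply: dv_eq (dvN (k t)) _; rewrite JN; last exact: (cont2_slice t cwx).
    by rewrite (J_FTC _ _ (cont2_slice t cwx) (dw t)); ring.
  rewrite /a /avg; apply: dv_eq; first by apply: dvM; [exact: g|exact: dv_cst].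
  by rewrite mulr0 addr0 /b /dq mulNr.
have dd x : der (d ^~ x) (fun t => - c t x).
  move=> t; rewrite /d /dq; apply: dv_eq.
    apply: dvM; last exact: dv_cst.
    by apply: dvD; [exact: dtv|apply: dvN; exact: dtv].
  by rewrite mulr0 addr0 /c /dq -mulNr; congr (_ / _); ring.
have cE : cont2 (fun t x => a t x ^+ 2 + d t x ^+ 2) by rewrite /cont2; ct.
have cE' : cont2 (fun t x => -2 * (a t x * b t x) + -2 * (d t x * c t x)) by rewrite /cont2; ct.
have dE x : der (fun t => a t x ^+ 2 + d t x ^+ 2) (fun t => -2 * (a t x * b t x) + -2 * (d t x * c t x)).
  move=> t; apply: dv_eq; first by apply: dvD; apply: dvX; [exact: da|exact: dd].
  by rewrite /= !expr1; ring.
have k := der_J_param cE cE' dE (ltW P0).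
move=> t; apply: dv_eq (k t) _.
have [sa sb] := (cont2_slice t ca, cont2_slice t cb).
have [sc sd] := (cont2_slice t cc, cont2_slice t cd).
have sf := cont2_slice t cf; have sv := cont2_slice t cv; have sw := cont2_slice t cw.
have dxa : der (a t) (d t) by exact: der_avg.
have saf : continuous (avg h (f t)) by exact: ct_avg.
have sdf : continuous (dq h (f t)) by exact: ct_dq.
have dxf : der (avg h (f t)) (dq h (f t)) by exact: der_avg.
have pa : periodic (a t) P by exact: periodic_avg.
have pf : periodic (f t) P by move=> x; rewrite /f pv.
have paf : periodic (avg h (f t)) P by exact: periodic_avg.
have pc : periodic (c t) P by exact: periodic_dq.
have dxc : der (c t) (fun x => b t x - dq h (f t) x).
  move=> x; apply: dv_eq (der_dq h (dwx t) x) _.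
  by rewrite /b /dq /f; ring.
have sbf : continuous (fun x => b t x - dq h (f t) x) by ct.
have e1 := J_parts_periodic dxa dxc sd sbf pa pc.
have e2 := J_parts_periodic dxa dxf sd sdf pa paf.
have e3 : J (fun x => a t x * (b t x - dq h (f t) x)) 0 P =
  J (fun x => a t x * b t x) 0 P - J (fun x => a t x * dq h (f t) x) 0 P.
  by rewrite -JB; [congr J; apply/funext => x; rewrite mulrBr|ct|ct].
(* The product of [phi (a)] with the derivative [d] of [a] is the x-derivative of a periodic
   function, so subtracting it is free. It leaves only the defect between averaging the flux and
   taking the flux of the average. *)
have e4 : J (fun x => d t x * phi (a t x)) 0 P = 0.
  have dG : der (fun x => kap / 2 * a t x ^+ 2 + 6^-1 * a t x ^+ 3) (fun x => d t x * phi (a t x)).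
    move=> x; apply: dv_eq; first by apply: dvD; (apply: dvM; [exact: dv_cst|apply: dvX; exact: dxa]).
    by rewrite /= !expr1; field.
  have cG : continuous (fun x => d t x * phi (a t x)) by ct.
  by rewrite (J_FTC _ _ cG dG) -{1 2}[P]add0r !pa subrr.
have e5 : J (fun x => d t x * (avg h (f t) x - phi (a t x))) 0 P =
  J (fun x => d t x * avg h (f t) x) 0 P - J (fun x => d t x * phi (a t x)) 0 P.
  by rewrite -JB; [congr J; apply/funext => x; rewrite mulrBr|ct|ct].
rewrite -/(f t) -/(a t) -/(d t).
rewrite JD; [|by ct|by ct]; rewrite !JZ; [|by ct|by ct].
transitivity (2 * (J (fun x => d t x * avg h (f t) x) 0 P - J (fun x => d t x * phi (a t x)) 0 P)); last by rewrite -e5.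
rewrite e4; move: e1 e2 e3; set X1 := J _ 0 P; set X2 := J _ 0 P; set X3 := J _ 0 P; set X4 := J _ 0 P.
lra.
Qed.

End Energy.

(** * A Holder bound uniform in time *)

Section Gronwall.
Context {R : realType}.
Notation P := (pi *+ 2 : R).
Context (kap : R) (v w wx : R -> R -> R).
Notation phi y := (kap * y + y ^+ 2 / 2).
Context (cv : cont2 v) (cw : cont2 w) (cwx : cont2 wx)
  (pv : forall t, periodic (v t) P)
  (pwx : forall t, periodic (wx t) P)
  (dw : forall t, der (w t) (wx t)) (dwx : forall t, der (wx t) (fun x => w t x - phi (v t x)))
  (dtv : forall x, der (v ^~ x) (fun t => - wx t x)).

Lemma phi_lip (B y z : R) : `|y| <= B -> `|z| <= B -> `|phi y - phi z| <= (`|kap| + B) * `|y - z|.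
Proof.
move=> hy hz; have -> : phi y - phi z = (kap + (y + z) / 2) * (y - z) by field.
rewrite normrM ler_wpM2r//; apply: le_trans (ler_normD _ _) _; rewrite lerD2l.
by move: hy hz; rewrite !ler_norml; lra.
Qed.

(** Both terms are within [eta / 2] of [phi (v t y)], at the representative [y] of [x]: v is
    uniformly continuous for [|t| <= S], and [phi] is Lipschitz on its range. *)
Lemma averaging_defect (S eta : R) : 0 < eta ->
  exists2 h0 : R, 0 < h0 & forall h : R, 0 < h < h0 -> forall t x, `|t| <= S ->
    `|avg h (fun y => phi (v t y)) x - phi (avg h (v t) x)| <= eta.
Proof.
move=> eta0; have P0 := @period_gt0 R.
have [B B0 hB] := cont2_bound S 0 P cv.
have bv t x : `|t| <= S -> `|v t x| <= B.
  move=> tS; have [z [zP E]] := periodic_reduce 0 x; rewrite (E _ (pv t)).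
  by apply: hB => //; rewrite add0r in zP.
pose L := `|kap| + B; have L0 : 0 < L by rewrite ltr_wpDl.
have d0 : 0 < eta / (2 * L) by rewrite divr_gt0// mulr_gt0.
have [h0 h00 hh] := cont2_equi S 0 P cv d0.
exists h0 => // h hlt t x tS.
have cvt := cont2_slice t cv.
have cft : continuous (fun y => phi (v t y)) by ct.
have pdef : periodic (fun x => avg h (fun y => phi (v t y)) x - phi (avg h (v t) x)) P.
  have p1 : periodic (avg h (v t)) P by exact: periodic_avg.
  have p2 : periodic (avg h (fun y => phi (v t y))) P.
    by apply: periodic_avg => // y; rewrite pv.
  by move=> y; rewrite p1 p2.
have [y [yP E]] := periodic_reduce 0 x; rewrite add0r in yP.
rewrite (E _ pdef).
have near z : y <= z <= y + h -> `|v t z - v t y| <= eta / (2 * L).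
  move=> zy; have -> : z = y + (z - y) by ring.
  by apply/ltW/hh => //; rewrite ger0_norm; lra.
have hp : 0 < h by lra.
have a1 : `|avg h (v t) y - v t y| <= eta / (2 * L) by exact: avg_near.
have a2 : `|avg h (v t) y| <= B.
  rewrite -[avg h (v t) y]subr0; apply: avg_near => // z _.
  by rewrite subr0 bv.
have half : L * (eta / (2 * L)) = eta / 2 by field; rewrite gt_eqF.
have a3 : `|avg h (fun y => phi (v t y)) y - phi (v t y)| <= eta / 2.
  apply: avg_near => // z zy; apply: le_trans (phi_lip (bv t z tS) (bv t y tS)) _.
  by rewrite -half; apply: ler_wpM2l; [exact: ltW|exact: near].
have a4 : `|phi (avg h (v t) y) - phi (v t y)| <= eta / 2.
  apply: le_trans (phi_lip a2 (bv t y tS)) _.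
  by rewrite -half; apply: ler_wpM2l; [exact: ltW|exact: a1].
move: a3 a4; set X := avg h _ y; set Y := kap * v t y + _; set Z := kap * avg h (v t) y + _.
by rewrite !ler_norml; lra.
Qed.

(** The defect is made smaller than [eta = (|t| + 1)^-1], so that the growth accumulated up to time
    [t] is at most [expR 1] for every [t]; only [h0] depends on [t]. The summand [P] comes from
    [2 * |D| * eta <= eta * (D^2 + 1)] integrated over a period. *)
Lemma energy_gronwall t : exists2 h0 : R, 0 < h0 & forall h : R, 0 < h < h0 ->
  energy v h t + P <= (energy v h 0 + P) * expR 1.
Proof.
have P0 := @period_gt0 R.
pose eta := (`|t| + 1)^-1.
have t1 : 0 < `|t| + 1 by have := normr_ge0 t; lra.
have eta0 : 0 < eta by rewrite invr_gt0.
have [h0 h00 hd] := averaging_defect `|t| eta0.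
exists h0 => // h hlt.
have hn : h != 0 by rewrite gt_eqF//; lra.
have dE := der_energy cv cw cwx pv pwx dw dwx dtv hn.
have E0 s : 0 <= energy v h s.
  have c1 := cont2_slice s (@cont2_dq _ h _ cv); have c2 := cont2_slice s (@cont2_avg _ h _ cv).
  apply: J_ge0; [by ct|exact: ltW|by move=> x _; rewrite addr_ge0 ?sqr_ge0].
have rate s : `|s| <= `|t| -> `|2 * J (fun x => dq h (v s) x *
    (avg h (fun y => phi (v s y)) x - phi (avg h (v s) x))) 0 P| <= eta * (energy v h s + P).
  move=> st.
  have c1 := cont2_slice s (@cont2_dq _ h _ cv); have c2 := cont2_slice s (@cont2_avg _ h _ cv).
  have cf : continuous (fun y => phi (v s y)) by have := cont2_slice s cv => c; ct.
  have c3 := @ct_avg _ h _ cf.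
  have e : eta * (energy v h s + P) = J (fun x => eta * (avg h (v s) x ^+ 2 + dq h (v s) x ^+ 2) + eta * 1) 0 P.
    by rewrite JD; [rewrite !JZ; [rewrite J_cst /energy; ring|ct|ct]|ct|ct].
  have cF : continuous (fun x => 2 * (dq h (v s) x * (avg h (fun y => phi (v s y)) x - phi (avg h (v s) x)))) by ct.
  have cG : continuous (fun x => eta * (avg h (v s) x ^+ 2 + dq h (v s) x ^+ 2) + eta * 1) by ct.
  have key x : `|2 * (dq h (v s) x * (avg h (fun y => phi (v s y)) x - phi (avg h (v s) x)))| <=
      eta * (avg h (v s) x ^+ 2 + dq h (v s) x ^+ 2) + eta * 1.
    have k := hd h hlt s x st.
    rewrite normrM (ger0_norm (ler0n R 2)) normrM; move: k; set X := `|_ - _|; set D := dq h (v s) x; set A := avg h (v s) x => k.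
    apply: (@le_trans _ _ (2 * (`|D| * eta))); first by rewrite ler_pM2l// ler_wpM2l.
    have k1 : 0 <= eta * (`|D| - 1) ^+ 2 by rewrite mulr_ge0 ?sqr_ge0// ltW.
    have k2 : 0 <= eta * A ^+ 2 by rewrite mulr_ge0 ?sqr_ge0// ltW.
    have k3 : eta * (`|D| - 1) ^+ 2 = eta * D ^+ 2 - 2 * (`|D| * eta) + eta.
      by rewrite -(real_normK (num_real D)); ring.
    lra.
  rewrite -JZ; last by ct.
  have cGN : continuous (fun x => - (eta * (avg h (v s) x ^+ 2 + dq h (v s) x ^+ 2) + eta * 1)) by ct.
  rewrite e ler_norml -(JN _ _ cG); apply/andP; split; apply: le_J => //; try exact: ltW.
    by move=> x _; have := key x; rewrite ler_norml => /andP[].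
  by move=> x _; have := key x; rewrite ler_norml => /andP[].
(* The direction of time, so that [r] runs from 0 to [|t|] whatever the sign of [t]. *)
pose s : R := if 0 <= t then 1 else -1.
have ts : t = s * `|t|.
  rewrite /s; case: (leP 0 t) => h1; first by rewrite mul1r ger0_norm.
  by rewrite mulN1r ltr0_norm// opprK.
have s1 : `|s| = 1 by rewrite /s; case: ifP => _; rewrite ?normrN normr1.
pose G r := - ((energy v h (s * r) + P) * expR (- eta * r)).
pose E' r := 2 * J (fun x => dq h (v r) x * (avg h (fun y => phi (v r y)) x - phi (avg h (v r) x))) 0 P.
have dG : der G (fun r => (eta * (energy v h (s * r) + P) - s * E' (s * r)) * expR (- eta * r)).
  move=> r; have d1 : dv r (fun r => energy v h (s * r)) (E' (s * r) * s).
    apply: (dv_comp (F := fun r => s * r)); last exact: dE.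
    by apply: dv_eq; [apply: dvM; [exact: dv_cst|exact: dv_id]|rewrite mul0r add0r mulr1].
  apply: dv_eq.
    apply: dvN; apply: dvM; first by apply: dvD; [exact: d1|exact: dv_cst].
    by apply: dv_exp; apply: dvM; [exact: dv_cst|exact: dv_id].
  by rewrite /=; ring.
have t0 : 0 <= `|t| by [].
have := der_nondecr t0 dG _.
rewrite /G mulr0 -ts mulr0 expR0 mulr1 lerN2 => k.
have {k} k : (energy v h t + P) * expR (- eta * `|t|) <= energy v h 0 + P.
  apply: k => r /andP[r0 rt]; apply: mulr_ge0 (expR_ge0 _).
  have sr : `|s * r| <= `|t| by rewrite normrM s1 mul1r ger0_norm.
  rewrite subr_ge0; apply: le_trans (rate _ sr).
  by apply: le_trans (ler_norm _) _; rewrite normrM s1 mul1r.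
rewrite mulNr expRN ler_pdivrMr ?expR_gt0// in k; apply: (le_trans k).
apply: ler_wpM2l; first by have := E0 0; lra.
by rewrite ler_expR /eta mulrC ler_pdivrMr// mul1r; lra.
Qed.

(** Cauchy-Schwarz for the average, whose derivative is [dq], passes to v as [h] tends to 0 at fixed
    [t]. The admissible [h] depends on [t] while [K] does not. *)
Lemma holder_uniform K0 : (forall h, 0 < h < P -> energy v h 0 <= K0) ->
  exists2 K : R, 0 < K & forall t x y, x <= y <= x + P -> (v t y - v t x) ^+ 2 <= (y - x) * K.
Proof.
move=> hK; have P0 := @period_gt0 R.
pose K := (`|K0| + P) * expR 1.
have K0' : 0 < K by rewrite mulr_gt0 ?expR_gt0// ltr_wpDl.
exists K => // t x y xy.
apply: sqr_le_amgm; [lra|exact: ltW|move=> l l0].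
apply/ler_addgt0Pr => e e0.
have [h0 h00 hg] := energy_gronwall t.
have cvt := cont2_slice t cv.
have e4 : 0 < e / 4 by lra.
have [d1 d10 hd1] := ct_eps x cvt e4.
have [d2 d20 hd2] := ct_eps y cvt e4.
have [a [a0 ah aP]] := ex_lt2 h00 P0.
have [b [b0 bd1 bd2]] := ex_lt2 d10 d20.
have [h [hp ha hb]] := ex_lt2 a0 b0.
have hlt : 0 < h < h0 by lra.
have hltP : 0 < h < P by lra.
have E := hg h hlt.
have cD : continuous (dq h (v t)) by exact: ct_dq.
have cA : continuous (avg h (v t)) by exact: ct_avg.
have cD2 : continuous (fun x => dq h (v t) x ^+ 2) by ct.
have eK : J (fun x => dq h (v t) x ^+ 2) 0 P <= K.
  have le1 : J (fun x => dq h (v t) x ^+ 2) 0 P <= energy v h t.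
    apply: le_J => //; [by ct|exact: ltW|move=> z _].
    by rewrite lerDr sqr_ge0.
  have le2 : (energy v h 0 + P) * expR 1 <= K.
    apply: ler_wpM2r; first exact: expR_ge0.
    by rewrite lerD2r; apply: le_trans (hK h hltP) (ler_norm _).
  lra.
have pD2 : periodic (fun x => dq h (v t) x ^+ 2) P.
  by move=> z; rewrite (periodic_dq h (pv t)).
have eK' : J (fun x => dq h (v t) x ^+ 2) x y <= K.
  apply: le_trans eK; rewrite -[X in _ <= J _ _ X]add0r (J_periodic 0 x cD2 pD2) [leRHS](J_cat _ y).
  rewrite lerDl; apply: J_ge0 => //; [lra|move=> z _; exact: sqr_ge0].
have key : 2 * `|avg h (v t) y - avg h (v t) x| <= l * K + (y - x) / l.
  rewrite -(J_FTC x y cD (der_avg h cvt)).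
  have c1 : continuous (fun z => l / 2 * dq h (v t) z ^+ 2 + (2 * l)^-1) by ct.
  have xy' : x <= y by lra.
  have pt z : `|dq h (v t) z| <= l / 2 * dq h (v t) z ^+ 2 + (2 * l)^-1.
    rewrite -subr_ge0 (_ : _ - _ = l / 2 * (`|dq h (v t) z| - l^-1) ^+ 2).
      by rewrite mulr_ge0 ?sqr_ge0// divr_ge0// ltW.
    by rewrite -(real_normK (num_real (dq h (v t) z))); field; rewrite gt_eqF.
  have : `|J (dq h (v t)) x y| <= J (fun z => l / 2 * dq h (v t) z ^+ 2 + (2 * l)^-1) x y.
    rewrite ler_norml -JN//; apply/andP; split; apply: le_J => //; try by ct.
      by move=> z _; have := pt z; rewrite ler_norml => /andP[].
    by move=> z _; have := pt z; rewrite ler_norml => /andP[].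
  rewrite JD; [|by ct|by ct]; rewrite JZ// J_cst => k.
  have lk := ler_wpM2l (ltW l0) eK'.
  have -> : (y - x) / l = 2 * ((2 * l)^-1 * (y - x)) by field; rewrite gt_eqF.
  lra.
have nx : `|avg h (v t) x - v t x| <= e / 4.
  by apply: avg_near => // z zx; apply/ltW/hd1; rewrite ger0_norm; lra.
have ny : `|avg h (v t) y - v t y| <= e / 4.
  by apply: avg_near => // z zx; apply/ltW/hd2; rewrite ger0_norm; lra.
have : `|v t y - v t x| <= `|avg h (v t) y - avg h (v t) x| + e / 2.
  rewrite (_ : v t y - v t x = (avg h (v t) y - avg h (v t) x) + ((avg h (v t) x - v t x) - (avg h (v t) y - v t y))); last ring.
  apply: le_trans (ler_normD _ _) _; rewrite lerD2l.
  by apply: le_trans (ler_normB _ _) _; lra.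
lra.
Qed.

End Gronwall.

(** * Solutions vanishing at a point with their potential *)

Section Rigidity.
Context {R : realType}.
Notation P := (pi *+ 2 : R).
Context (kap : R) (v w wx : R -> R -> R) (x0 K : R).
Notation phi y := (kap * y + y ^+ 2 / 2).
Notation pot y := (kap / 2 * y ^+ 2 + 6^-1 * y ^+ 3).
Context (cv : cont2 v) (cw : cont2 w) (cwx : cont2 wx)
  (pv : forall t, periodic (v t) P) (pw : forall t, periodic (w t) P)
  (pwx : forall t, periodic (wx t) P)
  (dw : forall t, der (w t) (wx t)) (dwx : forall t, der (wx t) (fun x => w t x - phi (v t x)))
  (dtv : forall x, der (v ^~ x) (fun t => - wx t x))
  (v0 : forall t, v t x0 = 0) (w0 : forall t, w t x0 = 0) (wx0 : forall t, wx t x0 = 0)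
  (K0 : 0 < K) (hK : forall t x y, x <= y <= x + P -> (v t y - v t x) ^+ 2 <= (y - x) * K).

Definition lyap t := J (fun x => expR (2 * x) * pot (v t x)) x0 (x0 + P).
Definition diss t := J (fun x => expR (2 * x) * (wx t x + w t x) ^+ 2) x0 (x0 + P).

Lemma on_period (f : R -> R) (M : R) : periodic f P -> (forall x, x0 <= x <= x0 + P -> `|f x| <= M) ->
  forall x, `|f x| <= M.
Proof. by move=> pf h x; have [y [yP ->//]] := periodic_reduce x0 x; exact: h. Qed.

Lemma diss_ge0 t : 0 <= diss t.
Proof.
have P0 := @period_gt0 R; have c1 := cont2_slice t cw; have c2 := cont2_slice t cwx.
by apply: J_ge0; [ct|lra|move=> x _; rewrite mulr_ge0 ?expR_ge0 ?sqr_ge0].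
Qed.

(* [exp(2x) pot(v)_t = d/dx (exp(2x) (wx^2 + w^2) / 2) - exp(2x) (wx + w)^2], and the
   boundary terms vanish since [w = wx = 0] at [x0]. *)
Lemma der_lyap : der lyap (fun t => - diss t).
Proof.
have P0 := @period_gt0 R.
have cE : cont2 (fun t x => expR (2 * x) * pot (v t x)) by rewrite /cont2; ct.
have cE' : cont2 (fun t x => - (expR (2 * x) * (phi (v t x) * wx t x))) by rewrite /cont2; ct.
have dE x : der (fun t => expR (2 * x) * pot (v t x)) (fun t => - (expR (2 * x) * (phi (v t x) * wx t x))).
  move=> t; have d := dtv x t; apply: dv_eq.
    apply: dvM; first exact: dv_cst.
    by apply: dvD; (apply: dvM; [exact: dv_cst|apply: dvX; exact: d]).
  by rewrite /= !expr1; field.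
have xP : x0 <= x0 + P by lra.
move=> t; apply: dv_eq (der_J_param cE cE' dE xP t) _.
have c1 := cont2_slice t cw; have c2 := cont2_slice t cwx; have c3 := cont2_slice t cv.
have dG : der (fun x => expR (2 * x) * (wx t x ^+ 2 + w t x ^+ 2) / 2)
    (fun x => expR (2 * x) * (wx t x + w t x) ^+ 2 + - (expR (2 * x) * (phi (v t x) * wx t x))).
  move=> x; have d1 := dw t x; have d2 := dwx t x; apply: dv_eq.
    apply: dvM; last exact: dv_cst.
    apply: dvM; first by apply: dv_exp; apply: dvM; [exact: dv_cst|exact: dv_id].
    by apply: dvD; apply: dvX; [exact: d2|exact: d1].
  by rewrite /= !expr1; field.
have ca : continuous (fun x : R => expR (2 * x) * (wx t x + w t x) ^+ 2) by ct.
have cb : continuous (fun x : R => - (expR (2 * x) * (phi (v t x) * wx t x))) by ct.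
have cab : continuous (fun x : R => expR (2 * x) * (wx t x + w t x) ^+ 2 + - (expR (2 * x) * (phi (v t x) * wx t x))) by ct.
have := J_FTC x0 (x0 + P) cab dG.
rewrite JD// pw pwx w0 wx0 expr0n /= addr0 !mulr0 !mul0r subrr /diss; lra.
Qed.

(** Cauchy-Schwarz for [exp(x) w], which starts from 0 at [x0] and has derivative [exp(x) (wx + w)];
    the square of the latter is the integrand of [diss]. *)
Lemma wave_small t x : x0 <= x <= x0 + P -> w t x ^+ 2 <= expR (- (2 * x0)) * (P * diss t).
Proof.
move=> xP; have P0 := @period_gt0 R.
have c1 := cont2_slice t cw; have c2 := cont2_slice t cwx.
have ca : continuous (fun x : R => expR (2 * x) * (wx t x + w t x) ^+ 2) by ct.
have h : (expR x * w t x) ^+ 2 <= P * diss t.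
  apply: sqr_le_amgm; [exact: ltW|exact: diss_ge0|move=> l l0].
  have dG : der (fun x => expR x * w t x) (fun x => expR x * (wx t x + w t x)).
    move=> y; have d1 := dw t y; apply: dv_eq.
      by apply: dvM; [apply: (dv_exp (F := id)); exact: dv_id|exact: d1].
    by rewrite mulr1; ring.
  have cG : continuous (fun x : R => expR x * (wx t x + w t x)) by ct.
  have e : expR x * w t x = J (fun x => expR x * (wx t x + w t x)) x0 x.
    by rewrite (J_FTC _ _ cG dG) w0 mulr0 subr0.
  have cH : continuous (fun y : R => l / 2 * (expR (2 * y) * (wx t y + w t y) ^+ 2) + (2 * l)^-1) by ct.
  have pt y : `|expR y * (wx t y + w t y)| <= l / 2 * (expR (2 * y) * (wx t y + w t y) ^+ 2) + (2 * l)^-1.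
    have -> : expR (2 * y) * (wx t y + w t y) ^+ 2 = (expR y * (wx t y + w t y)) ^+ 2.
      by rewrite exprMn -expRM_natl.
    set X := expR y * _; rewrite -subr_ge0 (_ : _ - _ = l / 2 * (`|X| - l^-1) ^+ 2).
      by rewrite mulr_ge0 ?sqr_ge0// divr_ge0// ltW.
    by rewrite -(real_normK (num_real X)); field; rewrite gt_eqF.
  have xx : x0 <= x by lra.
  have k1 : `|expR x * w t x| <= J (fun y => l / 2 * (expR (2 * y) * (wx t y + w t y) ^+ 2) + (2 * l)^-1) x0 x.
    have cN : continuous (fun y : R => - (l / 2 * (expR (2 * y) * (wx t y + w t y) ^+ 2) + (2 * l)^-1)) by ct.
    rewrite e ler_norml -(JN _ _ cH); apply/andP; split; apply: le_J => // y _;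
      by have := pt y; rewrite ler_norml => /andP[].
  have k2 : J (fun x => expR (2 * x) * (wx t x + w t x) ^+ 2) x0 x <= diss t.
    rewrite /diss [leRHS](J_cat _ x) lerDl; apply: J_ge0 => //; [lra|move=> y _].
    by rewrite mulr_ge0 ?expR_ge0 ?sqr_ge0.
  rewrite JD in k1; [|by ct|by ct]; rewrite JZ// J_cst in k1.
  have k3 := ler_wpM2l (ltW l0) k2.
  have li : 0 < (2 * l)^-1 by rewrite invr_gt0 mulr_gt0.
  have k4 : (2 * l)^-1 * (x - x0) <= (2 * l)^-1 * P by rewrite ler_wpM2l ?(ltW li)//; lra.
  have -> : P / l = 2 * ((2 * l)^-1 * P) by field; rewrite gt_eqF.
  lra.
have -> : w t x ^+ 2 = expR (- (2 * x)) * (expR x * w t x) ^+ 2.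
  rewrite exprMn -expRM_natl mulrA -expRD addNr expR0 mul1r//.
apply: le_trans (ler_wpM2l (expR_ge0 _) h) _.
rewrite ler_wpM2r ?mulr_ge0 ?(ltW P0) ?diss_ge0// ler_expR; lra.
Qed.

Lemma v_bound t x : `|v t x| <= 1 + P * K.
Proof.
move: x; apply: on_period => // x xP; have P0 := @period_gt0 R.
have PK : 0 < P * K by rewrite mulr_gt0.
have h : v t x ^+ 2 <= P * K.
  have := hK t xP; rewrite v0 subr0 => k; apply: (le_trans k).
  by rewrite ler_wpM2r ?(ltW K0)//; lra.
rewrite -(@ler_pXn2r _ 2) ?nnegrE//; last lra.
by rewrite real_normK ?num_real// !expr2; rewrite expr2 in h; have := mulr_ge0 (ltW PK) (ltW PK); lra.
Qed.

Lemma avgB h (f g : R -> R) x : continuous f -> continuous g ->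
  avg h (fun y => f y - g y) x = avg h f x - avg h g x.
Proof. by move=> cf cg; rewrite /avg JB// mulrBl. Qed.

Lemma avg_der h (F f : R -> R) x : continuous f -> der F f -> avg h f x = dq h F x.
Proof. by move=> cf dF; rewrite /avg (J_FTC _ _ cf dF). Qed.

(* The flux is [phi v = w - w''], so its averages are controlled by the size of [w] alone. *)
Lemma second_average t x d : 0 < d ->
  avg d (avg d (fun y => phi (v t y))) x =
  avg d (avg d (w t)) x - (w t (x + d + d) - 2 * w t (x + d) + w t x) / d ^+ 2.
Proof.
move=> d0; have c1 := cont2_slice t cw; have c2 := cont2_slice t cwx; have c3 := cont2_slice t cv.
have cf : continuous (fun y : R => phi (v t y)) by ct.
have cwf : continuous (fun y : R => w t y - phi (v t y)) by ct.
have e1 : avg d (fun y => phi (v t y)) = fun y => avg d (w t) y - dq d (wx t) y.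
  apply/funext => y; rewrite -(avg_der d y cwf (dwx t)) -avgB//; congr (avg d _ y).
  by apply/funext => z; ring.
have cdq : continuous (dq d (wx t)) by exact: ct_dq.
have ca : continuous (avg d (w t)) by exact: ct_avg.
rewrite e1 avgB// (avg_der d x cdq (der_dq d (dw t))); congr (_ - _).
by rewrite /dq; field; rewrite gt_eqF.
Qed.

(** The width [d] is fixed first, by the Holder bound, so that double averaging moves [phi (v t x)]
    by at most [e / 2] at every time. Then [w] is required to be small relative to [d ^+ 2]. *)
Lemma phi_small (e : R) : 0 < e -> exists2 m : R, 0 < m & forall t, diss t <= m ->
  forall x, `|phi (v t x)| <= e.
Proof.
move=> e0; have P0 := @period_gt0 R.
pose B := 1 + P * K; pose L := `|kap| + B.
have B0 : 0 < B by rewrite addr_gt0// mulr_gt0.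
have L0 : 0 < L by rewrite ltr_wpDl.
pose g := e / (2 * L); have g0 : 0 < g by rewrite divr_gt0// mulr_gt0.
(* Two successive averages reach up to [2 * d], where the Holder bound reads [2 * d * K <= g ^+ 2];
   [d < P / 2] keeps this within one period. *)
have q0 : 0 < g ^+ 2 / (2 * K) by apply: divr_gt0; [exact: exprn_gt0|exact: mulr_gt0].
have P2 : 0 < P / 2 by rewrite divr_gt0.
have [d [d0 dq0 dP]] := ex_lt2 q0 P2.
(* If [|w| <= m], the double average of [w] contributes [m] and the second difference
   [4 * m / d ^+ 2]. *)
pose s := 1 + 4 / d ^+ 2.
have s0 : 0 < s by rewrite ltr_wpDr// divr_ge0// exprn_ge0// ltW.
pose m := e / (2 * s); have m0 : 0 < m by rewrite divr_gt0// mulr_gt0.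
have c0 : 0 < expR (- (2 * x0)) * P by rewrite mulr_gt0 ?expR_gt0.
exists (m ^+ 2 / (expR (- (2 * x0)) * P)); first by rewrite divr_gt0// exprn_gt0.
move=> t; rewrite ler_pdivlMr// => hd.
have wm x : `|w t x| <= m.
  move: x; apply: on_period => // x xP.
  rewrite -(@ler_pXn2r _ 2) ?nnegrE ?(ltW m0)// real_normK ?num_real//.
  by apply: le_trans (wave_small t xP) _; rewrite mulrA mulrC.
move=> x.
have c1 := cont2_slice t cw; have c3 := cont2_slice t cv.
have cf : continuous (fun y : R => phi (v t y)) by ct.
have caf : continuous (avg d (fun y => phi (v t y))) by exact: ct_avg.
have caw : continuous (avg d (w t)) by exact: ct_avg.
have near y : x <= y <= x + d + d -> `|phi (v t y) - phi (v t x)| <= L * g.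
  move=> xy; apply: le_trans (phi_lip _ (v_bound t y) (v_bound t x)) _.
  apply: ler_wpM2l; first exact: ltW.
  rewrite -(@ler_pXn2r _ 2) ?nnegrE ?(ltW g0)// real_normK ?num_real//.
  have xy' : x <= y <= x + P by lra.
  apply: le_trans (hK t xy') _.
  rewrite ltr_pdivlMr ?mulr_gt0// in dq0.
  apply: le_trans (ltW dq0); rewrite mulrA ler_wpM2r ?(ltW K0)//; lra.
have a1 : `|avg d (avg d (fun y => phi (v t y))) x - phi (v t x)| <= L * g.
  apply: (avg_near d0 caf) => y yx; apply: (avg_near d0 cf) => z zy; apply: near; lra.
have a2 : `|avg d (avg d (w t)) x| <= m.
  rewrite -[avg d _ x]subr0; apply: (avg_near d0 caw) => y _.
  by apply: (avg_near d0 c1) => z _; rewrite subr0.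
have a3 : `|(w t (x + d + d) - 2 * w t (x + d) + w t x) / d ^+ 2| <= 4 * m / d ^+ 2.
  rewrite normrM normfV (ger0_norm (_ : 0 <= d ^+ 2)) ?sqr_ge0// ler_wpM2r ?invr_ge0 ?sqr_ge0//.
  by have := wm x; have := wm (x + d); have := wm (x + d + d); rewrite !ler_norml; lra.
have b1 : L * g = e / 2 by rewrite /g; field; rewrite gt_eqF.
have b2 : m + 4 * m / d ^+ 2 = e / 2.
  have ms (a b : R) : 0 < b -> a / (2 * b) * b = a / 2 by move=> b0; field; rewrite gt_eqF.
  rewrite -(ms e s s0) -/m /s; move: (m) => m'; field; rewrite gt_eqF//.
rewrite second_average// in a1; move: a1 a2 a3; rewrite b1.
set X := avg _ _ _; set Y := (_ - _ + _) / _; set Z := kap * _ + _.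
by rewrite !ler_norml; lra.
Qed.

(** The second zero of [phi] is excluded by connectedness: |v| is 0 at [x0], so to exceed [r] it
    must equal [r] somewhere, and there [phi] is bounded away from 0. *)
Lemma phi_small_v (e : R) : 0 < e -> exists2 m : R, 0 < m & forall t,
  (forall x, `|phi (v t x)| <= m) -> forall x, `|v t x| <= e.
Proof.
move=> e0; have P0 := @period_gt0 R.
(* Taking [r < |kap|] stays clear of the zero [- 2 * kap]; for [kap = 0] there is no other zero and
   1 is an arbitrary cap. *)
pose q := if kap == 0 then 1 else `|kap|.
have q0 : 0 < q by rewrite /q; case: eqP => // /eqP k0; rewrite normr_gt0.
have [r [r0 re rq]] := ex_lt2 e0 q0.
have rm (y : R) : `|y| = r -> r * `| `|kap| - r / 2 | <= `|phi y|.
  move=> yr; have -> : phi y = y * (kap + y / 2) by field.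
  rewrite normrM yr ler_wpM2l ?(ltW r0)//.
  have -> : r / 2 = `|- (y / 2)| by rewrite normrN normrM yr ger0_norm.
  by apply: le_trans (ler_dist_dist _ _) _; rewrite opprK.
have m0 : 0 < r * `| `|kap| - r / 2 |.
  rewrite mulr_gt0// normr_gt0; move: rq; rewrite /q; case: eqP => [->|_] h.
    by rewrite normr0 sub0r oppr_eq0 gt_eqF// divr_gt0.
  by rewrite gt_eqF//; lra.
exists (r * `| `|kap| - r / 2 | / 2); first lra.
move=> t ht; apply: on_period => // x xP; apply: le_trans (ltW re).
rewrite leNgt; apply/negP => rx.
have cvt := cont2_slice t cv.
have cn : continuous (fun y : R => `|v t y|) by ct.
have x0x : x0 <= x by lra.
have [c _ hc] : exists2 c, c \in `[x0, x] & `|v t c| = r.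
  apply: (@IVT _ (fun y => `|v t y|)) => //.
    exact: continuous_subspaceT.
  by rewrite v0 normr0; case: (leP 0 `|v t x|); have := normr_ge0 (v t x); lra.
by have := rm _ hc; have := ht c; lra.
Qed.

Lemma lyap_bound : exists2 C : R, 0 < C & forall t (r : R), 0 <= r <= 1 + P * K ->
  (forall x, `|v t x| <= r) -> `|lyap t| <= C * r.
Proof.
have P0 := @period_gt0 R; pose B := 1 + P * K.
have B0 : 0 < B by rewrite addr_gt0// mulr_gt0.
pose D := `|kap| / 2 * B + 6^-1 * B ^+ 2 + 1.
have D0 : 0 < D by rewrite ltr_wpDl// addr_ge0 ?mulr_ge0 ?exprn_ge0 ?(ltW B0).
exists (expR (2 * (x0 + P)) * D * P); first by rewrite !mulr_gt0 ?expR_gt0.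
move=> t r rB hr; have cvt := cont2_slice t cv.
have -> : expR (2 * (x0 + P)) * D * P * r = expR (2 * (x0 + P)) * (D * r) * (x0 + P - x0) by ring.
apply: J_norm_le; [by ct|lra|move=> x xP].
rewrite normrM (gtr0_norm (expR_gt0 _)); apply: ler_pM; [exact: expR_ge0|exact: normr_ge0|by rewrite ler_expR; lra|].
have r0 : 0 <= r by lra.
have rB' : r <= B by rewrite /B; lra.
have y := hr x.
have r2 : `|v t x| ^+ 2 <= r * B by rewrite expr2; apply: ler_pM => //; apply: le_trans rB'.
have r3 : `|v t x| ^+ 3 <= r * B ^+ 2.
  rewrite exprS; apply: ler_pM; [by []|exact: exprn_ge0|exact: y|].
  by apply: lerXn2r; rewrite ?nnegrE ?(ltW B0)//; apply: le_trans rB'.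
apply: le_trans (ler_normD _ _) _.
rewrite (normrM (kap / 2)) (normrM kap) (normrM 6^-1) (normrX 2) (normrX 3).
rewrite (ger0_norm (_ : 0 <= 2^-1 :> R)) ?invr_ge0// (ger0_norm (_ : 0 <= 6^-1 :> R)) ?invr_ge0//.
have k1 : `|kap| / 2 * `|v t x| ^+ 2 <= `|kap| / 2 * (r * B) by rewrite ler_wpM2l// divr_ge0.
have -> : D * r = `|kap| / 2 * (r * B) + 6^-1 * (r * B ^+ 2) + r by rewrite /D; ring.
lra.
Qed.

Lemma lyap_small (e : R) : 0 < e -> exists2 m : R, 0 < m & forall t, diss t <= m -> `|lyap t| <= e.
Proof.
move=> e0; have P0 := @period_gt0 R; have [C C0 hC] := lyap_bound.
have B0 : 0 < 1 + P * K by rewrite addr_gt0// mulr_gt0.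
have eC : 0 < e / C by rewrite divr_gt0.
have [r [r0 re rB]] := ex_lt2 eC B0.
have [m1 m10 h1] := phi_small_v r0.
have [m m0 h2] := phi_small m10.
exists m => // t ht; apply: le_trans (hC t r _ (h1 t (h2 t ht))) _; first lra.
by rewrite mulrC -ler_pdivlMr// ltW.
Qed.

(** Over a time [T] the function [lyap] varies by at most [2 * M]. The mean value theorem thus
    yields, on each side of [t], a time where [diss] is at most [m], and monotonicity squeezes
    [lyap t] between two small values. *)
Lemma lyap_eq0 t : lyap t = 0.
Proof.
apply/eqP; rewrite -normr_le0; apply/ler_addgt0Pr => e e0; rewrite add0r.
have P0 := @period_gt0 R; have [C C0 hC] := lyap_bound.
have B0 : 0 < 1 + P * K by rewrite addr_gt0// mulr_gt0.
pose M := C * (1 + P * K); have M0 : 0 < M by rewrite mulr_gt0.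
have lM s : `|lyap s| <= M by apply: hC; [lra|exact: v_bound].
have [m m0 hm] := lyap_small e0.
pose T := 2 * M / m; have T0 : 0 < T by rewrite divr_gt0// mulr_gt0.
have Tm : m * T = 2 * M by rewrite /T mulrC divfK// gt_eqF.
have dis s1 s2 c : s2 = s1 + T -> lyap s2 - lyap s1 = - diss c * (s2 - s1) -> diss c <= m.
  move=> -> E; rewrite -(ler_pM2r T0) Tm.
  have := lM s1; have := lM (s1 + T); rewrite !ler_norml => ? ?.
  by rewrite (_ : diss c * T = - (- diss c * (s1 + T - s1))); [rewrite -E; lra|ring].
have mono s1 s2 : s1 <= s2 -> lyap s2 <= lyap s1.
  move=> s12; have dN : der (fun s => - lyap s) (fun s => - - diss s).
    by move=> s; apply: dvN; exact: der_lyap.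
  have h x : s1 <= x <= s2 -> 0 <= - - diss x by rewrite opprK diss_ge0.
  by have := der_nondecr s12 dN h; rewrite lerN2.
have tT : t - T <= t by lra.
have tT' : t <= t + T by lra.
have [c1 c1t E1] := der_MVT tT der_lyap.
have [c2 c2t E2] := der_MVT tT' der_lyap.
have k1 := hm c1 (dis (t - T) t c1 ltac:(ring) E1).
have k2 := hm c2 (dis t (t + T) c2 erefl E2).
have m1 : lyap t <= lyap c1 by apply: mono; lra.
have m2 : lyap c2 <= lyap t by apply: mono; lra.
by move: k1 k2; rewrite !ler_norml; lra.
Qed.

Lemma confined_solution_eq0 t x : v t x = 0.
Proof.
have d0 s : diss s = 0.
  have := dv_derive1 (der_lyap s); have -> : lyap = fun=> 0 by apply/funext => r; exact: lyap_eq0.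
  by rewrite (dv_derive1 (dv_cst _ _)); lra.
apply/eqP; rewrite -normr_le0; apply/ler_addgt0Pr => e e0; rewrite add0r.
have [m m0 hm] := phi_small_v e0; have [m' m'0 hm'] := phi_small m0.
by apply: hm; apply: hm'; rewrite d0 ltW.
Qed.

End Rigidity.

(** * Unique continuation *)

Section Reduction.
Context {R : realType}.
Notation P := (pi *+ 2 : R).

(** Only the slice at time 0 matters, and the bound is uniform in [h]: this is how the H^1
    regularity of the data enters the energy argument. *)
Lemma H1_energy_bound (f : R -> R) (C : R) : H1 f -> exists K0 : R, forall v : R -> R -> R,
  v 0 = (fun x => f x - C) -> forall h, 0 < h < P -> energy v h 0 <= K0.
Proof.
move=> [pf cf [g wg]]; have P0 := @period_gt0 R.
have [S [cS mS S0 _ hS]] := weak_derivative_holder cf wg.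
pose v0 x := f x - C; have cv0 : continuous v0 by rewrite /v0; ct.
have pv0 : periodic v0 P by move=> x; rewrite /v0 pf.
have [B B0 hB] := compact_le_bound (@segment_compact R 0 P) cv0.
have bv x : `|v0 x| <= B.
  have [y [yP E]] := periodic_reduce 0 x; rewrite (E _ pv0); apply: hB.
  by rewrite add0r in yP; rewrite /= in_itv.
exists (B ^+ 2 * P + 5 * S P) => v vE h hP; rewrite /energy vE -/v0.
have ca : continuous (avg h v0) by exact: ct_avg.
have cd : continuous (dq h v0) by exact: ct_dq.
rewrite JD; [|by ct|by ct]; apply: lerD; last first.
  apply: dq_energy_bound => // x y xy yP.
  by rewrite (_ : v0 y - v0 x = f y - f x); [exact: hS|rewrite /v0; ring].
have cB : continuous (fun _ : R => B ^+ 2) by exact: ct_cst.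
have ca2 : continuous (fun x => avg h v0 x ^+ 2) by ct.
have := le_J ca2 cB (ltW P0) _; rewrite J_cst subr0; apply => x _.
have h0 : 0 < h by lra.
have : `|avg h v0 x| <= B by rewrite -[avg h v0 x]subr0; apply: (avg_near h0 cv0) => y _; rewrite subr0.
by move=> k; rewrite -(real_normK (num_real (avg h v0 x))) lerXn2r ?nnegrE ?(ltW B0).
Qed.

End Reduction.

Theorem theorem1p1 (R : realType) (u : R -> R -> R) (C : R) (omega : set R)
    (T : R) (hu : BBM_solution u) (homega : open_circle omega)
    (homega0 : omega !=set0) (hT : 0 < T)
    (huC : forall t x : R, 0 < t -> t < T -> omega x -> u t x = C) :
  forall t x : R, u t x = C.
Proof.
have [hH hB] := hu; have cu := continuous_H1_cont2 hH.
have pu t : periodic (u t) (pi *+ 2) by have [] := hH.1 t.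
have du := BBM_evolution cu pu hB.
have [oo _] := homega; have [x0 ox0] := homega0.
have uC t x : omega x -> u t x = C.
  move=> ox; apply: (time_unique_continuation cu pu du hT) => s /andP[s0 sT].
  exact: huC.
pose v t x := u t x - C.
pose f t x := (1 + C) * v t x + v t x ^+ 2 / 2.
pose w t := green (f t); pose wx t := dgreen (f t).
have cv : cont2 v by rewrite /cont2 /v; ct.
have cf : cont2 f by rewrite /cont2 /f; ct.
have cft t : continuous (f t) by exact: (cont2_slice t cf).
have pv t : periodic (v t) (pi *+ 2) by move=> x; rewrite /v pu.
have pf t : periodic (f t) (pi *+ 2) by move=> x; rewrite /f pv.
have cw : cont2 w by exact: cont2_green.
have cwx : cont2 wx by exact: cont2_dgreen.
have pw t : periodic (w t) (pi *+ 2) by exact: periodic_green.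
have pwx t : periodic (wx t) (pi *+ 2) by exact: periodic_dgreen.
have dw t : der (w t) (wx t) by exact: der_green.
have dwx t : der (wx t) (fun x => w t x - f t x) by exact: der_dgreen.
(* Expanding the flux at [u = C + v] gives [f] plus a constant, which [dgreen] annihilates; hence
   [kap = 1 + C]. *)
have fluxE t : flux (u t) = fun y => f t y + (C + C ^+ 2 / 2).
  by apply/funext => y; rewrite /flux /f /v; field.
have dtu x : der (u ^~ x) (fun t => - wx t x).
  move=> t; apply: dv_eq (du x t) _.
  rewrite fluxE (dgreenD x (cft t)); last exact: ct_cst.
  by rewrite dgreen_cst addr0.
have dtv x : der (v ^~ x) (fun t => - wx t x).
  move=> t; apply: dv_eq; first by apply: dvD; [exact: dtu|apply: dvN; exact: dv_cst].
  by rewrite subr0.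
have v0 t x : omega x -> v t x = 0 by move=> ox; rewrite /v uC// subrr.
have wx0 t x : omega x -> wx t x = 0.
  move=> ox; have := dv_derive1 (dtu x t).
  have -> : u ^~ x = fun=> C by apply/funext => s; exact: uC.
  by rewrite (dv_derive1 (dv_cst _ _)); lra.
(* As omega is open, [wx t] vanishes near [x0]; its derivative [w - f] is therefore 0 there, and so
   is [f]. *)
have w0 t : w t x0 = 0.
  have : dv x0 (wx t) 0.
    apply: near_eq_is_derive (dv_cst x0 0); near=> x; rewrite wx0//.
    by near: x; exact: open_nbhs_nbhs.
  move=> /dv_derive1; rewrite (dv_derive1 (dwx t x0)) /f v0// expr0n /= mulr0 mul0r; lra.
have [K0 hK0] := H1_energy_bound C (hH.1 0).
have [K Kp hK] := holder_uniform cv cw cwx pv pwx dw dwx dtv (hK0 v erefl).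
move=> t x; have := confined_solution_eq0 cv cw cwx pv pw pwx dw dwx dtv
  (fun t => v0 t x0 ox0) w0 (fun t => wx0 t x0 ox0) Kp hK t x.
by rewrite /v; lra.
Unshelve. all: by end_near. Qed.
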